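(* Let $\alpha\ge1$ and $k\ge1$, and write $j_{\nu,m}$ for the $m$-th positive zero of the Bessel function $J_\nu$. Then there exists a solution $\overline h_{\alpha,k}$ of the problem $$\sup\{\mu_k(h^\alpha): h\in\mathcal{L}\},$$ and moreover: (i) If $\alpha<2$ (put $j:=j_{\frac{\alpha-1}{2},1}$): for $k=1$, $\max\{\mu_1(h^\alpha):h\in\mathcal{L}\}=\mu_1(\overline h_{\alpha,1}^\alpha)=(2j)^2$ and $\overline h_{\alpha,1}(x)=2x$ on $[0,\frac12]$, $\overline h_{\alpha,1}(x)=2(1-x)$ on $[\frac12,1]$; for $k\ge2$, $\max\{\mu_k(h^\alpha):h\in\mathcal{L}\}=\mu_k(\overline h_{\alpha,k}^\alpha)=\big(2j+(k-1)\pi\big)^2$ and, setting $a=\frac{j}{2j+(k-1)\pi}$, $\overline h_{\alpha,k}(x)=\frac xa$ on $[0,a]$, $\overline h_{\alpha,k}(x)=1$ on $[a,1-a]$, $\overline h_{\alpha,k}(x)=\frac{1-x}{a}$ on $[1-a,1]$. (ii) If $\alpha=2$: $\max\{\mu_k(h^2):h\in\mathcal{L}\}=\mu_k(\overline h_{2,k}^2)=\big((k+1)\pi\big)^2$. The maximizer $\overline h_{2,k}$ is given by any function (in $\mathcal{L}$) such that $\overline h_{2,k}(0)=\overline h_{2,k}(1)=0$ and the graph of $\overline h_{2,k}$ is given by at most $k+1$ segments. (iii) If $\alpha>2$ and $k$ is odd: $\mu_k(\overline h_{\alpha,k}^\alpha)=4\,j_{\frac{\alpha-1}{2},\frac{k+1}{2}}^2$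 and $\overline h_{\alpha,k}(x)=2x$ on $[0,\frac12]$, $\overline h_{\alpha,k}(x)=2(1-x)$ on $[\frac12,1]$. (iv) If $\alpha>2$ and $k$ is even: $\mu_k(\overline h_{\alpha,k}^\alpha)=\big(j_{\frac{\alpha-1}{2},\frac k2}+j_{\frac{\alpha-1}{2},\frac{k+2}{2}}\big)^2$ and, setting $a=\frac{j_{\frac{\alpha-1}{2},\frac k2}}{j_{\frac{\alpha-1}{2},\frac k2}+j_{\frac{\alpha-1}{2},\frac{k+2}{2}}}$, $\overline h_{\alpha,k}(x)=\frac xa$ on $[0,a]$, $\overline h_{\alpha,k}(x)=\frac{1-x}{1-a}$ on $[a,1]$.
   Context: $\mathcal{L}=\{h:[0,1]\to[0,1]: h \text{ concave},\ \max h=1\}$. For a non-negative $h\in L^\infty(0,1)$ the relaxed Sturm–Liouville eigenvalues are $$\mu_k(h)=\inf_{E_k}\sup_{0\neq u\in E_k}\frac{\int_0^1(u')^2h\,dx}{\int_0^1u^2h\,dx},\qquad k\ge1,$$ the infimum being over all $k$-dimensional subspaces $E_k$ of $H^1(0,1)$ that are $L^2$-orthogonal to $h$ (i.e. $\int_0^1uh\,dx=0$ for all $u\in E_k$).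
   Formalization: In (ii) the end points of the at most k+1 segments are required to have abscissas among the multiples of 1/(k+1), since with arbitrary break points the claim is false (for k=1, a tent with apex a≠1/2 has μ_1<(2π)^2); exactly the true cases are kept. *)

(* Defs.v *)
From mathcomp Require Import all_boot all_order all_algebra.
From mathcomp Require Import all_classical all_reals all_analysis.

Set Implicit Arguments.
Unset Strict Implicit.
Unset Printing Implicit Defensive.

Import Order.TTheory GRing.Theory Num.Theory.
Import numFieldNormedType.Exports.

Local Open Scope classical_set_scope.
Local Open Scope ring_scope.

Section BesselZeros.
Variable R : realType.
Local Notation leb := (@lebesgue_measure R).

Definition Gamma (s : R) : R :=
  \int[leb]_(t in `]0, +oo[) (t `^ (s - 1) * expR (- t)).

(* J_nu on the positive half-line, for nu > -1 *)
Definition besselJ (nu x : R) : R :=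
  limn (series (fun m : nat =>
    (-1) ^+ m / (m`!%:R * Gamma (m%:R + nu + 1)) * (x / 2) `^ (2 * m%:R + nu))).

(* The m-th positive zero j_{nu,m}, m >= 1: the positive zero z such that
   exactly m zeros lie in ]0, z]. *)
Definition bessel_zero (nu : R) (m : nat) : R :=
  get [set z : R | [/\ 0 < z, besselJ nu z = 0 &
        ([set x | 0 < x <= z /\ besselJ nu x = 0] #= `I_m)%card ]].

End BesselZeros.

(* Functions on [0, 1] are represented by total functions R -> R whose values
   outside [0, 1] play no role. *)

Section Sobolev.
Variable R : realType.
Local Notation leb := (@lebesgue_measure R).
Local Notation I01 := (`]0%R, 1%R[%classic : set R).
Implicit Types (u v h phi : R -> R) (E : set (R -> R)).

Definition L2 u : Prop :=
  measurable_fun I01 u /\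
  leb.-integrable I01 (fun x => (u x ^+ 2)%:E).

Definition test_function phi : Prop :=
  (forall n x, derivable (phi^`(n))%classic x 1) /\
  exists a b : R, [/\ 0 < a, a < b, b < 1 &
    forall x, x < a \/ b < x -> phi x = 0].

Definition weak_derivative u v : Prop :=
  forall phi, test_function phi ->
    \int[leb]_(x in I01) (u x * (phi^`())%classic x) =
    - \int[leb]_(x in I01) (v x * phi x).

Definition H1 u : Prop := L2 u /\ exists2 v, L2 v & weak_derivative u v.

Definition ae0 u : Prop := {ae leb, forall x, I01 x -> u x = 0}.

Definition lincomb k (b : 'I_k -> R -> R) (c : 'I_k -> R) : R -> R :=
  fun x => \sum_(i < k) c i * b i x.

(* Elements of H^1 are classes modulo equality a.e.; a k-dimensional subspace
   is given by representatives of a basis, whose independence is therefore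
   required modulo a.e. equality. *)
Definition H1_subspace (k : nat) E : Prop :=
  exists b : 'I_k -> R -> R,
    [/\ forall i, H1 (b i),
        forall c : 'I_k -> R, ae0 (lincomb b c) -> forall i, c i = 0 &
        E = range (lincomb b)].

Definition orthogonal_to h E : Prop :=
  forall u, E u -> \int[leb]_(x in I01) (u x * h x) = 0.

(* v stands for u'. The quotient is taken in \bar R, where a / 0 = +oo for
   a > 0 and 0 / 0 = 0; the denominator can vanish only if the weight h does
   so on a set of positive measure. *)
Definition rayleigh h u v : \bar R :=
  ((\int[leb]_(x in I01) (v x ^+ 2 * h x)%R%:E) /
   (\int[leb]_(x in I01) (u x ^+ 2 * h x)%R%:E))%E.

Definition sup_rayleigh h E : \bar R :=
  ereal_sup [set q | exists u v,
    [/\ E u, ~ ae0 u, L2 v /\ weak_derivative u v & q = rayleigh h u v]].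

Definition SLeigen (k : nat) h : \bar R :=
  ereal_inf [set sup_rayleigh h E | E in
    [set E | H1_subspace k E /\ orthogonal_to h E]].

End Sobolev.

Section Problem.
Variable R : realType.
Implicit Types (h : R -> R).

Definition classL : set (R -> R) :=
  [set h | [/\ forall x, 0 <= x <= 1 -> 0 <= h x <= 1,
               convex_function (`[0, 1]%classic : set R) (fun x => - h x) &
               exists2 x, 0 <= x <= 1 & h x = 1]].

Definition SLpow (k : nat) (alpha : R) h : \bar R :=
  SLeigen k (fun x => h x `^ alpha).

Definition is_solution (k : nat) (alpha : R) h : Prop :=
  classL h /\
  SLpow k alpha h = ereal_sup [set SLpow k alpha g | g in classL].

Definition affine_between (a b : R) h : Prop :=
  exists p q : R, forall x, a <= x <= b -> h x = p * x + q.

(* The graph consists of at most n segments whose end points have abscissas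
   among 0, 1/n, 2/n, ..., 1. For n = k + 1 these are the zeros of
   sin ((k + 1) pi x). The abscissas cannot be arbitrary: for alpha = 2 and
   k = 1, the tent function with apex at a <> 1/2 is not a maximizer. *)
Definition graph_segments (n : nat) h : Prop :=
  forall i : nat, (i < n)%N ->
    affine_between (i%:R / n%:R) (i.+1%:R / n%:R) h.

End Problem.

(* Main.v *)
(** Fix nodes 0 = x_0 < ... < x_(k+1) = 1.  If every piece [x_i, x_(i+1)]
carries a nonnegative function vanishing at the interior nodes whose Rayleigh
quotient for the weight h^alpha is at most M, then the combinations of these
k+1 functions that are orthogonal to the weight show mu_k <= M.  If on every
piece M is a lower bound for the Rayleigh quotient of the functions vanishing at
the interior nodes, then mu_k >= M: in E_k plus the constants, of dimension k+1,
some nonzero element vanishes at the k interior nodes.  The nodes are the zeros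
of the k-th eigenfunction of the extremal profile.

Upper bound, for any concave h: on a piece compare h with a line l supporting h
at x0.  If u satisfies (l^alpha u')' >= - M l^alpha u and increases before x0 and
decreases after it, then, (h/l)^alpha being unimodal around x0, the layer-cake
formula bounds the Rayleigh quotient of u for h^alpha by M, without
differentiating h.  With u = w / l^(alpha/2) the differential inequality reads
w'' - c (l'/l)^2 w >= - M w, where c = (alpha/2)(alpha/2 - 1), and u' vanishes at
x0 as soon as x0 maximizes w / h^(alpha/2).  For alpha <= 2, c is nonpositive and
w is a sine; for alpha >= 2, c is nonnegative, w(x) = x^(alpha/2) G(s x) with
G(x) proportional to x^-nu J_nu(x), and |l'/l| <= 1/x when x <= 1/2.  On the two
extreme pieces l is x or 1 - x, u is G(s x) or G(s (1 - x)), and h/l is monotone.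

Lower bound: for the extremal profile u is an exact positive solution on every
piece, and Picone's inequality applies. *)

Require Import Defs.
From mathcomp Require Import all_boot all_order all_algebra.
From mathcomp Require Import all_classical all_reals all_analysis.
From mathcomp Require Import measurable_realfun.
From mathcomp Require Import ring lra zify.
Import Order.TTheory GRing.Theory Num.Theory.
Import numFieldNormedType.Exports.
Set Implicit Arguments.
Unset Strict Implicit.
Unset Printing Implicit Defensive.
Local Open Scope classical_set_scope.
Local Open Scope ring_scope.

(** * Integrals and absolutely continuous functions on a segment *)

Section Segments.
Variable R : realType.
Local Notation leb := (@lebesgue_measure R).
Implicit Types (p q r x : R) (f g F G : R -> R).

(** The nodes and the bound [M = s^2] depend only on [alpha] and [k]. The trial functions depend on
    [h] only through a supporting line, and on the two extreme pieces not at all. The value of [s]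
    is fixed by requiring that pieces of lengths [z / s], with [z] a first zero or a gap between
    consecutive zeros, fill [[0, 1]]. The flux [l^alpha u'] must change sign only at [x0]. Besides
    the lower bound [- M w], this calls for [w'' - c (l'/l)^2 w <= 0]. For the sine it holds because
    [c >= -1] and the inner pieces stay at distance at least [1/s] from 0 and 1, which rests on
    [j >= 1]. For the Bessel wave it holds because [c] is less than the square of the first zero.
    The obstacle is the piece around [1/2] when [alpha > 2] and [k] is even: neither [|l'/l| <= 1/x]
    nor [|l'/l| <= 1/(1 - x)] is known there, and the wave has to be chosen according to the
    position of a maximum of [h]. On the extreme pieces the flux vanishes at 0 and 1 together with
    [x^alpha] and [(1 - x)^alpha], so no boundary condition is needed at these ends. *)

Definition itg p q f := leb.-integrable `[p, q] (EFin \o f).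
Definition II p q f := \int[leb]_(x in `[p, q]) f x.

Lemma itg_measurable p q f : itg p q f -> measurable_fun `[p, q] f.
Proof. by move=> /measurable_int /measurable_EFinP. Qed.

Lemma itg_cont p q f : {within `[p, q], continuous f} -> itg p q f.
Proof. by move=> cf; apply: continuous_compact_integrable => //; exact: segment_compact. Qed.

Lemma itgD p q f g : itg p q f -> itg p q g -> itg p q (fun x => f x + g x).
Proof. by move=> If Ig; apply: (integrableD _ If Ig). Qed.

Lemma itgB p q f g : itg p q f -> itg p q g -> itg p q (fun x => f x - g x).
Proof. by move=> If Ig; apply: (integrableB _ If Ig). Qed.

Lemma itgZ p q c f : itg p q f -> itg p q (fun x => c * f x).
Proof. by move=> If; apply: (integrableZl _ c If). Qed.

Lemma itgS p q p' q' f : p <= p' -> q' <= q -> itg p q f -> itg p' q' f.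
Proof.
move=> pp qq; apply: integrableS => //; apply: subset_itv; rewrite bnd_simp //.
Qed.

Lemma IID p q f g : itg p q f -> itg p q g ->
  II p q (fun x => f x + g x) = II p q f + II p q g.
Proof. by move=> If Ig; apply: RintegralD. Qed.

Lemma IIB p q f g : itg p q f -> itg p q g ->
  II p q (fun x => f x - g x) = II p q f - II p q g.
Proof. by move=> If Ig; apply: RintegralB. Qed.

Lemma IIZ p q c f : itg p q f -> II p q (fun x => c * f x) = c * II p q f.
Proof. by move=> If; apply: RintegralZl. Qed.

Lemma eq_II p q f g : {in `[p, q], f =1 g} -> II p q f = II p q g.
Proof. by move=> fg; apply: eq_Rintegral => x; rewrite inE => xx; exact: fg. Qed.

Lemma eq_itg p q f g : {in `[p, q], f =1 g} -> itg p q f -> itg p q g.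
Proof.
move=> fg; apply: eq_integrable => // x; rewrite inE /= => xx.
by rewrite fg.
Qed.

Lemma le_II p q f g : itg p q f -> itg p q g ->
  {in `[p, q], forall x, f x <= g x} -> II p q f <= II p q g.
Proof. by move=> If Ig fg; apply: le_Rintegral. Qed.

Lemma II_ge0 p q f : {in `[p, q], forall x, 0 <= f x} -> 0 <= II p q f.
Proof. by move=> fg; apply: Rintegral_ge0 => x xx; exact: fg. Qed.

Lemma IIxx p f : II p p f = 0.
Proof. by rewrite /II set_itv1 Rintegral_set1. Qed.

Lemma IIcat p q r f : p <= q -> q <= r -> itg p r f ->
  II p r f = II p q f + II q r f.
Proof.
move=> pq qr If; rewrite /II; have := @Rintegral_itvB R f (BLeft p) (BRight r) q If.
rewrite !bnd_simp => /(_ pq qr) /eqP; rewrite subr_eq => /eqP ->.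
rewrite addrC; congr (_ + _); apply: Rintegral_itv_obnd_cbnd.
by apply: integrableS If => //; apply: subset_itv; rewrite bnd_simp.
Qed.

Lemma IIcst p q c : p <= q -> II p q (fun=> c) = c * (q - p).
Proof.
move=> pq; rewrite /II Rintegral_cst//.
have -> : fine (leb `[p, q]) = q - p; last by [].
rewrite (lebesgue_measure_itv `[p, q]) /= lte_fin.
case: ltP => [_|qp]; first by rewrite -EFinD.
by rewrite (_ : q = p) ?subrr//; apply/eqP; rewrite eq_le pq qp.
Qed.

Lemma itg_mul_bnd p q f g : itg p q f -> measurable_fun `[p, q] g ->
  (exists K, {in `[p, q], forall x, `|g x| <= K}) ->
  itg p q (fun x => f x * g x).
Proof.
move=> If mg [K gK]; rewrite /itg.
rewrite (_ : EFin \o _ = ((EFin \o f) \* (EFin \o g))%E)//.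
apply: integrableMl => //.
exists K; split; first by rewrite num_real.
move=> M KM x xx; apply: le_trans (ltW KM); exact: gK.
Qed.

Lemma cont_bnd p q f : {within `[p, q], continuous f} ->
  exists K, {in `[p, q], forall x, `|f x| <= K}.
Proof.
move=> cf; have [K [_ HK]] := compact_bounded (continuous_compact cf (@segment_compact _ p q)).
exists (K + 1) => x xx; apply: HK; first by rewrite ltrDl.
by exists x.
Qed.

Lemma cont_meas p q f : {within `[p, q], continuous f} -> measurable_fun `[p, q] f.
Proof. by move=> cf; apply: subspace_continuous_measurable_fun. Qed.

Lemma itg_mul_cont p q f g : itg p q f -> {within `[p, q], continuous g} ->
  itg p q (fun x => f x * g x).
Proof.
move=> If cg; apply: itg_mul_bnd => //; [exact: cont_meas|exact: cont_bnd].
Qed.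

Lemma itg_norm p q f : itg p q f -> itg p q (fun x => `|f x|).
Proof. by move=> If; apply: integrable_norm. Qed.

(** Fubini on the triangle [p <= y <= x <= q]. It yields integration by parts without any
    differentiability almost everywhere. *)
Lemma II_triangle p q f g : p <= q -> itg p q f -> itg p q g ->
  II p q (fun x => f x * II p x g) = II p q (fun y => g y * II y q f).
Proof.
move=> pq If Ig.
pose f' : R -> R := f \_ `[p, q]; pose g' : R -> R := g \_ `[p, q].
have If' : leb.-integrable setT (EFin \o f').
  by have := If; rewrite /itg integrable_mkcond// restrict_EFin.
have Ig' : leb.-integrable setT (EFin \o g').
  by have := Ig; rewrite /itg integrable_mkcond// restrict_EFin.
have mf' : measurable_fun setT f' by move/measurable_int/measurable_EFinP : If'.
have mg' : measurable_fun setT g' by move/measurable_int/measurable_EFinP : Ig'.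
pose k (z : R * R) : \bar R := (f' z.1 * g' z.2 * (z.2 <= z.1)%R%:R)%:E.
have mk : measurable_fun setT k.
  apply/measurable_EFinP; apply: measurable_funM; first apply: measurable_funM.
  - exact: (measurableT_comp mf' measurable_fst).
  - exact: (measurableT_comp mg' measurable_snd).
  - apply: (@measurableT_comp _ _ _ _ _ _ (fun b : bool => b%:R : R)) => //.
    exact: (measurable_fun_ler measurable_snd measurable_fst).
have Ik : (leb \x leb)%E.-integrable setT k.
  (* The kernel is dominated by [|f' x| |g' y|], whose iterated integral factors. *)
  apply/(integrable12ltyP leb leb mk).
  apply: (@le_lt_trans _ _ (\int[leb]_x ((`|f' x|)%:E * \int[leb]_y (`|g' y|)%:E))%E).
    apply: ge0_le_integral => //.
    - by move=> x _; exact: integral_ge0.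
    - apply: (@measurable_fun_fubini_tonelli_F _ _ _ _ _ leb (abse \o k)) => //.
      + exact: measurableT_comp.
      + by move=> z; exact: abse_ge0.
    - apply: emeasurable_funM => //; apply/measurable_EFinP; exact: measurableT_comp.
    - move=> x _; rewrite -ge0_integralZl//; last first.
        by apply/measurable_EFinP; exact: measurableT_comp.
      apply: ge0_le_integral => //.
      + apply: measurableT_comp => //.
        exact: (measurableT_comp mk (measurable_pair1 x)).
      + by apply: emeasurable_funM => //; apply/measurable_EFinP; exact: measurableT_comp.
      + move=> y _; rewrite /k/= lee_fin 2!normrM.
        by rewrite ler_piMr ?mulr_ge0// normr_nat lern1 leq_b1.
  rewrite ge0_integralZr//.
  - apply: lte_mul_pinfty; [by apply: integral_ge0 => y _; rewrite lee_fin|..].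
    + by apply: integrable_fin_num => //; exact: integrable_norm.
    + by apply: integrable_lty => //; exact: integrable_norm.
  - by apply/measurable_EFinP; exact: measurableT_comp.
  - by apply: integral_ge0 => y _; rewrite lee_fin.
have := @Fubini _ _ _ _ _ leb leb k Ik.
have EE a b h : itg a b h -> (\int[leb]_(x in `[a, b]) (h x)%:E)%E = (II a b h)%:E.
  by move=> Ih; rewrite /II /Rintegral fineK//; apply: integrable_fin_num.
have -> : (\int[leb]_x \int[leb]_y k (x, y) = \int[leb]_(x in `[p, q]) (f x * II p x g)%:E)%E.
  rewrite [RHS]integral_mkcond; apply: eq_integral => x _.
  rewrite patchE; case: ifPn => [|xpq]; last first.
    under eq_integral do rewrite /k/= /f' patchE (negbTE xpq) !mul0r.
    by rewrite integral0.
  rewrite inE/= => xpq; have [px xq] : p <= x /\ x <= q by move: xpq; rewrite in_itv/= => /andP.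
  have Igx : itg p x g by apply: itgS Ig.
  rewrite EFinM -EE// [in RHS]integral_mkcond -integralZl//; last first.
    by rewrite -integrable_mkcond.
  apply: eq_integral => y _; rewrite /k/= /f' /g' !patchE.
  have -> : x \in `[p, q]%classic by rewrite inE.
  rewrite !mem_setE !in_itv/=.
  case: (leP p y) => py /=; last by rewrite mulr0 mul0r mule0.
  case: (leP y x) => yx; first by rewrite (le_trans yx xq) mulr1.
  by rewrite mulr0 mule0.
have -> : (\int[leb]_y \int[leb]_x k (x, y) = \int[leb]_(y in `[p, q]) (g y * II y q f)%:E)%E.
  rewrite [RHS]integral_mkcond; apply: eq_integral => y _.
  rewrite patchE; case: ifPn => [|ypq]; last first.
    under eq_integral do rewrite /k/= /g' patchE (negbTE ypq) mulr0 !mul0r.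
    by rewrite integral0.
  rewrite inE/= => ypq; have [py yq] : p <= y /\ y <= q by move: ypq; rewrite in_itv/= => /andP.
  have Ify : itg y q f by apply: itgS If.
  rewrite EFinM -EE// [in RHS]integral_mkcond -integralZl//; last first.
    by rewrite -integrable_mkcond.
  apply: eq_integral => x _; rewrite /k/= /f' /g' !patchE.
  have -> : y \in `[p, q]%classic by rewrite inE.
  rewrite !mem_setE !in_itv/=.
  case: (leP x q) => xq /=; last by rewrite !andbF !mul0r mule0.
  case: (leP y x) => yx; first by rewrite (le_trans py yx) mulr1 [f x * _]mulrC.
  by rewrite mulr0 mule0.
by rewrite /II /Rintegral => ->.
Qed.

Lemma eq_within_cont p q f g : {in `[p, q], f =1 g} ->
  {within `[p, q], continuous f} -> {within `[p, q], continuous g}.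
Proof.
by move=> fg; apply: subspace_eq_continuous => x; rewrite inE => xx; exact: fg.
Qed.

Lemma within_contM p q f g : {within `[p, q], continuous f} ->
  {within `[p, q], continuous g} -> {within `[p, q], continuous (fun x => f x * g x)}.
Proof. by move=> cf cg x; apply: continuousM; [exact: cf|exact: cg]. Qed.

Lemma within_contD p q f g : {within `[p, q], continuous f} ->
  {within `[p, q], continuous g} -> {within `[p, q], continuous (fun x => f x + g x)}.
Proof. by move=> cf cg x; apply: continuousD; [exact: cf|exact: cg]. Qed.

Lemma within_contB p q f g : {within `[p, q], continuous f} ->
  {within `[p, q], continuous g} -> {within `[p, q], continuous (fun x => f x - g x)}.
Proof. by move=> cf cg x; apply: continuousB; [exact: cf|exact: cg]. Qed.

Lemma within_contN p q f : {within `[p, q], continuous f} ->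
  {within `[p, q], continuous (fun x => - f x)}.
Proof. by move=> cf x; apply: continuousN; exact: cf. Qed.

Lemma within_contV p q f : {in `[p, q], forall x, f x != 0} ->
  {within `[p, q], continuous f} ->
  {within `[p, q], continuous (fun x => (f x)^-1)}.
Proof.
move=> f0 cf; apply/subspace_continuousP => x xx; apply: cvgV; first exact: f0.
by move/subspace_continuousP : cf; exact.
Qed.

Lemma within_cont_cst p q c : {within `[p, q], continuous (fun=> c : R)}.
Proof. by move=> x; exact: cst_continuous. Qed.

(** Absolute continuity, with the derivative as an explicit argument: [f] is one integrable
    representative among all those equal almost everywhere. *)
Definition abscont p q F f := itg p q f /\ {in `[p, q], forall x, F x = F p + II p x f}.

Lemma II_cont p q f : p <= q -> itg p q f ->
  {within `[p, q], continuous (fun x => II p x f)}.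
Proof. by move=> pq If; exact: parameterized_integral_continuous. Qed.

Lemma AC_cont p q F f : p <= q -> abscont p q F f -> {within `[p, q], continuous F}.
Proof.
move=> pq [If HF].
apply: (@eq_within_cont _ _ (fun x => F p + II p x f)) => [x xx|].
  by rewrite -HF.
by apply: within_contD; [exact: within_cont_cst|exact: II_cont].
Qed.

Lemma ACS p q p' q' F f : p <= p' -> p' <= q' -> q' <= q -> abscont p q F f -> abscont p' q' F f.
Proof.
move=> pp pq' qq [If HF]; split; first exact: itgS If.
move=> x; rewrite in_itv/= => /andP[p'x xq'].
have xq := le_trans xq' qq; have px := le_trans pp p'x.
rewrite HF ?in_itv/= ?px// (HF p') ?in_itv/= ?pp ?(le_trans p'x)//.
by rewrite -addrA -IIcat//; exact: itgS If.
Qed.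

(** Once the initial values are split off, two double integrals remain. Exchanging the order in one
    of them puts [II y q f] next to [II p y f], and their sum is the constant [II p q f]. *)
Lemma AC_mul_int p q F G f g : p <= q -> abscont p q F f -> abscont p q G g ->
  II p q (fun x => f x * G x + F x * g x) = F q * G q - F p * G p.
Proof.
move=> pq AF AG; have cF := AC_cont pq AF; have cG := AC_cont pq AG.
case: AF AG => If HF [Ig HG].
have qq : q \in `[p, q] by rewrite in_itv/= pq lexx.
have cIg := II_cont pq Ig; have cIf := II_cont pq If.
have -> : II p q (fun x => f x * G x + F x * g x) =
    II p q (fun x => (G p * f x + F p * g x) + (f x * II p x g + g x * II p x f)).
  by apply: eq_II => x xx; rewrite HF// (HG x)//; ring.
have J1 : itg p q (fun x => f x * II p x g) by apply: itg_mul_cont.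
have J2 : itg p q (fun x => g x * II p x f) by apply: itg_mul_cont.
rewrite IID ?IID ?IIZ//; try by repeat apply: itgD => //; exact: itgZ.
all: try by repeat (apply: itgD || apply: itgZ).
rewrite II_triangle// addrC.
have -> : II p q (fun y => g y * II y q f) + II p q (fun y => g y * II p y f)
   = II p q f * II p q g.
  rewrite -IID//; last first.
    apply: eq_itg (itgB (itgZ (II p q f) Ig) J2) => y; rewrite in_itv/= => /andP[py yq].
    by rewrite (@IIcat p y q)//; ring.
  rewrite -IIZ//; apply: eq_II => y; rewrite in_itv/= => /andP[py yq].
  by rewrite (@IIcat p y q)//; ring.
by rewrite (HF q)// (HG q)//; ring.
Qed.

Lemma AC_mul p q F G f g : p <= q -> abscont p q F f -> abscont p q G g ->
  abscont p q (fun x => F x * G x) (fun x => f x * G x + F x * g x).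
Proof.
move=> pq AF AG; split.
  apply: itgD; first by apply: itg_mul_cont; [case: AF|exact: AC_cont AG].
  apply: (@eq_itg _ _ (fun x => g x * F x)); first by move=> x _; rewrite mulrC.
  by apply: itg_mul_cont; [case: AG|exact: AC_cont AF].
move=> x; rewrite in_itv/= => /andP[px xq].
by rewrite AC_mul_int//; [ring|exact: ACS AF|exact: ACS AG].
Qed.

Lemma ACD p q F G f g : abscont p q F f -> abscont p q G g ->
  abscont p q (fun x => F x + G x) (fun x => f x + g x).
Proof.
move=> [If HF] [Ig HG]; split; first exact: itgD.
move=> x xx; have /andP[px xq] : p <= x <= q by move: xx; rewrite in_itv.
by rewrite HF// HG// IID; [ring|exact: itgS If|exact: itgS Ig].
Qed.

Lemma ACZ p q c F f : abscont p q F f -> abscont p q (fun x => c * F x) (fun x => c * f x).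
Proof.
move=> [If HF]; split; first exact: itgZ.
move=> x xx; have /andP[px xq] : p <= x <= q by move: xx; rewrite in_itv.
by rewrite HF// IIZ; [ring|exact: itgS If].
Qed.

Lemma AC_cst p q c : abscont p q (fun=> c) (fun=> 0).
Proof.
split; first by apply: itg_cont => x; exact: cst_continuous.
move=> x; rewrite in_itv/= => /andP[px xq].
by rewrite IIcst// mul0r addr0.
Qed.

Lemma AC_int p q F f : p <= q -> abscont p q F f -> II p q f = F q - F p.
Proof. by move=> pq [_ HF]; rewrite (HF q) ?in_itv/= ?pq ?lexx//; ring. Qed.

(** The derivative is required only inside, continuity up to the ends. This is enough for the
    fundamental theorem of calculus and admits the power of [x] at the end 0. *)
Definition C1 p q F f := [/\ {in `]p, q[, forall x, is_derive x 1 F (f x)},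
  {within `[p, q], continuous F} & {within `[p, q], continuous f}].

Lemma within_contS p q p' q' f : p <= p' -> q' <= q ->
  {within `[p, q], continuous f} -> {within `[p', q'], continuous f}.
Proof.
by move=> pp qq; apply: continuous_subspaceW; apply: subset_itv; rewrite bnd_simp.
Qed.

Lemma C1_AC p q F f : p <= q -> C1 p q F f -> abscont p q F f.
Proof.
move=> pq [dF cF cf]; split; first exact: itg_cont.
move=> x; rewrite in_itv/= => /andP[]; rewrite le_eqVlt => /predU1P[<-|px] xq.
  by rewrite IIxx addr0.
have cFx : {within `[p, x], continuous F} by apply: within_contS cF.
have /continuous_within_itvP [] := cFx => // _ cl cr.
have := @continuous_FTC2 R f F p x px.
rewrite /II /Rintegral => ->/=; first by ring.
- exact: within_contS cf.
- split=> // y; rewrite in_itv/= => /andP[py yx].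
  by have [] := dF y; rewrite ?in_itv/= ?py ?(lt_le_trans yx).
- move=> y; rewrite in_itv/= => /andP[py yx]; rewrite derive1E.
  by apply: derive_val; apply: dF; rewrite in_itv/= py (lt_le_trans yx).
Qed.

Lemma C1M p q F f G g : C1 p q F f -> C1 p q G g ->
  C1 p q (fun x => F x * G x) (fun x => f x * G x + F x * g x).
Proof.
move=> [dF cF cf] [dG cG cg]; split.
- move=> x xx; apply: is_derive_eq; first by apply: is_deriveM; [exact: dF|exact: dG].
  by rewrite /GRing.scale/=; ring.
- exact: within_contM.
- by apply: within_contD; exact: within_contM.
Qed.

Lemma C1V p q F f : {in `[p, q], forall x, F x != 0} -> C1 p q F f ->
  C1 p q (fun x => (F x)^-1) (fun x => - f x / F x ^+ 2).
Proof.
move=> F0 [dF cF cf]; have cV := within_contV F0 cF; split => //.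
- move=> x xx; apply: is_derive_eq; first apply: is_deriveV; last 1 first.
  + by rewrite /GRing.scale/=; rewrite mulNr mulrC mulNr.
  + by apply: F0; apply: subset_itv_oo_cc xx.
  + exact: dF.
- apply: within_contM; first exact: within_contN.
  apply: (@eq_within_cont _ _ (fun x => (F x)^-1 * (F x)^-1)).
    by move=> x _; rewrite -invfM -expr2.
  exact: within_contM.
Qed.

Lemma C1D p q F f G g : C1 p q F f -> C1 p q G g ->
  C1 p q (fun x => F x + G x) (fun x => f x + g x).
Proof.
move=> [dF cF cf] [dG cG cg]; split.
- by move=> x xx; apply: is_deriveD; [exact: dF|exact: dG].
- exact: within_contD.
- exact: within_contD.
Qed.

Lemma C1_cst p q c : C1 p q (fun=> c) (fun=> 0).
Proof. split; [by move=> x _; exact: is_derive_cst|exact: within_cont_cst|exact: within_cont_cst]. Qed.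

(** A zero integral would make [f] vanish outside a null set, which cannot contain an open
    interval. *)
Lemma II_gt0 p q f : p < q -> itg p q f -> {in `]p, q[, forall x, 0 < f x} -> 0 < II p q f.
Proof.
move=> pq If f0.
have Ifo : leb.-integrable `]p, q[ (EFin \o f).
  by apply: integrableS If => //; apply: subset_itv; rewrite bnd_simp.
have mf : measurable_fun `]p, q[ (EFin \o f) by apply: measurable_int Ifo.
have -> : II p q f = \int[leb]_(x in `]p, q[) f x.
  by rewrite /II /Rintegral -(@integral_itv_bndoo R p q _ true false).
rewrite lt_neqAle; apply/andP; split; last first.
  by apply: Rintegral_ge0 => x xx; exact/ltW/f0.
apply/eqP => h.
have : (\int[leb]_(x in `]p, q[) `|(f x)%:E| = 0)%E.
  transitivity (\int[leb]_(x in `]p, q[) (f x)%:E)%E.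
    by apply: eq_integral => x; rewrite inE/= => xx; rewrite gtr0_norm ?f0.
  have : (\int[leb]_(x in `]p, q[) (f x)%:E)%E \is a fin_num by apply: integrable_fin_num.
  by move=> /fineK <-; rewrite -[fine _]/(\int[leb]_(x in `]p, q[) f x) -h.
move/(ae_eq_integral_abs leb (measurable_itv _) mf) => [N [mN N0 HN]].
have : (leb `]p, q[ <= leb N)%E.
  apply: le_measure; rewrite ?inE// => x xx; apply: HN => /= /(_ xx) [].
  by apply/eqP; rewrite gt_eqF// f0.
rewrite N0 (lebesgue_measure_itv `]p, q[) /= lte_fin pq -EFinD lee_fin.
by rewrite leNgt subr_gt0 pq.
Qed.

Lemma II_eq0 p q f : {in `[p, q], forall x, f x = 0} -> II p q f = 0.
Proof.
by move=> H; rewrite (@eq_II p q f (fun=> 0)) // /II /Rintegral integral0.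
Qed.

End Segments.

(** * Bump functions and weak derivatives *)

Section Smooth.
Variable R : realType.
Implicit Types (f g : R -> R) (x a b c : R) (n m : nat).

Lemma is_derive_fun f g : (forall x, is_derive x 1 f (g x)) ->
  (forall x, derivable f x 1) /\ f^`()%classic = g.
Proof.
move=> fg; split=> [x|]; first by have [] := fg x.
by apply/funext => x; rewrite derive1E; apply: derive_val.
Qed.

Lemma derivable_is_derive f x : derivable f x 1 -> is_derive x 1 f (f^`()%classic x).
Proof. by move=> df; rewrite derive1E; exact: derivableP. Qed.

(** Recursion on the first derivative turns stability under products and compositions into a plain
    induction on [n]. *)
Fixpoint smooth_upto n f : Prop :=
  if n is m.+1 then (forall x, derivable f x 1) /\ smooth_upto m f^`()%classic else True.

Lemma smooth_uptoP n f g : (forall x, is_derive x 1 f (g x)) -> smooth_upto n g ->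
  smooth_upto n.+1 f.
Proof. by move=> /is_derive_fun[df dg] sg; split=> //; rewrite dg. Qed.

Lemma smooth_uptoW n f : smooth_upto n.+1 f -> smooth_upto n f.
Proof. by elim: n f => // n IH f [df sf]; split=> //; exact: IH. Qed.

Lemma smooth_uptoD n f g : smooth_upto n f -> smooth_upto n g ->
  smooth_upto n (fun x => f x + g x).
Proof.
elim: n f g => // n IH f g [df sf] [dg sg]; apply: smooth_uptoP (IH _ _ sf sg) => x.
by apply: is_deriveD; exact: derivable_is_derive.
Qed.

Lemma smooth_uptoM n f g : smooth_upto n f -> smooth_upto n g ->
  smooth_upto n (fun x => f x * g x).
Proof.
elim: n f g => // n IH f g sf sg; have [df sf'] := sf; have [dg sg'] := sg.
apply: (smooth_uptoP _ (smooth_uptoD (IH _ _ sf' (smooth_uptoW sg)) (IH _ _ (smooth_uptoW sf) sg'))) => x.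
apply: is_derive_eq; first by apply: is_deriveM; exact: derivable_is_derive.
by rewrite /GRing.scale/=; ring.
Qed.

Lemma smooth_upto_cst n c : smooth_upto n (fun=> c).
Proof. by elim: n c => // n IH c; apply: (smooth_uptoP _ (IH 0)) => x; exact: is_derive_cst. Qed.

Lemma smooth_uptoZ n c f : smooth_upto n f -> smooth_upto n (fun x => c * f x).
Proof. by apply: smooth_uptoM; exact: smooth_upto_cst. Qed.

Lemma smooth_upto_expR n f : smooth_upto n f -> smooth_upto n (fun x => expR (f x)).
Proof.
elim: n f => // n IH f sf; have [df sf'] := sf.
apply: (smooth_uptoP _ (smooth_uptoM (IH _ (smooth_uptoW sf)) sf')) => x.
by apply: (@is_derive1_comp _ expR f); exact: derivable_is_derive.
Qed.

Lemma smooth_upto_affine n c a f : smooth_upto n f -> smooth_upto n (fun x => f (c * x + a)).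
Proof.
elim: n f => // n IH f [df sf].
apply: (smooth_uptoP _ (smooth_uptoZ c (IH _ sf))) => x.
rewrite mulrC.
apply: (@is_derive1_comp _ f (fun x => c * x + a)); first exact: derivable_is_derive.
by apply: is_derive_eq; rewrite /GRing.scale/=; ring.
Qed.

Lemma smooth_derivable f : (forall n, smooth_upto n f) ->
  forall n x, derivable (f^`(n))%classic x 1.
Proof.
move=> sf n; have : smooth_upto n.+1 f by [].
by elim: n f {sf} => [|n IH] f [df sf] x; [exact: df|rewrite derive1Sn; exact: IH].
Qed.

Lemma derivable_smooth f : (forall n x, derivable (f^`(n))%classic x 1) ->
  forall n, smooth_upto n f.
Proof.
move=> df n; elim: n f df => // n IH f df; split; first exact: (df 0%N).
by apply: IH => m x; rewrite -derive1Sn; exact: df.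
Qed.

(** For [n = 0] this is the classical [exp (- 1/x)] extended by 0; the extra powers of [1/x] make
    the family closed under differentiation. *)
Definition flat n x : R := if 0 < x then x^-1 ^+ n * expR (- x^-1) else 0.

Lemma flat_le0 n x : x <= 0 -> flat n x = 0.
Proof. by rewrite /flat ltNge => ->. Qed.

Lemma flat_gt0 n x : 0 < x -> 0 < flat n x.
Proof. by rewrite /flat => x0; rewrite x0 mulr_gt0 ?expR_gt0// exprn_gt0 ?invr_gt0. Qed.

Lemma flat_ge0 n x : 0 <= flat n x.
Proof. by case: (leP x 0) => x0; [rewrite flat_le0|rewrite ltW ?flat_gt0]. Qed.

(** A single term of the exponential series, [y^(n+1) / (n+1)! <= expR y] at [y = 1/x]. The linear
    bound is what controls [flat] at 0. *)
Lemma flat_small n x : `|flat n x| <= n.+1`!%:R * `|x|.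
Proof.
case: (leP x 0) => x0; first by rewrite flat_le0// normr0 mulr_ge0.
rewrite (ger0_norm (flat_ge0 _ _)) (gtr0_norm x0) /flat x0 expRN.
have := expR_ge1Dxn n (ltW (_ : 0 < x^-1)); rewrite invr_gt0 => /(_ x0) H.
rewrite ler_pdivrMr ?expR_gt0//.
have H2 : x^-1 ^+ n.+1 <= n.+1`!%:R * expR x^-1.
  rewrite mulrC -ler_pdivrMr ?ltr0n ?fact_gt0//.
  by apply: le_trans H; rewrite lerDr.
have -> : x^-1 ^+ n = x * x^-1 ^+ n.+1 by rewrite exprS mulrA divff ?mul1r// gt_eqF.
by rewrite -mulrA mulrCA ler_pM2l.
Qed.

Lemma flat_derive n x : is_derive x 1 (flat n) (flat n.+2 x - n%:R * flat n.+1 x).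
Proof.
case: (ltgtP x 0) => x0.
- rewrite !flat_le0 ?(ltW x0)// mulr0 subr0.
  apply: (@near_eq_is_derive _ _ _ (fun=> 0)) => //.
  by near=> y; rewrite flat_le0// ltW//; near: y; exact: lt_nbhsl.
- have -> : flat n.+2 x - n%:R * flat n.+1 x =
    x^-1 ^+ n.+2 * expR (- x^-1) - n%:R * (x^-1 ^+ n.+1 * expR (- x^-1)).
    by rewrite /flat x0.
  apply: (@near_eq_is_derive R R R (fun y : R => (y^-1 ^+ n * expR (- y^-1) : R))).
    by near=> y; rewrite /flat ifT//; near: y; exact: lt_nbhsr.
  have dV : is_derive x 1 (fun y : R => y^-1) (- x ^- 2).
    have x00 : id x != 0 by rewrite gt_eqF.
    apply: (is_derive_eq (is_deriveV x00 (is_derive_id x 1))).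
    by rewrite /GRing.scale/= mulr1.
  have dX := is_deriveX n dV; rewrite exprfctE in dX.
  have dE := @is_derive1_comp _ expR (fun y : R => - y^-1) x _ _ (is_derive_expR _) (is_deriveN dV).
  apply: (is_derive_eq (is_deriveM dX dE)).
  rewrite /GRing.scale/= opprK -exprVn.
  case: n {dX} => [|n] /=; first by ring.
  by rewrite !exprS; ring.
(* At 0 the difference quotient of [flat n] is [flat n.+1], continuous there by [flat_small]. *)
- rewrite x0 !flat_le0// mulr0 subr0; apply/is_derive1_caratheodory.
  exists (flat n.+1); split; last by rewrite flat_le0.
  + move=> z; rewrite subr0 (flat_le0 _ (lexx 0)) subr0 /flat.
    case: ifPn => z0; last by rewrite mul0r.
    by rewrite exprS; move: (z^-1 ^+ n) (expR _) => t e; field; rewrite gt_eqF.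
  + rewrite /prop_for /continuous_at (flat_le0 _ (lexx 0)).
    apply/cvgr0Pnorm_le => e e0.
    have d0 : 0 < e / n.+2`!%:R by rewrite divr_gt0// ltr0n fact_gt0.
    near=> y; apply: (le_trans (flat_small _ _)).
    rewrite mulrC -ler_pdivlMr; last by rewrite ltr0n fact_gt0.
    near: y; exact: (@nbhs0_le _ R^o).
Unshelve. all: by end_near. Qed.

Lemma smooth_flat n m : smooth_upto n (flat m).
Proof.
elim: n m => // n IH m; apply: (smooth_uptoP (flat_derive m)).
have -> : (fun x => flat m.+2 x - m%:R * flat m.+1 x) =
  (fun x => flat m.+2 x + (- m%:R) * flat m.+1 x) by apply/funext => x; rewrite mulNr.
by apply: smooth_uptoD => //; apply: smooth_uptoZ.
Qed.

(** The product of the two [flat] factors is positive exactly on []a, b[], so these functions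
    increase with [m] to the indicator of that interval while staying in [[0, 1]]. *)
Definition bump a b m x : R := 1 - expR (- m%:R * (flat 0 (x - a) * flat 0 (b - x))).

Lemma smooth_bump a b m n : smooth_upto n (bump a b m).
Proof.
rewrite /bump.
have -> : (fun x => 1 - expR (- m%:R * (flat 0 (x - a) * flat 0 (b - x)))) =
  (fun x => 1 + (-1) * expR (- m%:R * (flat 0 (1 * x + (- a)) * flat 0 ((-1) * x + b)))).
  by apply/funext => x; rewrite mul1r !mulN1r [- x + b]addrC.
apply: smooth_uptoD; first exact: smooth_upto_cst.
apply: smooth_uptoZ; apply: smooth_upto_expR; apply: smooth_uptoZ.
by apply: smooth_uptoM; apply: smooth_upto_affine; exact: smooth_flat.
Qed.

Lemma bump_out a b m x : ~~ (a < x < b) -> bump a b m x = 0.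
Proof.
rewrite negb_and -!leNgt => /orP[] h; rewrite /bump.
  by rewrite flat_le0 ?subr_le0// mul0r mulr0 expR0 subrr.
by rewrite (flat_le0 _ (_ : b - x <= 0)) ?subr_le0// !mulr0 expR0 subrr.
Qed.

Lemma bump_01 a b m x : 0 <= bump a b m x <= 1.
Proof.
by rewrite /bump subr_ge0 expR_le1 mulNr oppr_le0 mulr_ge0 ?mulr_ge0 ?flat_ge0//= lerBlDr lerDl expR_ge0.
Qed.

Lemma bump_gt0 a b m x : (0 < m)%N -> a < x < b -> 0 < bump a b m x.
Proof.
move=> m0 /andP[ax xb]; rewrite /bump subr_gt0 expR_lt1 mulNr oppr_lt0.
by rewrite mulr_gt0 ?ltr0n// mulr_gt0 ?flat_gt0 ?subr_gt0.
Qed.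

Lemma bump_cvg a b x : bump a b m x @[m --> \oo] --> (\1_`]a, b[ x : R).
Proof.
rewrite indicE mem_setE in_itv/=; case: (boolP (a < x < b)) => axb.
  rewrite -[1%:R]subr0 /bump; apply: cvgB; first exact: cvg_cst.
  set c := flat 0 _ * _; have c0 : 0 < c.
    by case/andP: axb => ax xb; rewrite /c mulr_gt0 ?flat_gt0 ?subr_gt0.
  rewrite (_ : (fun m => _) = (fun m => (expR (- c)) ^+ m)).
    by apply: cvg_expr; rewrite ger0_norm ?expR_ge0// expR_lt1 oppr_lt0.
  by apply/funext => m; rewrite -expRM_natl mulrN mulNr.
rewrite (_ : bump a b ^~ x = fun=> 0); first exact: cvg_cst.
by apply/funext => m; rewrite bump_out.
Qed.

Lemma bump_test a b m : 0 < a -> a < b -> b < 1 -> test_function (bump a b m).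
Proof.
move=> a0 ab b1; split; first by apply: smooth_derivable => n; exact: smooth_bump.
exists a, b; split=> // x xab; rewrite bump_out// negb_and -!leNgt.
by case: xab => /ltW ->; rewrite ?orbT.
Qed.

End Smooth.

(** * Square integrable functions and weak derivatives on the unit interval *)

Section WeakDerivatives.
Variable R : realType.
Local Notation leb := (@lebesgue_measure R).
Local Notation I01 := (`]0%R, 1%R[%classic : set R).
Implicit Types (u v f g phi : R -> R) (a b c x p q : R).

Lemma ae_mono (P Q : R -> Prop) : (forall x, P x -> Q x) ->
  {ae leb, forall x, P x} -> {ae leb, forall x, Q x}.
Proof. by move=> PQ; apply: negligibleS => x; apply: contra_not; exact: PQ. Qed.

Lemma ae_and (P Q : R -> Prop) : {ae leb, forall x, P x} -> {ae leb, forall x, Q x} ->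
  {ae leb, forall x, P x /\ Q x}.
Proof.
move=> aP aQ; apply: negligibleS (negligibleU aP aQ) => x /= /not_andP[]; by [left|right].
Qed.

Lemma meas_oo p q f : measurable_fun (`]p, q[%classic : set R) f <->
  measurable_fun (`[p, q]%classic : set R) f.
Proof.
apply: (iff_trans (measurable_fun_itv_obnd_cbndP p (BLeft q) f)).
exact: measurable_fun_itv_bndo_bndcP.
Qed.

Lemma integrable_oo p q f : leb.-integrable `]p, q[ (EFin \o f) <-> itg p q f.
Proof.
split; last first.
  by apply: integrableS => //; apply: subset_itv; rewrite bnd_simp.
move=> If; have /measurable_int/measurable_EFinP mf := If.
apply/integrableP; split; first exact/measurable_EFinP/meas_oo.
have /integrableP[_] := If.
rewrite -[X in (X < _)%E -> _]/(\int[leb]_(x in `]p, q[) ((abse \o (EFin \o f)) x))%E.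
rewrite -(@integral_itv_bndoo R p q _ true false)//.
by apply: measurableT_comp => //; exact/measurable_EFinP.
Qed.

Lemma eq_itg_oo p q f g : {in `]p, q[, f =1 g} -> itg p q f -> itg p q g.
Proof.
move=> fg /integrable_oo If; apply/integrable_oo; apply: eq_integrable If => //.
by move=> x; rewrite inE /= => xx; rewrite fg.
Qed.

Lemma meas_I01 f : measurable_fun I01 f <-> measurable_fun (`[0%R, 1%R]%classic : set R) f.
Proof. exact: meas_oo. Qed.

Lemma integrable_I01 f : leb.-integrable I01 (EFin \o f) <-> itg 0 1 f.
Proof. exact: integrable_oo. Qed.

Lemma Rint_I01 f : itg 0 1 f -> \int[leb]_(x in I01) f x = II 0 1 f.
Proof.
move=> /itg_measurable/meas_I01 mf; rewrite /II /Rintegral.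
by rewrite -(@integral_itv_bndoo R 0 1 _ true false)//; exact/measurable_EFinP.
Qed.

Lemma EFin_II p q f : itg p q f -> (\int[leb]_(x in `[p, q]) (f x)%:E)%E = (II p q f)%:E.
Proof. by move=> If; rewrite /II /Rintegral fineK//; apply: integrable_fin_num. Qed.

Lemma EFin_I01 f : itg 0 1 f -> (\int[leb]_(x in I01) (f x)%:E)%E = (II 0 1 f)%:E.
Proof.
move=> If; rewrite -EFin_II// -(@integral_itv_bndoo R 0 1 _ true false)//.
by apply/measurable_EFinP/meas_I01; exact: itg_measurable If.
Qed.

Lemma itg_dom p q f g : measurable_fun `[p, q] f ->
  {in `[p, q], forall x, `|f x| <= g x} -> itg p q g -> itg p q f.
Proof.
move=> mf fg; apply: le_integrable => //; first exact/measurable_EFinP.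
move=> x xx /=; rewrite lee_fin; apply: le_trans (fg _ xx) _; exact: ler_norm.
Qed.

Lemma L2P u : L2 u <-> measurable_fun (`[0%R, 1%R]%classic : set R) u /\
  itg 0 1 (fun x => u x ^+ 2).
Proof.
rewrite /L2; split=> -[mu iu]; split.
- exact/meas_I01.
- exact/integrable_I01.
- exact/meas_I01.
- exact/integrable_I01.
Qed.

Lemma L2_mul u v : L2 u -> L2 v -> itg 0 1 (fun x => u x * v x).
Proof.
move=> /L2P[mu iu] /L2P[mv iv].
apply: (@itg_dom _ _ _ (fun x => u x ^+ 2 + v x ^+ 2)); last exact: itgD.
  exact: measurable_funM.
move=> x _; rewrite ler_norml; apply/andP; split.
  have := sqr_ge0 (u x + v x); rewrite sqrrD; have := sqr_ge0 (u x); have := sqr_ge0 (v x); lra.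
have := sqr_ge0 (u x - v x); rewrite sqrrB; have := sqr_ge0 (u x); have := sqr_ge0 (v x); lra.
Qed.

Lemma L2_cont u : {within `[0, 1], continuous u} -> L2 u.
Proof.
move=> cu; apply/L2P; split; first exact: cont_meas.
apply: itg_cont; apply: (@eq_within_cont _ _ _ (fun x => u x * u x)).
  by move=> x _; rewrite expr2.
exact: within_contM.
Qed.

Lemma L2_itg u : L2 u -> itg 0 1 u.
Proof.
move=> uL; have := L2_mul uL (L2_cont (@within_cont_cst _ 0 1 1)).
by apply: eq_itg => x _; rewrite mulr1.
Qed.

Lemma L2D u v : L2 u -> L2 v -> L2 (fun x => u x + v x).
Proof.
move=> uL vL; have iuv := L2_mul uL vL; move: uL vL => /L2P[mu iu] /L2P[mv iv].
apply/L2P; split; first exact: measurable_funD.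
have := itgD (itgD iu iv) (itgZ 2 iuv); apply: eq_itg => x _; ring.
Qed.

Lemma L2Z c u : L2 u -> L2 (fun x => c * u x).
Proof.
move=> /L2P[mu iu]; apply/L2P; split; first exact: measurable_funM.
by have := itgZ (c ^+ 2) iu; apply: eq_itg => x _; rewrite exprMn.
Qed.

Lemma II_dct p q (f_ : nat -> R -> R) f g :
  (forall n, measurable_fun `[p, q] (f_ n)) ->
  {in `[p, q], forall x, f_ n x @[n --> \oo] --> f x} ->
  (forall n, {in `[p, q], forall x, `|f_ n x| <= g x}) -> itg p q g ->
  itg p q f /\ II p q (f_ n) @[n --> \oo] --> II p q f.
Proof.
move=> mf cf bf ig.
have mf' : measurable_fun `[p, q] f.
  apply/measurable_EFinP; apply: (@emeasurable_fun_cvg _ _ _ _ (fun n => EFin \o f_ n)) => // [n|x xx].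
    by apply/measurable_EFinP; exact: mf.
  by apply: cvg_EFin; [exact: nearW|exact: cf].
have [||||||If _ cI] := @dominated_convergence _ _ R leb `[p, q] _ (fun n => EFin \o f_ n) (EFin \o f) (EFin \o g) => //.
- by move=> n; apply/measurable_EFinP; exact: mf.
- exact/measurable_EFinP.
- by apply: aeW => x xx; apply: cvg_EFin; [exact: nearW|exact: cf].
- by apply: aeW => x xx n; rewrite /= lee_fin; exact: bf.
split=> //; rewrite /II /Rintegral; apply: fine_cvg; rewrite fineK; last exact: integrable_fin_num.
exact: cI.
Qed.

Lemma test_cont phi : test_function phi -> forall x, {for x, continuous phi}.
Proof. by move=> [dphi _] x; apply/differentiable_continuous/derivable1_diffP/(dphi 0%N). Qed.

Lemma test_C1 phi : test_function phi -> C1 0 1 phi (phi^`()%classic).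
Proof.
move=> tphi; have [dphi _] := tphi; split.
- by move=> x _; apply: derivable_is_derive; exact: (dphi 0%N).
- by apply: continuous_subspaceT => x; exact: test_cont.
- apply: continuous_subspaceT => x.
  by apply/differentiable_continuous/derivable1_diffP/(dphi 1%N).
Qed.

Lemma test_ends phi : test_function phi -> phi 0 = 0 /\ phi 1 = 0.
Proof. by move=> [_ [a [b [a0 ab b1 phi0]]]]; split; apply: phi0; [left|right]. Qed.

(** Dominated convergence along the bumps, which tend to the indicator of []a, b[]. *)
Lemma II_bump v a b : 0 < a -> a < b -> b < 1 -> itg 0 1 v ->
  (forall phi, test_function phi -> II 0 1 (fun x => v x * phi x) = 0) -> II a b v = 0.
Proof.
move=> a0 ab b1 Iv H.
have [] := @II_dct 0 1 (fun n x => v x * bump a b n x) (fun x => v x * \1_(`]a, b[%classic) x) (fun x => `|v x|).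
- move=> n; apply: measurable_funM; first exact: itg_measurable Iv.
  by apply: cont_meas; apply: continuous_subspaceT; exact: (test_cont (bump_test _ _ _ _)).
- by move=> x _; apply: cvgM; [exact: cvg_cst|exact: bump_cvg].
- by move=> n x _; have /andP[h0 h1] := bump_01 a b n x; rewrite normrM (ger0_norm h0) ler_piMr.
- exact: itg_norm.
move=> _; rewrite (_ : (fun n => _) = fun=> 0); last first.
  by apply/funext => n; apply: H; exact: bump_test.
move=> h; have /cvg_lim := h; rewrite lim_cst// => /(_ (@Rhausdorff R)) {h} h.
apply: etrans (esym h).
rewrite /II [RHS]Rintegral_mkcond; rewrite -Rintegral_itv_obnd_cbnd; last first.
  by apply: integrableS Iv => //; apply: subset_itv; rewrite bnd_simp ?ltW// (lt_trans ab).
rewrite -Rintegral_itv_bndo_bndc; last first.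
  by apply: integrableS Iv => //; apply: subset_itv; rewrite bnd_simp ltW.
rewrite [LHS]Rintegral_mkcond; apply: eq_Rintegral => x _.
rewrite !patchE indicE !mem_setE !in_itv/=.
case: ifPn => [/andP[ax xb]|]; last by rewrite mulr0; case: ifP.
by rewrite (ltW (lt_trans a0 ax)) (ltW (lt_trans xb b1)) mulr1.
Qed.

(** By Lebesgue differentiation the primitive of [v] has derivative [v x] at almost every [x]; here
    this primitive is locally constant. *)
Lemma ae0_II v : itg 0 1 v -> (forall a b, 0 < a -> a < b -> b < 1 -> II a b v = 0) -> ae0 v.
Proof.
move=> Iv H; pose w : R -> R := v \_ `[0, 1].
have Iw : leb.-integrable setT (EFin \o w).
  by have := Iv; rewrite /itg integrable_mkcond// restrict_EFin.
have lw : locally_integrable setT w by apply: open_integrable_locally => //; exact: openT.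
have Iwy y : leb.-integrable [set` Interval (BLeft 0) (BRight y)] (EFin \o w).
  exact: integrableS Iw.
apply: ae_mono (FTC1 Iwy lw) => x /= HF; rewrite in_itv/= => /andP[x0 x1].
have [] := HF; first by rewrite ?lte_fin.
move=> _ /[!derive1E] dF; rewrite -[v x](_ : w x = _); last first.
  by rewrite /w patchE mem_setE in_itv/= !ltW.
rewrite -dF; transitivity ('D_1 (fun=> II 0 x v) x); last exact: derive_cst.
apply: near_eq_derive.
have d0 : 0 < x / 2 by rewrite divr_gt0.
near=> y.
have y0 : x / 2 < y by near: y; apply: lt_nbhsr; lra.
have y1 : y < 1 by near: y; exact: lt_nbhsl.
have IIw z : z < 1 -> II 0 z w = II 0 z v.
  move=> z1; apply: eq_II => t; rewrite in_itv/= => /andP[t0 tz].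
  by rewrite /w patchE mem_setE in_itv/= t0 (le_trans tz (ltW z1)).
rewrite -[LHS]/(II 0 y w) IIw//.
have [xy|yx] := ltP x y.
  rewrite (@IIcat _ 0 x y) ?(ltW x0) ?(ltW xy) ?(H x y) ?addr0//.
  by apply: (@itgS _ 0 1) => //; exact: ltW.
have [->//|yx'] := eqVneq y x.
have ltyx : y < x by rewrite lt_neqAle yx' yx.
rewrite (@IIcat _ 0 y x) ?(H y x) ?addr0//; try lra.
by apply: (@itgS _ 0 1) => //; exact: ltW.
Unshelve. all: by end_near. Qed.

Lemma fundamental_lemma v : itg 0 1 v ->
  (forall phi, test_function phi -> II 0 1 (fun x => v x * phi x) = 0) -> ae0 v.
Proof. by move=> Iv H; apply: ae0_II => // a b a0 ab b1; exact: II_bump. Qed.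

Lemma test_smooth phi : test_function phi -> forall n, smooth_upto n phi.
Proof. by move=> [dphi _]; exact: derivable_smooth. Qed.

(** The primitive from 0 vanishes to the left of the support of [psi], and to its right because the
    total integral is 0. *)
Lemma test_integral (psi : R -> R) : test_function psi -> II 0 1 psi = 0 ->
  exists2 phi : R -> R, test_function phi & phi^`()%classic = psi.
Proof.
move=> tpsi I0; have [dpsi [a [b [a0 ab b1 psi0]]]] := tpsi.
have cpsi : continuous psi by move=> x; exact: test_cont.
have Ipsi p q : itg p q psi by apply: itg_cont; exact: continuous_subspaceT.
have Z p q : (forall x, p <= x <= q -> psi x = 0) -> II p q psi = 0.
  by move=> H; apply: II_eq0 => x; rewrite in_itv/=; exact: H.
pose phi x := II 0 x psi.
have phi_a x : x < a -> phi x = 0.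
  by move=> xa; apply: Z => y /andP[_ yx]; apply: psi0; left; exact: le_lt_trans xa.
have dphi x : is_derive x 1 phi (psi x).
  have [xa|ax] := ltP x a.
    rewrite psi0; last by left.
    apply: (@near_eq_is_derive _ _ _ (fun=> 0)) => //.
    by near=> y; rewrite phi_a//; near: y; exact: lt_nbhsl.
  have x0 : 0 < x by exact: lt_le_trans ax.
  have xx1 : x < x + 1 by rewrite ltrDl.
  have [dp <-] := continuous_FTC1_closed xx1 (Ipsi _ _) x0 (cpsi x).
  exact: derivable_is_derive.
exists phi; last by have [] := is_derive_fun dphi.
split.
  apply: smooth_derivable => n; apply: smooth_uptoW; apply: (smooth_uptoP dphi).
  exact: test_smooth.
(* A point strictly between [b] and 1 is taken because [psi0] says nothing at [b] itself. *)
exists a, ((b + 1) / 2); split=> //; try lra.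
move=> x [xa|bx]; first exact: phi_a.
have x0 : 0 <= (b + 1) / 2 by lra.
rewrite /phi (@IIcat _ 0 ((b + 1) / 2) x) ?(ltW bx)//.
rewrite (Z ((b + 1) / 2) x) => [|y /andP[yb _]]; last by apply: psi0; right; lra.
rewrite -[RHS]I0 (@IIcat _ 0 ((b + 1) / 2) 1)//; last by lra.
by rewrite (Z ((b + 1) / 2) 1)// => y /andP[yb _]; apply: psi0; right; lra.
Unshelve. all: by end_near. Qed.

Lemma test_lin (phi psi : R -> R) c : test_function phi -> test_function psi ->
  test_function (fun x => phi x + c * psi x).
Proof.
move=> tphi tpsi; split.
  apply: smooth_derivable => n; apply: smooth_uptoD; first exact: test_smooth.
  by apply: smooth_uptoZ; exact: test_smooth.
have [_ [a [b [a0 ab b1 phi0]]]] := tphi; have [_ [a' [b' [a0' ab' b1' psi0]]]] := tpsi.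
exists (Num.min a a'), (Num.max b b'); split.
- by rewrite lt_min a0.
- by rewrite gt_min !lt_max ab.
- by rewrite gt_max b1.
- move=> x; rewrite lt_min gt_max => -[/andP[h1 h2]|/andP[h1 h2]].
    by rewrite phi0 ?psi0 ?mulr0 ?addr0//; left.
  by rewrite phi0 ?psi0 ?mulr0 ?addr0//; right.
Qed.

Lemma test_itg phi : test_function phi -> itg 0 1 phi.
Proof. by move=> /test_C1[_ c _]; exact: itg_cont. Qed.

Lemma AC_weak f g : abscont 0 1 f g -> weak_derivative f g.
Proof.
move=> ACf phi tphi; have [p0 p1] := test_ends tphi.
have C1p := test_C1 tphi; have ACp := C1_AC ler01 C1p.
have [If _] := ACf.
have := AC_mul_int ler01 ACf ACp; rewrite p0 p1 !mulr0 subrr => H.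
have I1 : itg 0 1 (fun x => g x * phi x) by apply: itg_mul_cont => //; case: C1p.
have I2 : itg 0 1 (fun x => f x * phi^`()%classic x).
  apply: itg_cont; apply: within_contM; first exact: AC_cont ACf.
  by case: C1p.
rewrite !Rint_I01//; apply/eqP; rewrite -addr_eq0 addrC -IID//; exact/eqP.
Qed.

(* With [psi0] of integral 1, every test function [psi] is, up to a multiple
   of [psi0], the derivative of a test function. *)
Lemma du_bois_reymond u v : L2 u -> L2 v -> weak_derivative u v ->
  exists c, {ae leb, forall x, I01 x -> u x = c + II 0 x v}.
Proof.
move=> Lu Lv uv; have Iu := L2_itg Lu; have Iv := L2_itg Lv.
pose V x := II 0 x v; have ACV : abscont 0 1 V v.
  by split=> // x _; rewrite /V IIxx add0r.
have cV := AC_cont ler01 ACV.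
pose f x := u x - V x.
have If : itg 0 1 f by apply: itgB => //; exact: itg_cont.
have Ip g phi : itg 0 1 g -> test_function phi -> itg 0 1 (fun x => g x * phi x).
  by move=> Ig /test_C1[_ c _]; exact: itg_mul_cont.
have f0 phi : test_function phi -> II 0 1 (fun x => f x * phi^`()%classic x) = 0.
  move=> tphi; have cp : {within `[0, 1], continuous phi^`()%classic} by case: (test_C1 tphi).
  have E1 := uv _ tphi; have E2 := AC_weak ACV tphi.
  have J1 := itg_mul_cont Iu cp; have J2 := itg_cont (within_contM cV cp).
  have J3 := Ip _ _ Iv tphi; rewrite !Rint_I01// in E1 E2.
  rewrite (@eq_II _ _ _ _ (fun x => u x * phi^`()%classic x - V x * phi^`()%classic x)).
    by rewrite IIB// E1 E2 subrr.
  by move=> x _; rewrite mulrBl.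
have h12 : (1 / 4 : R) < 1 / 2 by lra.
pose psi1 : R -> R := bump (1 / 4) (1 / 2) 1.
have tpsi1 : test_function psi1 by apply: bump_test; lra.
have cpsi1 : {within `[0, 1], continuous psi1} by case: (test_C1 tpsi1).
have m0 : II 0 1 psi1 != 0.
  rewrite gt_eqF// (@IIcat _ 0 (1 / 4) 1)//; try lra; last exact: itg_cont.
  rewrite (@IIcat _ (1 / 4) (1 / 2) 1)//; try lra; last first.
    by apply: itgS (itg_cont cpsi1) => //; lra.
  rewrite addrCA ltr_wpDr//.
    by apply: addr_ge0; apply: II_ge0 => x _; have /andP[] := bump_01 (1 / 4) (1 / 2) 1%N x.
  apply: II_gt0 => //; first by apply: itgS (itg_cont cpsi1); lra.
  by move=> x; rewrite in_itv/= => xx; exact: bump_gt0.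
(* This value makes [f - c] orthogonal to [psi1], and therefore to every test function. *)
pose c := II 0 1 (fun x => f x * psi1 x) / II 0 1 psi1.
exists c.
have Ifc : itg 0 1 (fun x => f x - c) by apply: itgB => //; apply: itg_cont; exact: within_cont_cst.
have : ae0 (fun x => f x - c).
  apply: fundamental_lemma => // psi tpsi.
  pose d := - (II 0 1 psi / II 0 1 psi1).
  have tl := test_lin d tpsi tpsi1.
  have J1 := Ip _ _ If tpsi; have J2 := Ip _ _ If tpsi1.
  have [|phi tphi Ephi] := test_integral tl.
    rewrite IID; [|exact: test_itg|exact: itgZ (test_itg _)].
    by rewrite IIZ; [rewrite /d; field|exact: test_itg].
  have := f0 _ tphi; rewrite Ephi.
  rewrite (@eq_II _ _ _ _ (fun x => f x * psi x + d * (f x * psi1 x))); last by move=> x _; ring.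
  rewrite IID//; last exact: itgZ.
  rewrite IIZ// => H.
  rewrite (@eq_II _ _ _ _ (fun x => f x * psi x - c * psi x)); last by move=> x _; ring.
  rewrite IIB//; last exact: itgZ (test_itg _).
  rewrite IIZ; last exact: test_itg.
  by rewrite -[RHS]H /d /c; field.
apply: ae_mono => x H x01; have := H x01; rewrite /f /V; lra.
Qed.

(** Needed because [sup_rayleigh] admits every representative [v] of the weak derivative. *)
Lemma weak_derivative_uniq u v w : L2 v -> L2 w ->
  weak_derivative u v -> weak_derivative u w ->
  {ae leb, forall x, I01 x -> v x = w x}.
Proof.
move=> Lv Lw uv uw; have Iv := L2_itg Lv; have Iw := L2_itg Lw.
have : ae0 (fun x => v x - w x).
  apply: fundamental_lemma; first exact: itgB.
  move=> phi tphi; have E1 := uv _ tphi; have := uw _ tphi; rewrite E1.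
  have [_ c _] := test_C1 tphi.
  rewrite !Rint_I01; [|exact: itg_mul_cont|exact: itg_mul_cont].
  move=> /oppr_inj E.
  rewrite (@eq_II _ _ _ _ (fun x => v x * phi x - w x * phi x)); last by move=> x _; ring.
  by rewrite IIB ?E ?subrr//; exact: itg_mul_cont.
apply: ae_mono => x H x01; have := H x01; lra.
Qed.

Lemma weak_derivativeD u1 v1 u2 v2 : L2 u1 -> L2 v1 -> L2 u2 -> L2 v2 ->
  weak_derivative u1 v1 -> weak_derivative u2 v2 ->
  weak_derivative (fun x => u1 x + u2 x) (fun x => v1 x + v2 x).
Proof.
move=> Lu1 Lv1 Lu2 Lv2 H1 H2 phi tphi.
have [_ c c'] := test_C1 tphi.
have mc (g h : R -> R) : L2 g -> {within `[0, 1], continuous h} -> itg 0 1 (fun x => g x * h x).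
  by move=> Lg ch; apply: itg_mul_cont => //; exact: L2_itg.
have := H1 _ tphi; have := H2 _ tphi.
have md (g1 g2 h : R -> R) : L2 g1 -> L2 g2 -> {within `[0, 1], continuous h} ->
    II 0 1 (fun x => (g1 x + g2 x) * h x) = II 0 1 (fun x => g1 x * h x) + II 0 1 (fun x => g2 x * h x).
  move=> Lg1 Lg2 ch; rewrite -IID; [|exact: mc|exact: mc].
  by apply: eq_II => x _; ring.
rewrite !Rint_I01; try (by apply: mc => //; exact: L2D); try exact: mc.
rewrite !md// => -> ->; ring.
Qed.

Lemma weak_derivativeZ a u v : L2 u -> L2 v -> weak_derivative u v ->
  weak_derivative (fun x => a * u x) (fun x => a * v x).
Proof.
move=> Lu Lv H phi tphi.
have [_ c c'] := test_C1 tphi.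
have mc (g h : R -> R) : L2 g -> {within `[0, 1], continuous h} -> itg 0 1 (fun x => g x * h x).
  by move=> Lg ch; apply: itg_mul_cont => //; exact: L2_itg.
have := H _ tphi.
have md (g h : R -> R) : L2 g -> {within `[0, 1], continuous h} ->
    II 0 1 (fun x => (a * g x) * h x) = a * II 0 1 (fun x => g x * h x).
  move=> L1 ch; rewrite -IIZ; last exact: mc.
  by apply: eq_II => x _; ring.
rewrite !Rint_I01; try (by apply: mc => //; exact: L2Z); try exact: mc.
rewrite !md// => ->; ring.
Qed.

End WeakDerivatives.

(** * Rayleigh quotients on one piece *)

Section Pieces.
Variable R : realType.
Local Notation leb := (@lebesgue_measure R).
Implicit Types (p q x y t M : R) (f g u du r rho H U v G : R -> R).

Lemma eq_II_oo p q f g : itg p q f -> itg p q g -> {in `]p, q[, f =1 g} ->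
  II p q f = II p q g.
Proof.
move=> If Ig fg; have E h : itg p q h -> II p q h = \int[leb]_(x in `]p, q[) h x.
  move=> Ih; rewrite /II /Rintegral -(@integral_itv_bndoo R p q _ true false)//.
  apply/measurable_EFinP; apply: (measurable_funS _ _ (itg_measurable Ih)) => //.
  by apply: subset_itv; rewrite bnd_simp.
by rewrite !E//; apply: eq_Rintegral => x; rewrite inE; exact: fg.
Qed.

Lemma itg_ind p q rho G t : measurable_fun `[p, q] rho -> itg p q G ->
  itg p q (fun x => (t <= rho x)%R%:R * G x).
Proof.
move=> mr IG; apply: (@eq_itg _ _ _ (fun x => G x * (t <= rho x)%R%:R)).
  by move=> x _; rewrite mulrC.
apply: itg_mul_bnd => //.
  apply: (@measurableT_comp _ _ _ _ _ _ (fun b : bool => b%:R : R)) => //.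
  exact: measurable_fun_ler.
by exists 1 => x _; rewrite normr_nat lern1 leq_b1.
Qed.

(** The sum is the integer part of [y] capped at [m]; the first alternative is the capped case. *)
Lemma sum_floor m y : 0 <= y ->
  let S := \sum_(i < m) (i.+1%:R <= y)%R%:R : R in
  (S = m%:R /\ m%:R <= y) \/ (y < m%:R /\ y - 1 < S <= y).
Proof.
move=> y0; elim: m => [|m IH] /=; first by left; rewrite big_ord0.
rewrite big_ord_recr/=; case: IH => [[-> my]|[ym Sy]].
  case: (leP m.+1%:R y) => h; first by left; rewrite -natr1.
  right; split=> //; rewrite addr0 my andbT; move: h; rewrite -natr1; lra.
have ym1 : y < m.+1%:R by rewrite -natr1; lra.
by right; split=> //; rewrite leNgt ym1 addr0.
Qed.

(* Layer-cake: [rho] is the limit of combinations of indicators of its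
   superlevel sets. *)
Lemma layer_cake_le0 p q rho G : measurable_fun `[p, q] rho ->
  {in `[p, q], forall x, 0 <= rho x} -> itg p q G -> itg p q (fun x => rho x * G x) ->
  (forall t, 0 < t -> II p q (fun x => (t <= rho x)%R%:R * G x) <= 0) ->
  II p q (fun x => rho x * G x) <= 0.
Proof.
move=> mr r0 IG IrG Ht.
pose S n m x : R := \sum_(i < m) (i.+1%:R <= n.+1%:R * rho x)%R%:R.
(* This rounds [rho] down to a multiple of [1/(n+1)]; with [(n+1)^2] levels the cap is at [n + 1],
   hence inactive for large [n]. *)
pose rn n x := n.+1%:R^-1 * S n (n.+1 * n.+1)%N x.
have n0 n : (0 : R) < n.+1%:R by rewrite ltr0n.
have indE n i x : (i.+1%:R <= n.+1%:R * rho x) = (i.+1%:R / n.+1%:R <= rho x).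
  by rewrite ler_pdivrMr// mulrC.
have IS n m : itg p q (fun x => S n m x * G x) /\ II p q (fun x => S n m x * G x) <= 0.
  elim: m => [|m [I1 I2]].
    have E0 : {in `[p, q], forall x, S n 0%N x * G x = 0} by move=> x _; rewrite /S big_ord0 mul0r.
    split; last by rewrite II_eq0.
    by apply: (@eq_itg _ _ _ (fun x => 0 * G x)) (itgZ _ IG) => x xx; rewrite E0// mul0r.
  have E x : S n m.+1 x * G x = S n m x * G x + (m.+1%:R / n.+1%:R <= rho x)%R%:R * G x.
    by rewrite /S big_ord_recr/= indE mulrDl.
  have J := itg_ind (m.+1%:R / n.+1%:R) mr IG.
  split; first by apply: eq_itg (itgD I1 J) => x _; rewrite E.
  rewrite (@eq_II _ _ _ _ (fun x => S n m x * G x + (m.+1%:R / n.+1%:R <= rho x)%R%:R * G x)); last by [].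
  by rewrite IID//; have := Ht _ (divr_gt0 (n0 m) (n0 n)); move: I2; lra.
have Irn n : itg p q (fun x => rn n x * G x) /\ II p q (fun x => rn n x * G x) <= 0.
  have [I1 I2] := IS n (n.+1 * n.+1)%N.
  have E : {in `[p, q], forall x, n.+1%:R^-1 * (S n (n.+1 * n.+1)%N x * G x) = rn n x * G x}.
    by move=> x _; rewrite /rn mulrA.
  split; first by apply: eq_itg E _; exact: itgZ.
  by rewrite -(eq_II E) IIZ// mulr_ge0_le0// invr_ge0 ltW.
have Hrn n x : x \in `[p, q] -> 0 <= rn n x <= rho x /\ (rho x < n.+1%:R -> rho x - n.+1%:R^-1 < rn n x).
  move=> xx; have := sum_floor (n.+1 * n.+1) (mulr_ge0 (ltW (n0 n)) (r0 _ xx)).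
  rewrite -[\sum_(_ < _) _]/(S n (n.+1 * n.+1)%N x) /= /rn natrM => -[[-> h]|[h /andP[h1 h2]]].
    rewrite mulrA mulVf ?gt_eqF// mul1r ler0n/=; move: h; rewrite ler_pM2l// => h.
    by split=> //; rewrite ltNge h.
  have S0 : 0 <= S n (n.+1 * n.+1)%N x by apply: sumr_ge0.
  split.
    by rewrite (mulr_ge0 _ S0) ?invr_ge0 ?(ltW (n0 n))//= mulrC ler_pdivrMr// mulrC.
  by move=> _; rewrite mulrC ltr_pdivlMr// mulrBl mulVf ?gt_eqF// mulrC.
have [||_ cI] := @II_dct _ p q (fun n x => rn n x * G x) (fun x => rho x * G x) (fun x => `|rho x * G x|)
  (fun n => itg_measurable (Irn n).1) _ _ (itg_norm IrG).
- move=> x xx; apply: cvgM; last exact: cvg_cst.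
  apply/cvgrPdist_lt => e e0.
  have [k hk] : exists k, rho x < k.+1%:R.
    exists (Num.bound (rho x)); apply: lt_trans (_ : (Num.bound (rho x))%:R < _).
      by apply: archi_boundP; exact: r0.
    by rewrite ltr_nat.
  near=> n.
  have [/andP[h0 h1] h2] := Hrn n x xx.
  rewrite ger0_norm ?subr_ge0//.
  have nk : rho x < n.+1%:R.
    apply: lt_le_trans hk _; rewrite ler_nat ltnS; near: n; exact: nbhs_infty_ge.
  have /h2 h3 := nk.
  apply: (@lt_trans _ _ n.+1%:R^-1); first by rewrite ltrBlDr addrC -ltrBlDr.
  by near: n; exact: near_infty_natSinv_lt (PosNum e0).
- by move=> n x xx; have [/andP[h0 h1] _] := Hrn n x xx; rewrite normrM [leRHS]normrM; apply: ler_wpM2r => //; rewrite (ger0_norm h0) ger0_norm// r0.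
- rewrite -(cvg_lim (@Rhausdorff R) cI); apply: limr_le; first by apply/cvg_ex; exists (II p q (fun x => rho x * G x)).
  by apply: nearW => n; exact: (Irn n).2.
Unshelve. all: by end_near. Qed.

(* The flux [F = r du] has the sign of [x0 - x], so that
   [int r (du^2 - M u^2) <= [F u] <= 0] over every interval around [x0]; the
   superlevel sets of [rho] are such intervals. *)
Lemma unimodal_rayleigh p q x0 M r u du f rho : p < q -> p <= x0 <= q ->
  C1 p q u du -> {within `[p, q], continuous r} ->
  abscont p q (fun x => r x * du x) f ->
  {in `[p, q], forall x, - M * (r x * u x) <= f x} ->
  {in `[p, q], forall x, 0 <= u x} ->
  {in `[p, q], forall x, x <= x0 -> 0 <= r x * du x} ->
  {in `[p, q], forall x, x0 <= x -> r x * du x <= 0} ->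
  measurable_fun `[p, q] rho -> {in `[p, q], forall x, 0 <= rho x} ->
  (forall x y, p < x -> x <= y -> y <= x0 -> y < q -> rho x <= rho y) ->
  (forall x y, x0 <= x -> x <= y -> y < q -> p < x -> rho y <= rho x) ->
  itg p q (fun x => rho x * (r x * (du x ^+ 2 - M * u x ^+ 2))) ->
  II p q (fun x => rho x * (r x * (du x ^+ 2 - M * u x ^+ 2))) <= 0.
Proof.
move=> pq /andP[px0 x0q] C1u cr ACF fM u0 Fp Fm mrho rho0 rhop rhom.
set G := fun x => r x * (du x ^+ 2 - M * u x ^+ 2) => IrG.
have [du_ cu cdu] := C1u.
have cG : {within `[p, q], continuous G}.
  apply: within_contM => //; apply: within_contB.
    by apply: (@eq_within_cont _ _ _ (fun x => du x * du x)) => [x _|]; [rewrite expr2|exact: within_contM].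
  apply: within_contM; first exact: within_cont_cst.
  by apply: (@eq_within_cont _ _ _ (fun x => u x * u x)) => [x _|]; [rewrite expr2|exact: within_contM].
have IG := itg_cont cG.
apply: layer_cake_le0 => // t t0.
have Iind := itg_ind t mrho IG.
have G12 y1 y2 : p <= y1 -> y1 <= x0 -> x0 <= y2 -> y2 <= q -> II y1 y2 G <= 0.
  move=> py1 y1x x0y y2q; have y12 := le_trans y1x x0y.
  have A1 := ACS py1 y12 y2q ACF; have A2 := ACS py1 y12 y2q (C1_AC (ltW pq) C1u).
  have := AC_mul_int y12 A1 A2.
  set E1 := II _ _ _ => H.
  have HE : II y1 y2 G <= E1.
    apply: le_II; first exact: itgS IG.
      by have [] := AC_mul y12 A1 A2.
    move=> x; rewrite in_itv/= => /andP[yx xy].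
    have xx : x \in `[p, q] by rewrite in_itv/= (le_trans py1 yx) (le_trans xy y2q).
    have h := ler_wpM2r (u0 _ xx) (fM _ xx).
    rewrite /G; move: h; nra.
  apply: le_trans HE _; rewrite H.
  have y1q : y1 \in `[p, q] by rewrite in_itv/= py1 (le_trans y12).
  have y2p : y2 \in `[p, q] by rewrite in_itv/= y2q (le_trans py1).
  have h1 := mulr_ge0 (Fp _ y1q y1x) (u0 _ y1q).
  have h2 := mulr_le0_ge0 (Fm _ y2p x0y) (u0 _ y2p).
  by rewrite subr_le0; apply: le_trans h1.
(* Only interior points are kept: the monotonicity hypotheses do not control [rho] at [p] and [q],
   and the integrals ignore these two points. *)
pose S := [set x | p < x < q /\ t <= rho x].
have [S0|/set0P[s Ss]] := eqVneq S set0.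
  rewrite (@eq_II_oo _ _ _ (fun x => 0 * G x)) ?IIZ ?mul0r//; first exact: itgZ.
  move=> x; rewrite in_itv/= => xx; congr (_ * _).
  case: leP => // tr; suff : S x by rewrite S0.
  by split.
have Slb : has_lbound S by exists p => x [/andP[/ltW]].
have Sub : has_ubound S by exists q => x [/andP[_ /ltW]].
have Sn0 : S !=set0 by exists s.
have hiS : has_inf S by []. have hsS : has_sup S by [].
pose y1 := inf S; pose y2 := sup S.
have py1 : p <= y1 by apply: lb_le_inf => // x [/andP[/ltW]].
have y2q : y2 <= q by apply: ge_sup => // x [/andP[_ /ltW]].
have Sy x : S x -> y1 <= x <= y2 by move=> Sx; rewrite ge_inf// ub_le_sup.
have Sleft x z : S x -> x <= z -> z <= x0 -> z < q -> S z.
  move=> [/andP[px xq] tx] xz zx0 zq; split; first by rewrite zq (lt_le_trans px).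
  by apply: le_trans tx _; apply: rhop.
have Sright x z : S x -> z <= x -> x0 <= z -> p < z -> S z.
  move=> [/andP[px xq] tx] zx xz pz; split; first by rewrite pz (le_lt_trans zx).
  by apply: le_trans tx _; apply: rhom.
have y1x0 : y1 <= x0.
  rewrite leNgt; apply/negP => x0y1.
  have zS : S ((x0 + y1) / 2).
    have [/andP[ps sq] _] := Ss; have /andP[y1s _] := Sy _ Ss.
    by apply: (Sright s) => //; lra.
  by have /andP[] := Sy _ zS; lra.
have x0y2 : x0 <= y2.
  rewrite leNgt; apply/negP => x0y1.
  have zS : S ((x0 + y2) / 2).
    have [/andP[ps sq] _] := Ss; have /andP[_ y1s] := Sy _ Ss.
    by apply: (Sleft s) => //; lra.
  by have /andP[] := Sy _ zS; lra.
have Smid z : y1 < z < y2 -> S z.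
  move=> /andP[y1z zy2]; have [zx0|x0z] := leP z x0.
    have e0 : 0 < z - y1 by rewrite subr_gt0.
    have [x Sx xz] := inf_adherent e0 hiS.
    have {}xz : x < z by move: xz; rewrite -/y1; lra.
    by apply: (Sleft x) => //; [exact: ltW|lra].
  have e0 : 0 < y2 - z by rewrite subr_gt0.
  have [x Sx xz] := sup_adherent e0 hsS.
  have {}xz : z < x by move: xz; rewrite -/y2; lra.
  by apply: (Sright x) => //; [exact: ltW|exact: ltW|lra].
have y12 := le_trans y1x0 x0y2.
have py2 := le_trans py1 y12; have y1q := le_trans y12 y2q.
rewrite (@IIcat _ p y1 q)// (@IIcat _ y1 y2 q)//; last by apply: itgS Iind.
have Z a b : p <= a -> b <= q -> (forall z, a < z < b -> ~ S z) ->
    II a b (fun x => (t <= rho x)%R%:R * G x) = 0.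
  move=> pa bq H; rewrite (@eq_II_oo _ _ _ (fun x => 0 * G x)) ?IIZ ?mul0r//; try by apply: itgZ; apply: itgS IG.
  - by apply: itgS IG.
  - by apply: itgS Iind.
  - move=> x; rewrite in_itv/= => /andP[ax xb]; congr (_ * _).
    case: leP => // tr; case: (H x); first by rewrite ax.
    by split => //; rewrite (le_lt_trans pa ax) (lt_le_trans xb bq).
rewrite (Z p y1)//; last by move=> z /andP[_ h] /Sy/andP[]; lra.
rewrite (Z y2 q)//; last by move=> z /andP[h _] /Sy/andP[]; lra.
rewrite add0r addr0 (@eq_II_oo _ _ _ G).
- exact: G12.
- by apply: itgS Iind.
- by apply: itgS IG.
- by move=> x; rewrite in_itv/= => /Smid[_ ->]; rewrite mul1r.
Qed.

(* The perturbation [phi + d] stays positive at the ends; let [d] go to 0. *)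
Lemma picone p q M r phi dphi U v : p < q -> 0 <= M ->
  {within `[p, q], continuous r} -> {in `[p, q], forall x, 0 <= r x} ->
  C1 p q phi dphi -> {in `[p, q], forall x, 0 <= phi x} ->
  {in `]p, q[, forall x, 0 < phi x} ->
  abscont p q (fun x => r x * dphi x) (fun x => - M * (r x * phi x)) ->
  abscont p q U v -> itg p q (fun x => v x ^+ 2) ->
  U p = 0 \/ r p * dphi p = 0 -> U q = 0 \/ r q * dphi q = 0 ->
  M * II p q (fun x => U x ^+ 2 * r x) <= II p q (fun x => v x ^+ 2 * r x).
Proof.
move=> pq M0 cr r0 Cphi phi0 phip ACF ACU Iv2 bp bq.
have [_ cphi cdphi] := Cphi; have pq' := ltW pq.
have cU := AC_cont pq' ACU; have [Iv _] := ACU.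
have IR : itg p q (fun x => v x ^+ 2 * r x) by apply: itg_mul_cont.
have cU2 : {within `[p, q], continuous (fun x => U x * U x)} by exact: within_contM.
have key n : M * II p q (fun x => phi x / (phi x + n.+1%:R^-1) * (U x ^+ 2 * r x))
    <= II p q (fun x => v x ^+ 2 * r x).
  set d := n.+1%:R^-1; have d0 : 0 < d by rewrite invr_gt0 ltr0n.
  have pd0 : {in `[p, q], forall x, phi x + d != 0}.
    by move=> x xx; rewrite gt_eqF// ltr_wpDl// phi0.
  have C1pd : C1 p q (fun x => phi x + d) dphi.
    have := C1D Cphi (C1_cst p q d); rewrite (_ : (fun x => dphi x + 0) = dphi)//.
    by apply/funext => x; rewrite addr0.
  have C1V' := C1V pd0 C1pd.
  have ACpsi := AC_mul pq' ACF (C1_AC pq' C1V').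
  have ACU2 := AC_mul pq' ACU ACU.
  have := AC_mul_int pq' ACpsi ACU2.
  set E := II p q _ => H.
  (* The boundary term is [r phi' U^2 / (phi + d)]; at each end either [U] or the flux [r phi']
     vanishes. *)
  have E0 : E = 0.
    rewrite H; case: bp => ->; case: bq => ->; rewrite ?(mul0r, mulr0) ?subrr//.
  rewrite -[leRHS]subr0 -E0 -IIZ; last first.
    apply: itg_cont; apply: within_contM.
      by apply: within_contM => //; apply: within_contV => //; apply: within_contD => //; exact: within_cont_cst.
    apply: (@eq_within_cont _ _ _ (fun x => (U x * U x) * r x)); first by move=> x _; rewrite expr2.
    exact: within_contM.
  rewrite /E -IIB//; last by have [] := AC_mul pq' ACpsi ACU2.
  apply: le_II.
  - apply: itgZ; apply: itg_cont; apply: within_contM.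
      by apply: within_contM => //; apply: within_contV => //; apply: within_contD => //; exact: within_cont_cst.
    apply: (@eq_within_cont _ _ _ (fun x => (U x * U x) * r x)); first by move=> x _; rewrite expr2.
    exact: within_contM.
  - by apply: itgB => //; have [] := AC_mul pq' ACpsi ACU2.
  - move=> x xx; rewrite -subr_ge0.
    (* Picone's identity: the difference of the integrands is a square weighted by [r]. *)
    have -> : v x ^+ 2 * r x - ((- M * (r x * phi x) / (phi x + d) +
         r x * dphi x * (- dphi x / (phi x + d) ^+ 2)) * (U x * U x) +
        r x * dphi x / (phi x + d) * (v x * U x + U x * v x)) -
      M * (phi x / (phi x + d) * (U x ^+ 2 * r x)) =
      r x * (v x - dphi x / (phi x + d) * U x) ^+ 2 by field; exact: pd0.
    by rewrite mulr_ge0 ?sqr_ge0// r0.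
have cUr : {within `[p, q], continuous (fun x => U x ^+ 2 * r x)}.
  apply: (@eq_within_cont _ _ _ (fun x => (U x * U x) * r x)); first by move=> x _; rewrite expr2.
  exact: within_contM.
have d0 n : (0 : R) < n.+1%:R^-1 by rewrite invr_gt0 ltr0n.
(* As [d] tends to 0, [phi / (phi + d)] tends to 1 where [phi > 0], in particular on the whole open
   segment. *)
have [||||If cI] := @II_dct _ p q (fun n x => phi x / (phi x + n.+1%:R^-1) * (U x ^+ 2 * r x))
   (fun x => (0 < phi x)%R%:R * (U x ^+ 2 * r x)) (fun x => U x ^+ 2 * r x).
- move=> n; apply: cont_meas; apply: within_contM => //.
  apply: within_contM => //; apply: within_contV.
    by move=> x xx; rewrite gt_eqF// ltr_wpDl// phi0.
  by apply: within_contD => //; exact: within_cont_cst.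
- move=> x xx; apply: cvgM; last exact: cvg_cst.
  case: (ltP 0 (phi x)) => px /=; last first.
    have -> : phi x = 0 by apply/eqP; rewrite eq_le px phi0.
    by under eq_fun do rewrite mul0r; exact: cvg_cst.
  rewrite -[X in _ --> X](@divff _ (phi x)) ?gt_eqF//.
  apply: cvgM; first exact: cvg_cst.
  apply: cvgV; first by rewrite gt_eqF.
  rewrite -[X in _ --> X]addr0; apply: cvgD; first exact: cvg_cst.
  apply/cvgr0Pnorm_lt => e e0; near=> n; rewrite gtr0_norm//.
  by near: n; exact: near_infty_natSinv_lt (PosNum e0).
- move=> n x xx; have p0 := phi0 _ xx; have U0 : 0 <= U x ^+ 2 * r x by rewrite mulr_ge0 ?sqr_ge0 ?r0.
  rewrite normrM (ger0_norm U0) ler_piMl// ger0_norm; last by rewrite divr_ge0// addr_ge0// ltW.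
  by rewrite ler_pdivrMr ?mul1r ?lerDl ?ltr_wpDl// ltW.
- exact: itg_cont.
rewrite (@eq_II_oo _ _ _ (fun x => (0 < phi x)%R%:R * (U x ^+ 2 * r x)))//; last 2 first.
- exact: itg_cont.
- by move=> x xx; rewrite phip// mul1r.
apply: (cvgr_to_le (cvgM (cvg_cst M) cI)).
by apply: nearW => n; exact: key.
Unshelve. all: by end_near. Qed.

End Pieces.

(** * From the pieces to the eigenvalues *)

Section Assembly.
Variable R : realType.
Local Notation leb := (@lebesgue_measure R).
Local Notation I01 := (`]0%R, 1%R[%classic : set R).
Implicit Types (p q y t M : R) (f g u du H U v : R -> R).

(** The alternatives [p = 0] and [q = 1] leave the ends of the interval free, as natural boundary
    conditions; [u] is constrained only at interior nodes. *)
Definition upper_piece H M p q := exists u du, [/\ C1 p q u du,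
  {in `]p, q[, forall x, 0 < u x}, p = 0 \/ u p = 0, q = 1 \/ u q = 0 &
  II p q (fun x => du x ^+ 2 * H x) <= M * II p q (fun x => u x ^+ 2 * H x)].

(** The class of [U] is that of the continuous representatives of elements of [H1], with the same
    freedom at 0 and 1. *)
Definition lower_piece H M p q := forall U v, abscont p q U v ->
  itg p q (fun x => v x ^+ 2) -> p = 0 \/ U p = 0 -> q = 1 \/ U q = 0 ->
  M * II p q (fun x => U x ^+ 2 * H x) <= II p q (fun x => v x ^+ 2 * H x).

Definition weight H := [/\ measurable_fun (`[0%R, 1%R]%classic : set R) H,
  forall x, 0 <= x <= 1 -> 0 <= H x <= 1 & forall x, 0 < x < 1 -> 0 < H x].

Lemma weight_itg H f : weight H -> itg 0 1 f -> itg 0 1 (fun x => f x * H x).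
Proof.
move=> [mH H01 _] If; apply: itg_mul_bnd => //; exists 1 => x; rewrite in_itv/= => xx.
by have /andP[h0 h1] := H01 _ xx; rewrite ger0_norm.
Qed.

Lemma itg_patch p q f : 0 <= p -> q <= 1 -> itg p q f -> itg 0 1 (f \_ `[p, q]).
Proof.
move=> p0 q1 If; rewrite /itg -restrict_EFin; apply/integrable_restrict => //.
rewrite setIidr//; apply: subset_itv; rewrite bnd_simp//.
Qed.

Lemma patch_in p q f x : p <= x <= q -> (f \_ `[p, q]) x = f x.
Proof. by move=> xpq; rewrite patchE mem_setE in_itv/= xpq. Qed.

Lemma patch_out p q f x : ~~ (p <= x <= q) -> (f \_ `[p, q]) x = 0.
Proof. by move=> xpq; rewrite patchE mem_setE in_itv/= (negbTE xpq). Qed.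

Lemma abscont_patch p q u du : 0 <= p -> p < q -> q <= 1 -> C1 p q u du ->
  p = 0 \/ u p = 0 -> q = 1 \/ u q = 0 ->
  abscont 0 1 (u \_ `[p, q]) (du \_ `[p, q]).
Proof.
move=> p0 pq q1 Cu up uq; have [Idu Hu] := C1_AC (ltW pq) Cu.
have I' := itg_patch p0 q1 Idu.
have Z a b : 0 <= a -> b <= 1 -> (b <= p \/ q <= a) -> II a b (du \_ `[p, q]) = 0.
  move=> a0 b1 ab; have Iab : itg a b (du \_ `[p, q]) by apply: itgS I'.
  rewrite (@eq_II_oo _ _ _ _ (fun x => 0 * (du \_ `[p, q]) x))//; last 2 first.
  - exact: itgZ.
  - move=> x; rewrite in_itv/= => /andP[ax xb]; rewrite mul0r patch_out//.
    by rewrite negb_and -!ltNge; case: ab => h; apply/orP; [left|right]; lra.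
  by rewrite IIZ// mul0r.
have In y : p <= y <= q -> II p y (du \_ `[p, q]) = u y - u p.
  move=> /andP[py yq]; rewrite (@eq_II _ p y _ du).
    by rewrite (Hu y) ?in_itv/= ?py//; ring.
  by move=> x; rewrite in_itv/= => /andP[px xy]; rewrite patch_in// px (le_trans xy).
split=> // y; rewrite in_itv/= => /andP[y0 y1].
have w0 : (u \_ `[p, q]) 0 = u p.
  have [->|pp] := eqVneq p 0; first by rewrite patch_in// lexx; case: up pq => [->|_]; lra.
  case: up pp => [->|->]; rewrite ?eqxx// => pp; rewrite patch_out// negb_and -ltNge lt_neqAle eq_sym.
  by rewrite pp p0.
rewrite w0; have [yp|py] := ltP y p.
  rewrite patch_out ?negb_and -?ltNge ?yp//.
  rewrite Z//; last by left; exact: ltW.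
  by case: up => [pz|->]; [lra|rewrite addr0].
have [yq|qy] := leP y q.
  rewrite patch_in ?py// (@IIcat _ 0 p y)//; last exact: itgS I'.
  by rewrite Z//; [rewrite In ?py//; ring|lra|left].
have uq0 : u q = 0 by case: uq => // q1'; lra.
rewrite patch_out ?negb_and -?ltNge ?qy ?orbT//.
rewrite (@IIcat _ 0 p y)//; last exact: itgS I'.
rewrite (@IIcat _ p q y) ?(ltW qy) ?(ltW pq)//; last exact: itgS I'.
rewrite (Z 0 p)//; [|lra|by left].
rewrite (Z q y)//; [|lra|by right].
by rewrite In ?(ltW pq) ?lexx// uq0; ring.
Qed.

Section Partition.
Variables (k : nat) (x : nat -> R).
Hypotheses (x0 : x 0%N = 0) (xk : x k.+1 = 1).
Hypothesis xS : forall i, (i <= k)%N -> x i < x i.+1.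

Lemma part_lt i j : (i < j)%N -> (j <= k.+1)%N -> x i < x j.
Proof.
elim: j => // j IH; rewrite ltnS leq_eqVlt => /predU1P[->|ij] jk; first exact: xS.
by apply: (lt_trans (IH ij (ltnW jk))); exact: xS.
Qed.

Lemma part_le i j : (i <= j)%N -> (j <= k.+1)%N -> x i <= x j.
Proof. by rewrite leq_eqVlt => /predU1P[->//|ij jk]; exact/ltW/part_lt. Qed.

Lemma part01 i : (i <= k.+1)%N -> 0 <= x i <= 1.
Proof. by move=> ik; rewrite -x0 -xk !part_le. Qed.

Lemma II_part f : itg 0 1 f -> II 0 1 f = \sum_(i < k.+1) II (x i) (x i.+1) f.
Proof.
move=> If.
suff H n : (n <= k.+1)%N -> II (x 0%N) (x n) f = \sum_(i < n) II (x i) (x i.+1) f.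
  by have := H k.+1 (leqnn _); rewrite x0 xk.
elim: n => [|n IH] nk; first by rewrite big_ord0 IIxx.
rewrite big_ord_recr/= -(IH (ltnW nk)); apply: IIcat.
  by apply: part_le => //; exact: ltnW.
  by apply/ltW/xS.
by apply: itgS If; rewrite ?x0//; have /andP[] := part01 nk.
Qed.

Lemma part_out f i j y : (i <= k)%N -> (j <= k)%N -> i != j -> x i < y < x i.+1 ->
  (f \_ `[x j, x j.+1]) y = 0.
Proof.
move=> ik jk ij /andP[xy yx]; apply: patch_out; rewrite negb_and -!ltNge.
move: ij; rewrite neq_ltn => /orP[] h; apply/orP; [left|right].
  by apply: (lt_le_trans yx); apply: part_le => //; exact: leqW.
by apply: le_lt_trans xy; apply: part_le => //; exact: ltnW.
Qed.

End Partition.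

Lemma abscont_sum n p q (F f : 'I_n -> R -> R) (d : 'I_n -> R) :
  (forall i, abscont p q (F i) (f i)) ->
  abscont p q (fun y => \sum_(i < n) d i * F i y) (fun y => \sum_(i < n) d i * f i y).
Proof.
elim: n F f d => [|n IH] F f d H.
  have := @AC_cst R p q 0.
  have -> : (fun=> 0) = (fun y : R => \sum_(i < 0) d i * F i y) :> (R -> R).
    by apply/funext => y; rewrite big_ord0.
  by have -> : (fun y : R => \sum_(i < 0) d i * F i y) = (fun y => \sum_(i < 0) d i * f i y) :> (R -> R)
    by apply/funext => y; rewrite !big_ord0.
have := IH (fun i => F (widen_ord (leqnSn n) i)) (fun i => f (widen_ord (leqnSn n) i))
  (fun i => d (widen_ord (leqnSn n) i)) (fun i => H _).
move=> /ACD/(_ (ACZ (d ord_max) (H ord_max))).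
have E (G : 'I_n.+1 -> R -> R) : (fun y => \sum_(i < n.+1) d i * G i y) = (fun y =>
  \sum_(i < n) d (widen_ord (leqnSn n) i) * G (widen_ord (leqnSn n) i) y + d ord_max * G ord_max y).
  by apply/funext => y; rewrite big_ord_recr.
by rewrite !E.
Qed.

Lemma L2_sum n (f : 'I_n -> R -> R) (d : 'I_n -> R) : (forall i, L2 (f i)) ->
  L2 (fun y => \sum_(i < n) d i * f i y).
Proof.
elim: n f d => [|n IH] f d H.
  have -> : (fun y => \sum_(i < 0) d i * f i y) = fun=> 0 by apply/funext => y; rewrite big_ord0.
  apply: L2_cont; exact: within_cont_cst.
have -> : (fun y => \sum_(i < n.+1) d i * f i y) = (fun y =>
  \sum_(i < n) d (widen_ord (leqnSn n) i) * f (widen_ord (leqnSn n) i) y + d ord_max * f ord_max y).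
  by apply/funext => y; rewrite big_ord_recr.
apply: L2D; last exact: L2Z.
by apply: (IH (fun i => f (widen_ord (leqnSn n) i)) (fun i => d (widen_ord (leqnSn n) i))).
Qed.

Lemma weak_derivative_sum n (u v : 'I_n -> R -> R) (d : 'I_n -> R) :
  (forall i, L2 (u i)) -> (forall i, L2 (v i)) -> (forall i, weak_derivative (u i) (v i)) ->
  weak_derivative (fun y => \sum_(i < n) d i * u i y) (fun y => \sum_(i < n) d i * v i y).
Proof.
elim: n u v d => [|n IH] u v d Lu Lv H.
  have E (f : 'I_0 -> R -> R) : (fun y => \sum_(i < 0) d i * f i y) = fun=> 0.
    by apply/funext => y; rewrite big_ord0.
  by rewrite !E; exact: AC_weak (AC_cst _ _ _).
have E (G : 'I_n.+1 -> R -> R) : (fun y => \sum_(i < n.+1) d i * G i y) = (fun y =>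
  \sum_(i < n) d (widen_ord (leqnSn n) i) * G (widen_ord (leqnSn n) i) y + d ord_max * G ord_max y).
  by apply/funext => y; rewrite big_ord_recr.
rewrite !E; apply: weak_derivativeD.
- by apply: (@L2_sum n (fun i => u (widen_ord (leqnSn n) i))).
- by apply: (@L2_sum n (fun i => v (widen_ord (leqnSn n) i))).
- exact: L2Z.
- exact: L2Z.
- by apply: (IH (fun i => u (widen_ord (leqnSn n) i)) (fun i => v (widen_ord (leqnSn n) i))).
- exact: weak_derivativeZ.
Qed.

Lemma eq_ae_EFin_II f g : itg 0 1 g -> measurable_fun I01 f ->
  {ae leb, forall y, I01 y -> f y = g y} ->
  (\int[leb]_(y in I01) (f y)%:E)%E = (II 0 1 g)%:E.
Proof.
move=> Ig mf fg; rewrite -EFin_I01//; apply: ae_eq_integral => //.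
- exact/measurable_EFinP.
- by apply/measurable_EFinP/meas_I01; exact: itg_measurable Ig.
- by apply: ae_mono fg => y H yy; rewrite H.
Qed.

Lemma ae_eq_II f g : itg 0 1 f -> itg 0 1 g ->
  {ae leb, forall y, I01 y -> f y = g y} -> II 0 1 f = II 0 1 g.
Proof.
move=> If Ig fg; apply: EFin_inj; rewrite -(eq_ae_EFin_II Ig _ fg) ?EFin_I01//.
by apply/meas_I01; exact: itg_measurable If.
Qed.

Lemma II_eq0_ae f : itg 0 1 f -> (forall y, 0 < y < 1 -> 0 <= f y) -> II 0 1 f = 0 -> ae0 f.
Proof.
move=> If f0 I0.
have : (\int[leb]_(y in I01) `|(f y)%:E| = 0)%E.
  transitivity (\int[leb]_(y in I01) (f y)%:E)%E; last by rewrite EFin_I01// I0.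
  apply: eq_integral => y; rewrite inE/= in_itv/= => yy; rewrite ger0_norm//; exact: f0.
have mf : measurable_fun I01 (EFin \o f).
  by apply/measurable_EFinP/meas_I01; exact: itg_measurable If.
move/(ae_eq_integral_abs leb (measurable_itv _) mf); apply: ae_mono => y H yy.
by have [] := H yy.
Qed.

Lemma not_ae0_itv p q (d : R) u f : 0 <= p -> p < q -> q <= 1 ->
  (forall y, p < y < q -> 0 < u y) -> (forall y, p < y < q -> f y = d * u y) ->
  ae0 f -> d = 0.
Proof.
move=> p0 pq q1 u0 fu [N [mN N0 HN]]; apply/eqP/negPn/negP => d0.
have : (leb `]p, q[ <= leb N)%E.
  apply: le_measure; rewrite ?inE// => y; rewrite /= in_itv/= => yy; apply: HN => /= H.
  have : f y = 0 by apply: H; rewrite in_itv/=; case/andP: yy => h1 h2; apply/andP; split; lra.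
  by rewrite fu// => /eqP; rewrite mulf_eq0 (negbTE d0)/= gt_eqF// u0.
rewrite N0 (lebesgue_measure_itv `]p, q[) /= lte_fin pq -EFinD lee_fin.
by rewrite leNgt subr_gt0 pq.
Qed.

Theorem SLeigen_le (k : nat) (x : nat -> R) H M : weight H ->
  x 0%N = 0 -> x k.+1 = 1 -> (forall i, (i <= k)%N -> x i < x i.+1) ->
  (forall i, (i <= k)%N -> upper_piece H M (x i) (x i.+1)) ->
  (SLeigen k H <= M%:E)%E.
Proof.
move=> wH x0 xk xS HP; have [mH H01 Hp] := wH.
have /choice[u Hu] : forall i : 'I_k.+1, exists u, exists du, [/\ C1 (x i) (x i.+1) u du,
  {in `](x i), (x i.+1)[, forall y, 0 < u y}, x i = 0 \/ u (x i) = 0, x i.+1 = 1 \/ u (x i.+1) = 0 &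
  II (x i) (x i.+1) (fun y => du y ^+ 2 * H y) <= M * II (x i) (x i.+1) (fun y => u y ^+ 2 * H y)].
  by move=> i; apply: HP; rewrite -ltnS.
have {Hu} /choice[du Hu] := Hu.
pose w (i : 'I_k.+1) := u i \_ `[x i, x i.+1]; pose dw (i : 'I_k.+1) := du i \_ `[x i, x i.+1].
have p01 (i : 'I_k.+1) : [/\ 0 <= x i, x i < x i.+1 & x i.+1 <= 1].
  have ik : (i < k.+1)%N by [].
  have /andP[h1 _] := part01 x0 xk xS (ltnW ik); have /andP[_ h2] := part01 x0 xk xS ik.
  by split => //; exact: xS.
have ACw i : abscont 0 1 (w i) (dw i).
  have [h1 h2 h3] := p01 i; have [c1 _ b1 b2 _] := Hu i; exact: abscont_patch.
have L2dw i : L2 (dw i).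
  have [h1 h2 h3] := p01 i; have [[_ _ cdu] _ _ _ _] := Hu i.
  apply/L2P; split; first by have [I _] := ACw i; exact: itg_measurable I.
  have I : itg (x i) (x i.+1) (fun y => du i y * du i y) by apply: itg_cont; exact: within_contM.
  apply: eq_itg (itg_patch h1 h3 I) => y _; rewrite /dw !patchE; case: ifP => _; first by rewrite expr2.
  by rewrite expr0n.
have L2w i : L2 (w i) by apply: L2_cont; exact: AC_cont (ACw i).
pose U (d : 'I_k.+1 -> R) y := \sum_(i < k.+1) d i * w i y.
pose dU (d : 'I_k.+1 -> R) y := \sum_(i < k.+1) d i * dw i y.
have UE d (i : 'I_k.+1) y : x i < y < x i.+1 -> U d y = d i * u i y.
  move=> yy; rewrite /U (bigD1 i)//= big1 ?addr0.
    by rewrite /w patch_in//; case/andP: yy => /ltW -> /ltW ->.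
  move=> j ji; rewrite /w (part_out xS _ (_ : (i <= k)%N))// ?mulr0//; try by rewrite -ltnS ltn_ord.
  by rewrite eq_sym.
have dUE d (i : 'I_k.+1) y : x i < y < x i.+1 -> dU d y = d i * du i y.
  move=> yy; rewrite /dU (bigD1 i)//= big1 ?addr0.
    by rewrite /dw patch_in//; case/andP: yy => /ltW -> /ltW ->.
  move=> j ji; rewrite /dw (part_out xS _ (_ : (i <= k)%N))// ?mulr0//; try by rewrite -ltnS ltn_ord.
  by rewrite eq_sym.
have ACU d : abscont 0 1 (U d) (dU d) by exact: abscont_sum.
have L2U d : L2 (U d) by exact: L2_sum.
have L2dU d : L2 (dU d) by exact: L2_sum.
have IU2 d : itg 0 1 (fun y => U d y ^+ 2 * H y) by apply: weight_itg => //; have /L2P[] := L2U d.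
have IdU2 d : itg 0 1 (fun y => dU d y ^+ 2 * H y) by apply: weight_itg => //; have /L2P[] := L2dU d.
have IUH d : itg 0 1 (fun y => U d y * H y) by apply: weight_itg => //; exact: L2_itg.
have IHp (i : 'I_k.+1) f : {within `[x i, x i.+1], continuous f} ->
    itg (x i) (x i.+1) (fun y => f y * H y).
  move=> cf; have [h1 h2 h3] := p01 i.
  apply: (@eq_itg _ _ _ (fun y => H y * f y)); first by move=> y _; rewrite mulrC.
  apply: itg_mul_cont => //; apply: itgS h1 h3 _.
  have := weight_itg wH (itg_cont (@within_cont_cst R 0 1 1)).
  by apply: eq_itg => y _; rewrite mul1r.
have sqc (i : 'I_k.+1) f : {within `[x i, x i.+1], continuous f} ->
    {within `[x i, x i.+1], continuous (fun y => f y ^+ 2)}.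
  move=> cf; apply: (@eq_within_cont _ _ _ (fun y => f y * f y)); first by move=> y _; rewrite expr2.
  exact: within_contM.
pose A (i : 'I_k.+1) := II (x i) (x i.+1) (fun y => u i y ^+ 2 * H y).
pose B (i : 'I_k.+1) := II (x i) (x i.+1) (fun y => du i y ^+ 2 * H y).
pose m (i : 'I_k.+1) := II (x i) (x i.+1) (fun y => u i y * H y).
(* The supports meet only at nodes, so both quadratic forms and the orthogonality condition are
   diagonal in the coefficients [d]. *)
have split_part (F : R -> R) (G : 'I_k.+1 -> R -> R) c : itg 0 1 F ->
    (forall i : 'I_k.+1, itg (x i) (x i.+1) (G i)) ->
    (forall (i : 'I_k.+1) y, x i < y < x i.+1 -> F y = c i * G i y) ->
    II 0 1 F = \sum_(i < k.+1) c i * II (x i) (x i.+1) (G i).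
  move=> IF IG FG; rewrite (II_part x0 xk xS IF); apply: eq_bigr => i _.
  have [h1 h2 h3] := p01 i.
  rewrite -IIZ//; apply: eq_II_oo; [exact: itgS IF|exact: itgZ|].
  by move=> y; rewrite in_itv/=; exact: FG.
have cu (i : 'I_k.+1) : {within `[x i, x i.+1], continuous (u i)} by have [[]] := Hu i.
have cdu (i : 'I_k.+1) : {within `[x i, x i.+1], continuous (du i)} by have [[]] := Hu i.
have EU d : II 0 1 (fun y => U d y ^+ 2 * H y) = \sum_(i < k.+1) d i ^+ 2 * A i.
  apply: split_part => // [i|i y yy]; first by apply: IHp; exact: sqc.
  by rewrite (UE _ i)// exprMn mulrA.
have EdU d : II 0 1 (fun y => dU d y ^+ 2 * H y) = \sum_(i < k.+1) d i ^+ 2 * B i.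
  apply: split_part => // [i|i y yy]; first by apply: IHp; exact: sqc.
  by rewrite (dUE _ i)// exprMn mulrA.
have EH d : II 0 1 (fun y => U d y * H y) = \sum_(i < k.+1) d i * m i.
  apply: split_part => // [i|i y yy]; first by apply: IHp.
  by rewrite (UE _ i)// mulrA.
have up (i : 'I_k.+1) y : x i < y < x i.+1 -> 0 < u i y /\ 0 < H y.
  move=> yy; have [h1 h2 h3] := p01 i; have [_ h _ _ _] := Hu i; split; first by apply: h; rewrite in_itv.
  by apply: Hp; case/andP: yy => ? ?; apply/andP; split; lra.
have A0 (i : 'I_k.+1) : 0 < A i.
  have [h1 h2 h3] := p01 i; apply: II_gt0 => //; first by apply: IHp; exact: sqc.
  by move=> y; rewrite in_itv/= => /up[? ?]; rewrite mulr_gt0// exprn_gt0.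
have m0 (i : 'I_k.+1) : 0 < m i.
  have [h1 h2 h3] := p01 i; apply: II_gt0 => //; first exact: IHp.
  by move=> y; rewrite in_itv/= => /up[? ?]; rewrite mulr_gt0.
have BA i : B i <= M * A i by have [] := Hu i.
pose wi (i : 'I_k) : 'I_k.+1 := widen_ord (leqnSn k) i.
have wimax i : (wi i == ord_max) = false.
  by apply/negP => /eqP /(congr1 val) /= h; have := ltn_ord i; rewrite h ltnn.
(* Dividing by the masses [m] makes each difference between the [i]-th function and the last one
   orthogonal to the weight. These [k] differences span all the orthogonal combinations. *)
pose dd (i : 'I_k) (j : 'I_k.+1) : R := ((j == wi i)%:R - (j == ord_max)%:R) / m j.
pose b (i : 'I_k) : R -> R := U (dd i).
pose D (c : 'I_k -> R) j := \sum_(i < k) c i * dd i j.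
have lincombE c : lincomb b c = U (D c).
  apply/funext => y; rewrite /lincomb /b /U.
  under eq_bigr do rewrite mulr_sumr.
  rewrite exchange_big/=; apply: eq_bigr => j _; rewrite /D mulr_suml.
  by apply: eq_bigr => i _; rewrite mulrA.
have Dwi c i : D c (wi i) = c i / m (wi i).
  rewrite /D (bigD1 i)//= big1 ?addr0.
    by rewrite /dd eqxx wimax subr0 mul1r.
  move=> l li; rewrite /dd wimax subr0.
  have -> : (wi i == wi l) = false.
    by apply/negP => /eqP /(congr1 val) /= h; move/negP: li; apply; apply/eqP/val_inj.
  by rewrite mul0r mulr0.
have Dm c : \sum_(j < k.+1) D c j * m j = 0.
  rewrite /D; under eq_bigr do rewrite mulr_suml.
  rewrite exchange_big/= big1// => i _.
  transitivity (\sum_(j < k.+1) c i * ((j == wi i)%:R - (j == ord_max)%:R)).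
    by apply: eq_bigr => j _; rewrite /dd; field; rewrite gt_eqF.
  have one (l : 'I_k.+1) : \sum_(j < k.+1) (j == l)%:R = 1 :> R.
    by rewrite (bigD1 l)//= eqxx big1 ?addr0// => j /negbTE ->.
  by rewrite -mulr_sumr sumrB !one subrr mulr0.
have wE d v : L2 v -> weak_derivative (U d) v ->
    {ae leb, forall y, I01 y -> v y = dU d y}.
  by move=> Lv; move/weak_derivative_uniq => /(_ _ Lv (L2dU d)); apply; exact: AC_weak.
suff : (sup_rayleigh H (range (lincomb b)) <= M%:E)%E.
  apply: le_trans; apply: ereal_inf_lbound; exists (range (lincomb b)) => //.
  split.
    exists b; split=> //.
      by move=> i; split; [exact: L2U|exists (dU (dd i)); [exact: L2dU|exact: AC_weak (ACU _)]].
    move=> c; rewrite lincombE => h i.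
    have [h1 h2 h3] := p01 (wi i).
    have /eqP : D c (wi i) = 0.
      apply: (@not_ae0_itv _ _ _ (u (wi i)) _ h1 h2 h3 _ _ h) => y yy; first by have [] := up _ _ yy.
      exact: UE.
    by rewrite Dwi mulf_eq0 invr_eq0 (gt_eqF (m0 _)) orbF => /eqP.
  by move=> _ [c _ <-]; rewrite lincombE Rint_I01// EH Dm.
apply: ub_ereal_sup => _ [U0 [v [[c _ <-] nae [Lv wv] ->]]].
rewrite lincombE in nae wv *; set d := D c in nae wv *.
rewrite /rayleigh (EFin_I01 (IU2 d)) (@eq_ae_EFin_II _ (fun y => dU d y ^+ 2 * H y))//; last 2 first.
- have [mv _] := Lv; apply: measurable_funM; first exact: measurable_funX.
  by apply/meas_I01.
- by apply: ae_mono (wE _ _ Lv wv) => y h yy; rewrite h.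
have d0 : exists i, d i != 0.
  apply: contrapT => /forallNP h; apply: nae; apply: aeW => y _ /=.
  rewrite /U big1// => i _; have /negP := h i; rewrite negbK => /eqP ->.
  by rewrite mul0r.
have UU : 0 < II 0 1 (fun y => U d y ^+ 2 * H y).
  case: d0 => i di; rewrite EU (bigD1 i)//= ltr_wpDr//.
    by apply: sumr_ge0 => j _; rewrite mulr_ge0 ?sqr_ge0// ltW.
  by rewrite mulr_gt0// exprn_even_gt0.
rewrite inver gt_eqF// -EFinM lee_fin ler_pdivrMr// EdU EU mulr_sumr; apply: ler_sum => i _.
by rewrite mulrCA ler_wpM2l ?sqr_ge0.
Qed.

Theorem SLeigen_ge (k : nat) (x : nat -> R) H M : weight H -> (0 < k)%N -> 0 <= M ->
  x 0%N = 0 -> x k.+1 = 1 -> (forall i, (i <= k)%N -> x i < x i.+1) ->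
  (forall i, (i <= k)%N -> lower_piece H M (x i) (x i.+1)) ->
  (M%:E <= SLeigen k H)%E.
Proof.
move=> wH k0 M0 x0 xk xS HP; have [mH H01 Hp] := wH.
apply: le_ereal_inf_tmp => _ [E [[b [Hb bind ->]] Eo] <-].
have /choice[v Hv] : forall i, exists v, L2 v /\ weak_derivative (b i) v.
  by move=> i; have [_ [v]] := Hb i; exists v.
have Lb i : L2 (b i) by have [] := Hb i.
have /choice[cc Hcc] : forall i, exists c, {ae leb, forall y, I01 y -> b i y = c + II 0 y (v i)}.
  by move=> i; have [Lv wv] := Hv i; exact: du_bois_reymond (Lb i) Lv wv.
(* The continuous representative of [b i], whose values at the nodes make sense. *)
pose B i y := cc i + II 0 y (v i).
have ACB i : abscont 0 1 (B i) (v i).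
  have [Lv _] := Hv i; split; first exact: L2_itg.
  by move=> y _; rewrite /B IIxx addr0.
pose A1 : 'M[R]_k := \matrix_(i, l) B i (x l.+1).
(* The rows hold the values at the [k] interior nodes of the [k] basis functions and of the constant
   1. There are [k + 1] rows and [k] columns, hence a nonzero row vector [r] in the left kernel. *)
pose A : 'M[R]_(k + 1, k) := col_mx A1 (const_mx 1).
have [r rA r0] : exists2 r : 'rV[R]_(k + 1), (r <= kermx A)%MS & r != 0.
  apply/rowV0Pn; rewrite -mxrank_eq0 mxrank_ker -lt0n subn_gt0.
  by rewrite (leq_ltn_trans (rank_leq_col A))// addn1.
move/sub_kermxP in rA.
pose d (i : 'I_k) := r 0 (lshift 1 i); pose e := r 0 (rshift k 0).
pose U y := \sum_(i < k) d i * B i y + e.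
pose V y := \sum_(i < k) d i * v i y.
have Uz l : (l < k)%N -> U (x l.+1) = 0.
  move=> lk; have := congr1 (fun C : 'rV_k => C 0 (Ordinal lk)) rA.
  rewrite -[r]hsubmxK mul_row_col !mxE big_ord1 !mxE mulr1 => h.
  rewrite -[RHS]h /U; congr (_ + _); apply: eq_bigr => i _.
  by rewrite !mxE.
have [i di] : exists i, d i != 0.
  apply: contrapT => /forallNP h.
  have {}h i : d i = 0 by have /negP := h i; rewrite negbK => /eqP.
  have e0 : e = 0 by rewrite -(Uz 0%N k0) /U big1 ?add0r// => i _; rewrite h mul0r.
  case/eqP: r0; apply/rowP => j; rewrite mxE.
  by case: (split_ordP j) => l ->; [exact: h|rewrite (ord1 l)].
have Ev (a : 'I_k -> R) : lincomb b a = (fun y => \sum_(i < k) a i * b i y) by [].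
have Lu : L2 (lincomb b d) by exact: L2_sum.
have Lv : L2 V by apply: L2_sum => j; have [] := Hv j.
have wv : weak_derivative (lincomb b d) V.
  by apply: weak_derivative_sum => j //; have [] := Hv j.
have nae : ~ ae0 (lincomb b d) by move=> /bind /(_ i)/eqP; rewrite (negbTE di).
apply: (@le_trans _ _ (rayleigh H (lincomb b d) V)); last first.
  by apply: ereal_sup_ubound; exists (lincomb b d), V; split=> //; exists d.
have IU2 : itg 0 1 (fun y => lincomb b d y ^+ 2 * H y) by apply: weight_itg => //; have /L2P[] := Lu.
have IV2 : itg 0 1 (fun y => V y ^+ 2 * H y) by apply: weight_itg => //; have /L2P[] := Lv.
have IH0 : itg 0 1 H.
  have := weight_itg wH (itg_cont (@within_cont_cst R 0 1 1)).
  by apply: eq_itg => y _; rewrite mul1r.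
have IuH : itg 0 1 (fun y => lincomb b d y * H y) by apply: weight_itg => //; exact: L2_itg.
have H0 y : 0 < y < 1 -> 0 <= H y by move=> yy; exact/ltW/Hp.
have D0 : 0 < II 0 1 (fun y => lincomb b d y ^+ 2 * H y).
  rewrite lt_neqAle eq_sym; apply/andP; split; last first.
    apply: II_ge0 => y; rewrite in_itv/= => yy; rewrite mulr_ge0 ?sqr_ge0//.
    by have /andP[] := H01 _ yy.
  apply/eqP => /II_eq0_ae h; apply: nae; apply: ae_mono (h IU2 _) => [y hy yy|y yy].
    have /eqP := hy yy; rewrite mulf_eq0 sqrf_eq0 => /orP[/eqP //|/eqP Hy].
    by have := Hp y; rewrite Hy ltxx; move: yy; rewrite /= in_itv/= => yy /(_ yy).
  by rewrite mulr_ge0 ?sqr_ge0// H0.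
rewrite /rayleigh (EFin_I01 IV2) (EFin_I01 IU2) inver gt_eqF// -EFinM lee_fin ler_pdivlMr//.
have ACU : abscont 0 1 U V.
  have := ACD (abscont_sum d ACB) (AC_cst 0 1 e).
  by under [X in abscont _ _ _ X -> _]eq_fun do rewrite addr0.
have LU : L2 U by apply: L2_cont; exact: AC_cont ACU.
have IUU : itg 0 1 (fun y => U y ^+ 2 * H y) by apply: weight_itg => //; have /L2P[] := LU.
have uU : {ae leb, forall y, I01 y -> U y = lincomb b d y + e}.
  have : {ae leb, forall y, forall i, I01 y -> b i y = B i y}.
    have gen n (f g : 'I_n -> R -> R) : (forall i, {ae leb, forall y, I01 y -> f i y = g i y}) ->
        {ae leb, forall y, forall i, I01 y -> f i y = g i y}.
      elim: n f g => [|n IH] f g h; first by apply: aeW => y [].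
      have h1 := h ord_max; have h2 := IH _ _ (fun i => h (widen_ord (leqnSn n) i)).
      apply: ae_mono (ae_and h1 h2) => y [e1 e2] j yy.
      have [jn|] := ltnP j n.
        by have := e2 (Ordinal jn) yy; congr (f _ _ = g _ _); exact: val_inj.
      move=> nj; have -> : j = ord_max by apply/val_inj/eqP; rewrite eqn_leq /= nj -ltnS ltn_ord.
      exact: e1.
    by apply: gen.
  by apply: ae_mono => y h yy; rewrite /U /lincomb; congr (_ + _); apply: eq_bigr => j _; rewrite h.
have orth : II 0 1 (fun y => lincomb b d y * H y) = 0.
  by rewrite -Rint_I01//; apply: Eo; exists d.
(* Adding the constant [e] does not change the derivative and, by orthogonality, can only increase
   the weighted norm. *)
have IUu : II 0 1 (fun y => U y ^+ 2 * H y) =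
    II 0 1 (fun y => lincomb b d y ^+ 2 * H y) + e ^+ 2 * II 0 1 H.
  have I1 := itgZ (2 * e) IuH; have I2 := itgZ (e ^+ 2) IH0.
  transitivity (II 0 1 (fun y => lincomb b d y ^+ 2 * H y +
      ((2 * e) * (lincomb b d y * H y) + e ^+ 2 * H y))).
    apply: ae_eq_II => //; first by apply: itgD => //; exact: itgD.
    by apply: ae_mono uU => y h yy; rewrite h//; ring.
  by rewrite IID ?IID ?IIZ ?orth ?mulr0 ?add0r//; exact: itgD.
apply: (@le_trans _ _ (M * II 0 1 (fun y => U y ^+ 2 * H y))).
  rewrite ler_wpM2l// IUu lerDl mulr_ge0 ?sqr_ge0//; apply: II_ge0 => y; rewrite in_itv/= => yy.
  by have /andP[] := H01 _ yy.
rewrite (II_part x0 xk xS IUU) (II_part x0 xk xS IV2) mulr_sumr; apply: ler_sum => j _.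
have jk : (j <= k)%N by rewrite -ltnS.
have /andP[j0 _] := part01 x0 xk xS (leqW jk); have jk1 : (j.+1 <= k.+1)%N by [].
have /andP[_ j1] := part01 x0 xk xS jk1.
apply: HP => //.
- by apply: ACS ACU => //; exact/ltW/xS.
- by have /L2P[_ I] := Lv; apply: itgS I.
- case: (j : nat) jk => [|l] lk; [by left|right; exact: Uz].
- move: jk; rewrite leq_eqVlt => /predU1P[->|lk]; [by left|right; exact: Uz].
Qed.

End Assembly.

(** * Concave profiles *)

Section Concave.
Variable R : realType.
Implicit Types (h : R -> R) (x y z t al s M : R).

(** The chord inequality cleared of denominators, ready for linear arithmetic. *)
Definition concave01 h := forall x y z, 0 <= x -> x < y -> y < z -> z <= 1 ->
  (z - y) * h x + (y - x) * h z <= (z - x) * h y.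

Definition concave_unit h := [/\ forall x, 0 <= x <= 1 -> 0 <= h x <= 1,
  concave01 h & exists2 t, 0 <= t <= 1 & h t = 1].

Lemma concave01_conv h c a b : concave01 h -> 0 <= c <= 1 -> 0 <= a <= 1 -> 0 <= b <= 1 ->
  c * h a + (1 - c) * h b <= h (c * a + (1 - c) * b).
Proof.
move=> ch /andP[c0 c1] /andP[a0 a1] /andP[b0 b1].
have [->|ab] := eqVneq a b.
  have -> : c * b + (1 - c) * b = b by ring.
  lra.
have [->|cn0] := eqVneq c 0.
  have -> : 0 * a + (1 - 0) * b = b by ring.
  lra.
have [->|cn1] := eqVneq c 1.
  have -> : 1 * a + (1 - 1) * b = a by ring.
  lra.
have {}c0 : 0 < c by rewrite lt_neqAle eq_sym cn0.
have {}c1 : c < 1 by rewrite lt_neqAle cn1.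
move: ab; rewrite neq_lt => /orP[ab|ba].
  have := ch a (c * a + (1 - c) * b) b a0 _ _ b1.
  have -> : b - (c * a + (1 - c) * b) = c * (b - a) by ring.
  have -> : c * a + (1 - c) * b - a = (1 - c) * (b - a) by ring.
  have -> : c * (b - a) * h a + (1 - c) * (b - a) * h b = (b - a) * (c * h a + (1 - c) * h b) by ring.
  by rewrite ler_pM2l ?subr_gt0//; apply; nra.
have := ch b (c * a + (1 - c) * b) a b0 _ _ a1.
have -> : a - (c * a + (1 - c) * b) = (1 - c) * (a - b) by ring.
have -> : c * a + (1 - c) * b - b = c * (a - b) by ring.
have -> : (1 - c) * (a - b) * h b + c * (a - b) * h a = (a - b) * (c * h a + (1 - c) * h b) by ring.
by rewrite ler_pM2l ?subr_gt0//; apply; nra.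
Qed.

Lemma classLP h : classL h <-> concave_unit h.
Proof.
split=> -[h01 ch ht]; split=> //.
- move=> x y z x0 xy yz z1; have xz := lt_trans xy yz.
  have zx0 : 0 < z - x by rewrite subr_gt0.
  have t0 : 0 <= (z - y) / (z - x) by rewrite divr_ge0// subr_ge0 ltW.
  have t1 : (z - y) / (z - x) <= 1 by rewrite ler_pdivrMr// mul1r lerD2l lerN2 ltW.
  have := ch (Itv01 t0 t1) x z.
  rewrite !inE/= !in_itv/= x0 z1 (ltW (lt_le_trans xz z1)) (ltW (le_lt_trans x0 xz)) => /(_ isT isT) H.
  have {}H : - h ((z - y) / (z - x) * x + (1 - (z - y) / (z - x)) * z) <=
    (z - y) / (z - x) * (- h x) + (1 - (z - y) / (z - x)) * (- h z) := H.
  move: H; have -> : (z - y) / (z - x) * x + (1 - (z - y) / (z - x)) * z = y.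
    by field; rewrite gt_eqF.
  have -> : (z - y) / (z - x) * (- h x) + (1 - (z - y) / (z - x)) * (- h z) =
     - (((z - y) * h x + (y - x) * h z) / (z - x)) by field; rewrite gt_eqF.
  by rewrite lerN2 ler_pdivrMr// mulrC; lra.
- move=> t a b; rewrite !inE/= !in_itv/= => a01 b01.
  set c := t%:num; have c0 : 0 <= c by rewrite /c ge0. have c1 : c <= 1 by rewrite /c le1.
  have c01 : 0 <= c <= 1 by rewrite c0.
  have := concave01_conv ch c01 a01 b01; rewrite -lerN2 opprD -!mulrN; exact.
Qed.

Variable h : R -> R.
Hypothesis hL : concave_unit h.

Lemma concave_ge0 x : 0 <= x <= 1 -> 0 <= h x.
Proof. by case: hL => h01 _ _ /h01/andP[]. Qed.

Lemma concave_le1 x : 0 <= x <= 1 -> h x <= 1.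
Proof. by case: hL => h01 _ _ /h01/andP[]. Qed.

(** The point [x] is a maximum point or lies on a chord joining one to an end, where [h] is
    nonnegative. *)
Lemma concave_gt0 x : 0 < x < 1 -> 0 < h x.
Proof.
case: (hL) => h01 ch [t /andP[t0 t1] ht] /andP[x0 x1].
have h0 : 0 <= h 0 by apply: concave_ge0; rewrite lexx ler01.
have h1 : 0 <= h 1 by apply: concave_ge0; rewrite lexx ler01.
have [tx|xt|<-] := ltgtP t x; last by rewrite ht.
- have := ch t x 1 t0 tx x1 (lexx _); rewrite ht => H; have : 0 < (1 - t) * h x by nra.
  by rewrite pmulr_rgt0// subr_gt0 (lt_trans tx).
- have := ch 0 x t (lexx _) x0 xt t1; rewrite ht => H; have : 0 < (t - 0) * h x by nra.
  by rewrite pmulr_rgt0// subr0 (lt_trans x0).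
Qed.

(** The chord starts at 0, where [h >= 0]. This is the monotonicity of [h / l] on the first piece,
    with [l = x]. *)
Lemma concave_x x y : 0 < x -> x <= y -> y <= 1 -> h y * x <= h x * y.
Proof.
case: (hL) => h01 ch _ x0; rewrite le_eqVlt => /predU1P[->//|xy] y1.
have h0 : 0 <= h 0 by apply: concave_ge0; rewrite lexx ler01.
have := ch 0 x y (lexx _) x0 xy y1; nra.
Qed.

Lemma concave_1x x y : 0 <= x -> x <= y -> y < 1 -> h x * (1 - y) <= h y * (1 - x).
Proof.
case: (hL) => h01 ch _ x0; rewrite le_eqVlt => /predU1P[->//|xy] y1.
have h1 : 0 <= h 1 by apply: concave_ge0; rewrite lexx ler01.
have := ch x y 1 x0 xy y1 (lexx _); nra.
Qed.

(** Together with [h <= 1], the chords issued from 0 and from 1 give an explicit constant. It blows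
    up at the ends, where a concave function may jump. *)
Lemma concave_lip y z : 0 < y < 1 -> 0 < z < 1 ->
  `|h z - h y| <= `|z - y| * (y^-1 + (1 - y)^-1).
Proof.
move=> yy zz; have hy := concave_gt0 yy; have hz := concave_gt0 zz.
case: (hL) => h01 _ _; move: (yy) (zz) => /andP[y0 y1] /andP[z0 z1].
have hy1 : h y <= 1 by apply: concave_le1; rewrite !ltW.
set A := y^-1; set B := (1 - y)^-1.
have yA : y * A = 1 by rewrite mulfV ?gt_eqF. have yB : (1 - y) * B = 1 by rewrite mulfV// gt_eqF// subr_gt0.
have A0 : 0 < A by rewrite invr_gt0. have B0 : 0 < B by rewrite invr_gt0 subr_gt0.
have step (a b c : R) : 0 < c -> a * c <= b -> forall d, c * d = 1 -> a <= b * d.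
  move=> c0 acb d cd; have d0 : 0 < d by rewrite -(pmulr_rgt0 _ c0) cd.
  by have := ler_wpM2r (ltW d0) acb; rewrite -mulrA cd mulr1.
rewrite ler_norml; have [yz|zy] := leP y z.
  rewrite ger0_norm ?subr_ge0//; apply/andP; split.
    have H1 := concave_1x (ltW y0) yz z1; have y10 : 0 < 1 - y by lra.
    have H2 : (h y - h z) * (1 - y) <= z - y by nra.
    have := step _ _ _ y10 H2 _ yB; nra.
  have H1 := concave_x y0 yz (ltW z1).
  have H2 : (h z - h y) * y <= z - y by nra.
  have := step _ _ _ y0 H2 _ yA; nra.
rewrite ltr0_norm ?subr_lt0//; apply/andP; split.
  have H1 := concave_x z0 (ltW zy) (ltW y1).
  have H2 : (h y - h z) * y <= y - z by nra.
  have := step _ _ _ y0 H2 _ yA; nra.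
have H1 := concave_1x (ltW z0) (ltW zy) y1.
have H2 : (h z - h y) * (1 - y) <= y - z by nra.
have y10 : 0 < 1 - y by lra.
have := step _ _ _ y10 H2 _ yB; nra.
Qed.

Lemma concave_cont y : 0 < y < 1 -> {for y, continuous h}.
Proof.
move=> yy; have /andP[y0 y1] := yy.
set K := y^-1 + (1 - y)^-1.
have K0 : 0 < K by rewrite addr_gt0// invr_gt0// subr_gt0.
apply/cvgrPdist_le => e e0; near=> z.
have zz : 0 < z < 1.
  by apply/andP; split; near: z; [exact: lt_nbhsr|exact: lt_nbhsl].
rewrite distrC; apply: (le_trans (concave_lip yy zz)); rewrite -ler_pdivlMr// distrC.
near: z; apply: (@cvgr_dist_le _ R^o _ (nbhs y) _ id); first exact: cvg_id.
exact: divr_gt0.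
Unshelve. all: by end_near. Qed.

Lemma concave_weight al : 0 < al -> weight (fun x => h x `^ al).
Proof.
move=> al0; case: (hL) => h01 _ _; split.
- apply/meas_I01; apply: (measurableT_comp (measurable_powR al)).
  apply: open_continuous_measurable_fun; first exact: interval_open.
  by move=> y; rewrite inE/= in_itv/=; exact: concave_cont.
- move=> x xx; have /andP[h0 h1] := h01 _ xx; rewrite powR_ge0/=.
  rewrite [leRHS](_ : 1 = 1 `^ al); last by rewrite powR1.
  by apply: ge0_ler_powR; rewrite ?nnegrE// ltW.
- by move=> x xx; rewrite powR_gt0// concave_gt0.
Qed.

(** Along the chord from a point to the contact point, [h] is at least the convex combination for
    which [l] has equality. As [h <= l], the ratio [h / l] can only increase towards its value 1 at
    [x0]. *)
Lemma concave_ratio m s (l := fun x => m + s * x) x0 : 0 < x0 < 1 ->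
  (forall x, 0 <= x <= 1 -> h x <= l x) -> h x0 = l x0 ->
  (forall x y, 0 < x -> x <= y -> y <= x0 -> h x * l y <= h y * l x) /\
  (forall x y, x0 <= x -> x <= y -> y < 1 -> h y * l x <= h x * l y).
Proof.
case: (hL) => h01 ch _ /andP[x00 x01] hl hx0.
have hx0p : 0 < h x0 by apply: concave_gt0; rewrite x00.
(* Common to both sides: [d1] and [d2] are the unnormalized chord weights of the outer point and of
   the contact point. *)
have aux (d1 d2 hx hy lx ly l0 : R) : 0 < d1 + d2 -> 0 <= d2 -> 0 < hx -> hx <= lx -> 0 < l0 ->
    ly * (d1 + d2) = d1 * lx + d2 * l0 -> d1 * hx + d2 * l0 <= (d1 + d2) * hy -> hx * ly <= hy * lx.
  move=> d0 d20 hx0' hlx l00 e H; rewrite -(ler_pM2r d0) -mulrA e.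
  have := ler_wpM2r (le_trans (ltW hx0') hlx) H.
  have : 0 <= d2 * l0 * (lx - hx) by rewrite !mulr_ge0 ?subr_ge0// ltW.
  by move=> h1 h2; apply: le_trans (le_trans _ h2) _; lra.
split=> x y.
- move=> xp; rewrite le_eqVlt => /predU1P[->//|xy]; rewrite le_eqVlt => /predU1P[yE|yx0].
    rewrite yE -hx0 mulrC ler_wpM2l// ?hl//; last by apply/andP; split; lra.
    exact: ltW.
  apply: (@aux (x0 - y) (y - x) _ _ _ _ (l x0)); rewrite -?hx0//.
  - lra.
  - lra.
  - by apply: concave_gt0; apply/andP; split; lra.
  - by apply: hl; apply/andP; split; lra.
  - by rewrite hx0 /l; ring.
  - have := ch x y x0 (ltW xp) xy yx0 (ltW x01).
    by have -> : x0 - y + (y - x) = x0 - x by ring.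
- rewrite le_eqVlt => /predU1P[<-|x0x]; rewrite le_eqVlt => /predU1P[->//|xy] y1.
    rewrite -hx0 mulrC ler_wpM2l// ?hl//; last by apply/andP; split; lra.
    exact: ltW.
  apply: (@aux (x - x0) (y - x) _ _ _ _ (l x0)); rewrite -?hx0//.
  - lra.
  - lra.
  - by apply: concave_gt0; apply/andP; split; lra.
  - by apply: hl; apply/andP; split; lra.
  - by rewrite hx0 /l; ring.
  - have := ch x0 x y (ltW x00) x0x xy (ltW y1).
    have -> : x - x0 + (y - x) = y - x0 by ring.
    by rewrite addrC.
Qed.

(* Concavity turns the one-sided contact with [Phi] into a supporting line of [h]. *)
Lemma concave_touch x0 Phi s : 0 < x0 < 1 -> is_derive x0 1 Phi s ->
  (\forall x \near x0, Phi x <= h x) -> Phi x0 = h x0 ->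
  forall x, 0 <= x <= 1 -> h x <= h x0 + s * (x - x0).
Proof.
case: (hL) => h01 ch _ /andP[x00 x01] dPhi Ph Px0 x /andP[xp x1].
have /is_derive1_caratheodory[g [gE cg gs]] := dPhi.
have slope K : s < K \/ K < s -> exists2 e, 0 < e & forall z, `|z - x0| < e ->
    [/\ 0 < z < 1, Phi z <= h z & (s < K -> g z < K) /\ (K < s -> K < g z)].
  move=> sK; have gK : \forall z \near x0, (s < K -> g z < K) /\ (K < s -> K < g z).
    case: sK => sK; near=> z; split=> [h1|h1]; try (by have := lt_asym K s; rewrite sK h1); near: z.
      by apply: (cvgr_lt (g x0)) => //; rewrite gs.
    by apply: (cvgr_gt (g x0)) => //; rewrite gs.
  have : \forall z \near x0, [/\ 0 < z < 1, Phi z <= h z & (s < K -> g z < K) /\ (K < s -> K < g z)].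
    near=> z; split.
    - by apply/andP; split; near: z; [exact: lt_nbhsr|exact: lt_nbhsl].
    - by near: z.
    - by near: z.
  move=> /nbhs_ballP[e /= e0 He]; exists e => // z ze; apply: He.
  by rewrite /ball/= distrC.
have [xx0|x0x|<-] := ltgtP x x0; last by rewrite subrr mulr0 addr0.
(* If [h x] were above the line, the chord from [x] to [x0] would have slope [K < s]. Just to the
   right of [x0], [h >= Phi] rises faster than [K], against concavity. *)
- rewrite leNgt; apply/negP => H.
  have d0 : 0 < x0 - x by lra.
  pose K := (h x0 - h x) / (x0 - x).
  have Ks : K < s by rewrite /K ltr_pdivrMr//; lra.
  have [e e0 He] := slope _ (or_intror Ks).
  have [|/andP[z0 z1] Pz [_ /(_ Ks) gz]] := He (x0 + e / 2).
    by rewrite addrAC subrr add0r gtr0_norm; lra.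
  set z := x0 + e / 2 in z0 z1 Pz gz.
  have x0z : x0 < z by rewrite /z; lra.
  have := ch x x0 z xp xx0 x0z (ltW z1).
  have := gE z; rewrite Px0 => E1.
  have EK : K * (x0 - x) = h x0 - h x by rewrite /K; field; rewrite gt_eqF.
  have zz : 0 < z - x0 by lra.
  have : K * (z - x0) < h z - h x0.
    by apply: (@lt_le_trans _ _ (g z * (z - x0))); [rewrite ltr_pM2r|lra].
  nra.
- rewrite leNgt; apply/negP => H.
  have d0 : 0 < x - x0 by lra.
  pose K := (h x - h x0) / (x - x0).
  have Ks : s < K by rewrite /K ltr_pdivlMr//; lra.
  have [e e0 He] := slope _ (or_introl Ks).
  have [|/andP[z0 z1] Pz [/(_ Ks) gz _]] := He (x0 - e / 2).
    by rewrite addrAC subrr add0r normrN gtr0_norm; lra.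
  set z := x0 - e / 2 in z0 z1 Pz gz.
  have x0z : z < x0 by rewrite /z; lra.
  have := ch z x0 x (ltW z0) x0z x0x x1.
  have := gE z; rewrite Px0 => E1.
  have EK : K * (x - x0) = h x - h x0 by rewrite /K; field; rewrite gt_eqF.
  have zz : 0 < x0 - z by lra.
  have : h x0 - h z < K * (x0 - z).
    by apply: (@le_lt_trans _ _ (g z * (x0 - z))); [lra|rewrite ltr_pM2r].
  nra.
Unshelve. all: by end_near. Qed.

(** Writes [h^al] as [rho l^al] with [rho = (h/l)^al], the form in which [unimodal_rayleigh]
    applies. Positivity of [l] and monotonicity of [h / l] are asked only inside, because [l]
    vanishes at 0 or 1 on the extreme pieces. *)
Lemma upper_of_flux al M p q x0 (l u du f : R -> R) : 1 <= al ->
  0 <= p -> p < q -> q <= 1 -> p <= x0 <= q ->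
  {in `]p, q[, forall x, 0 < l x} -> {in `]p, q[, continuous l} ->
  {within `[p, q], continuous (fun x => l x `^ al)} ->
  C1 p q u du -> abscont p q (fun x => l x `^ al * du x) f ->
  {in `[p, q], forall x, - M * (l x `^ al * u x) <= f x} ->
  {in `]p, q[, forall x, 0 < u x} -> 0 <= u p -> 0 <= u q ->
  p = 0 \/ u p = 0 -> q = 1 \/ u q = 0 ->
  {in `[p, q], forall x, x <= x0 -> 0 <= l x `^ al * du x} ->
  {in `[p, q], forall x, x0 <= x -> l x `^ al * du x <= 0} ->
  (forall x y, p < x -> x <= y -> y <= x0 -> y < q -> h x * l y <= h y * l x) ->
  (forall x y, x0 <= x -> x <= y -> y < q -> p < x -> h y * l x <= h x * l y) ->
  upper_piece (fun x => h x `^ al) M p q.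
Proof.
move=> al1 p0 pq q1 x0pq lp cl cr C1u ACF fM up up0 uq0 bp bq Fp Fm mp mm.
exists u, du; split=> //.
have al0 : 0 < al by lra.
have [mH _ _] := concave_weight al0.
have IH : itg 0 1 (fun x => h x `^ al).
  have := weight_itg (concave_weight al0) (itg_cont (@within_cont_cst R 0 1 1)).
  by apply: eq_itg => y _; rewrite mul1r.
have IHpq : itg p q (fun x => h x `^ al) by apply: itgS IH.
have [_ cu cdu] := C1u.
have sqc (f0 : R -> R) : {within `[p, q], continuous f0} ->
    {within `[p, q], continuous (fun y => f0 y ^+ 2)}.
  move=> cf; apply: (@eq_within_cont _ _ _ (fun y => f0 y * f0 y)); first by move=> y _; rewrite expr2.
  exact: within_contM.
have I1 : itg p q (fun x => du x ^+ 2 * h x `^ al).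
  by apply: (@eq_itg _ _ _ (fun x => h x `^ al * du x ^+ 2)) => [x _|]; [rewrite mulrC|apply: itg_mul_cont => //; exact: sqc].
have I2 : itg p q (fun x => u x ^+ 2 * h x `^ al).
  by apply: (@eq_itg _ _ _ (fun x => h x `^ al * u x ^+ 2)) => [x _|]; [rewrite mulrC|apply: itg_mul_cont => //; exact: sqc].
pose rho x := (h x / l x) `^ al.
have pq01 x : p < x < q -> 0 < x < 1 by move=> /andP[? ?]; apply/andP; split; lra.
have rhoE : {in `]p, q[, forall x, rho x * l x `^ al = h x `^ al}.
  move=> x xx; have lx := lp _ xx; have hx : 0 < h x.
    by apply/concave_gt0/pq01; move: xx; rewrite in_itv.
  by rewrite /rho -powRM ?divr_ge0 ?ltW// divfK// gt_eqF.
pose T x := rho x * (l x `^ al * (du x ^+ 2 - M * u x ^+ 2)).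
pose T' x := du x ^+ 2 * h x `^ al - M * (u x ^+ 2 * h x `^ al).
have IT' : itg p q T' by apply: itgB => //; exact: itgZ.
have TT : {in `]p, q[, T' =1 T}.
  by move=> x xx; rewrite /T mulrA rhoE// /T'; ring.
have IT : itg p q T by apply: eq_itg_oo IT'.
rewrite -subr_le0 -IIZ// -IIB//; last exact: itgZ.
rewrite -/T' (eq_II_oo IT' IT TT).
have u0 : {in `[p, q], forall x, 0 <= u x}.
  move=> x; rewrite in_itv/= => /andP[]; rewrite le_eqVlt => /predU1P[<-//|px].
  rewrite le_eqVlt => /predU1P[->//|xq]; apply/ltW/up; by rewrite in_itv/= px.
have [? ?] := andP x0pq.
apply: (@unimodal_rayleigh _ p q x0 M _ u du f rho) => //.
- apply/meas_oo; apply: (measurableT_comp (measurable_powR al)).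
  apply: open_continuous_measurable_fun; first exact: interval_open.
  move=> y; rewrite inE => yy; apply: cvgM.
    by apply/concave_cont/pq01; move: yy; rewrite /= in_itv.
  by apply: cvgV; [rewrite gt_eqF// lp|exact: cl].
- by move=> x _; exact: powR_ge0.
- move=> x y px xy yx0 yq; have xxq : x \in `]p, q[ by rewrite in_itv/= px (le_lt_trans xy).
  have yyq : y \in `]p, q[ by rewrite in_itv/= yq (lt_le_trans px).
  have hx : 0 < h x by apply/concave_gt0/pq01; move: xxq; rewrite in_itv.
  have hy : 0 < h y by apply/concave_gt0/pq01; move: yyq; rewrite in_itv.
  apply: ge0_ler_powR; rewrite ?nnegrE ?divr_ge0 ?(ltW hx) ?(ltW hy) ?(ltW al0) ?(ltW (lp _ xxq)) ?(ltW (lp _ yyq))//.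
  by rewrite ler_pdivrMr ?lp// mulrAC ler_pdivlMr ?lp// mp.
- move=> x y x0x xy yq px; have xxq : x \in `]p, q[ by rewrite in_itv/= px (le_lt_trans xy).
  have yyq : y \in `]p, q[ by rewrite in_itv/= yq (lt_le_trans px).
  have hx : 0 < h x by apply/concave_gt0/pq01; move: xxq; rewrite in_itv.
  have hy : 0 < h y by apply/concave_gt0/pq01; move: yyq; rewrite in_itv.
  apply: ge0_ler_powR; rewrite ?nnegrE ?divr_ge0 ?(ltW hx) ?(ltW hy) ?(ltW al0) ?(ltW (lp _ xxq)) ?(ltW (lp _ yyq))//.
  by rewrite ler_pdivrMr ?lp// mulrAC ler_pdivlMr ?lp// mm.
Qed.

End Concave.

(** * The Liouville transformation for an affine profile *)

Section Liouville.
Variable R : realType.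
Implicit Types (p q x al M : R) (F f G g : R -> R).

Lemma C1_intro p q F f : {in `[p, q], forall x, is_derive x 1 F (f x)} ->
  {within `[p, q], continuous f} -> C1 p q F f.
Proof.
move=> dF cf; split=> //; first by move=> x xx; apply: dF; apply: subset_itv_oo_cc xx.
by apply: derivable_within_continuous => x /dF[].
Qed.

Lemma eq_C1 p q F f g : {in `[p, q], f =1 g} -> C1 p q F f -> C1 p q F g.
Proof.
move=> fg [dF cF cf]; split => //; last exact: eq_within_cont cf.
move=> x xx; apply: is_derive_eq (dF x xx) _; apply: fg; exact: subset_itv_oo_cc xx.
Qed.

Lemma eq_abscont p q F G f g : p <= q -> {in `[p, q], F =1 G} -> {in `[p, q], f =1 g} ->
  abscont p q F f -> abscont p q G g.
Proof.
move=> pq FG fg [If HF]; split; first exact: eq_itg If.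
move=> x xx; rewrite -!FG ?in_itv/= ?lexx ?pq// HF//; congr (_ + _); apply: eq_II => y.
rewrite in_itv/= => /andP[py yx]; apply: fg; rewrite in_itv/= py (le_trans yx)//.
by move: xx; rewrite in_itv/= => /andP[].
Qed.

Variables (p q m s al : R) (w dw ddw : R -> R).
Hypothesis pq : p < q.
Let l x := m + s * x.
Hypothesis l0 : {in `[p, q], forall x, 0 < l x}.
Hypotheses (Cw : C1 p q w dw) (Cdw : C1 p q dw ddw).

Let L x := l x `^ (al / 2).
Let g x := al / 2 * (s / l x).
(* Liouville transformation: [u = w / l^(al/2)], its derivative, and the
   derivative of the flux [l^al u']. *)
Definition liouville_u x := w x / L x.
Definition liouville_du x := (dw x - g x * w x) / L x.
Definition liouville_f x := L x * (ddw x - al / 2 * (al / 2 - 1) * (s / l x) ^+ 2 * w x).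

Lemma L_gt0 x : x \in `[p, q] -> 0 < L x.
Proof. by move=> /l0; exact: powR_gt0. Qed.

Lemma is_derive_affine x : is_derive x 1 l s.
Proof. by apply: is_derive_eq; rewrite /GRing.scale/=; ring. Qed.

Lemma C1_l : C1 p q l (fun=> s).
Proof. by apply: C1_intro => [x _|]; [exact: is_derive_affine|exact: within_cont_cst]. Qed.

Lemma l_neq0 : {in `[p, q], forall x, l x != 0}.
Proof. by move=> x xx; rewrite gt_eqF// l0. Qed.

Lemma C1_g : C1 p q g (fun x => - (al / 2) * (s / l x) ^+ 2).
Proof.
have H := C1M (C1_cst p q (al / 2 * s)) (C1V l_neq0 C1_l).
have -> : g = (fun x => al / 2 * s * (l x)^-1) by apply/funext => x; rewrite /g mulrA.
apply: eq_C1 H => x xx /=; rewrite mul0r add0r.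
by field; exact: l_neq0.
Qed.

Lemma C1_L : C1 p q L (fun x => g x * L x).
Proof.
have [_ cg _] := C1_g.
have dL : {in `[p, q], forall x, is_derive x 1 L (g x * L x)}.
  move=> x xx; have lx := l0 xx.
  have := @is_derive1_comp _ (fun y => y `^ (al / 2)) l x _ _ (is_derive1_powR _ lx) (is_derive_affine x).
  move=> H; apply: (is_derive_eq H); rewrite /g /L.
  have -> : l x `^ (al / 2) = l x * l x `^ (al / 2 - 1).
    rewrite -{2}(powRr1 (ltW lx)) -powRD; last by rewrite (gt_eqF lx) implybT.
    by rewrite addrC subrK.
  by field; exact: l_neq0.
apply: C1_intro => //; apply: within_contM => //.
by apply: derivable_within_continuous => x /dL[].
Qed.

Lemma L_neq0 : {in `[p, q], forall x, L x != 0}.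
Proof. by move=> x xx; rewrite gt_eqF// L_gt0. Qed.

Lemma C1_liouville : C1 p q liouville_u liouville_du.
Proof.
apply: eq_C1 (C1M Cw (C1V L_neq0 C1_L)) => x xx; rewrite /liouville_du.
by field; exact: L_neq0.
Qed.

Lemma powR_LL x : x \in `[p, q] -> l x `^ al = L x * L x.
Proof.
by move=> xx; have lx := l0 xx; rewrite /L -powRD ?(gt_eqF lx) ?implybT// -splitr.
Qed.

Lemma liouville_fluxE : {in `[p, q], forall x, l x `^ al * liouville_du x = L x * (dw x - g x * w x)}.
Proof.
move=> x xx; rewrite powR_LL// /liouville_du.
by field; exact: L_neq0.
Qed.

(** Since [L' = g L], the terms in [dw] cancel in the derivative of [L (dw - g w)], which leaves the
    potential [g' + g^2]. *)
Lemma abscont_liouville : abscont p q (fun x => l x `^ al * liouville_du x) liouville_f.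
Proof.
have C1N := C1D Cdw (C1M (C1_cst p q (-1)) (C1M C1_g Cw)).
have := C1_AC (ltW pq) (C1M C1_L C1N); apply: eq_abscont => [|x xx|x xx]; first exact: ltW.
  by rewrite liouville_fluxE// mulN1r.
rewrite /liouville_f /g; field; exact: l_neq0.
Qed.

End Liouville.

(** * Pieces with an affine comparison profile *)

Section PieceLemmas.
Variable R : realType.
Implicit Types (p q x al M : R) (h w dw ddw : R -> R).

(** The criticality condition says that the flux vanishes at [x0]. Of the two bounds on [Q], the
    lower one is the differential inequality behind the Rayleigh bound; the upper one makes the flux
    nonincreasing, so that [x0] separates its signs. *)
Lemma upper_line h al M p q x0 s w dw ddw : concave_unit h -> 1 <= al -> 0 <= M ->
  0 < p -> p < x0 -> x0 < q -> q < 1 ->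
  (forall x, 0 <= x <= 1 -> h x <= h x0 + s * (x - x0)) ->
  C1 p q w dw -> C1 p q dw ddw -> {in `]p, q[, forall x, 0 < w x} -> w p = 0 -> w q = 0 ->
  dw x0 * h x0 = al / 2 * s * w x0 ->
  (let Q x := ddw x - al / 2 * (al / 2 - 1) * (s / (h x0 + s * (x - x0))) ^+ 2 * w x in
   {in `[p, q], forall x, - M * w x <= Q x <= 0}) ->
  upper_piece (fun x => h x `^ al) M p q.
Proof.
move=> hL al1 M0 p0 px0 x0q q1 hl Cw Cdw wp wp0 wq0 crit; set m := h x0 - s * x0 => /= HQ.
have pq := lt_trans px0 x0q.
have lE x : h x0 + s * (x - x0) = m + s * x by rewrite /m; ring.
have x001 : 0 < x0 < 1 by apply/andP; split; lra.
have l0 : {in `[p, q], forall x, 0 < m + s * x}.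
  move=> x; rewrite in_itv/= => /andP[px xq]; rewrite -lE.
  apply: lt_le_trans (hl x _); last by apply/andP; split; lra.
  by apply: (concave_gt0 hL); apply/andP; split; lra.
have HQ' : {in `[p, q], forall x,
    - M * w x <= ddw x - al / 2 * (al / 2 - 1) * (s / (m + s * x)) ^+ 2 * w x <= 0}.
  by move=> x xx; have := HQ x xx; rewrite lE.
have [r1 r2] := @concave_ratio _ _ hL m s x0 x001
   (fun x xx => eq_ind _ (fun t => h x <= t) (hl x xx) _ (lE x))
   (eq_trans (esym (etrans (congr1 (fun t => h x0 + s * t) (subrr x0)) (etrans (congr1 (fun t => h x0 + t) (mulr0 s)) (addr0 _)))) (lE x0)).
have CU := C1_liouville al l0 Cw; have AF := abscont_liouville al pq l0 Cw Cdw.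
have L0 := L_gt0 al l0.
have x0pq : x0 \in `[p, q] by rewrite in_itv/= !ltW.
have F0 : (m + s * x0) `^ al * liouville_du m s al w dw x0 = 0.
  rewrite (liouville_fluxE al w dw l0)//; apply/eqP; rewrite mulf_eq0; apply/orP; right.
  have lx0 : m + s * x0 = h x0 by rewrite -lE subrr mulr0 addr0.
  rewrite lx0 subr_eq0; apply/eqP.
  have hx0 : h x0 != 0 by rewrite gt_eqF// (concave_gt0 hL).
  apply: (mulIf hx0); rewrite crit; field; exact: hx0.
have f0 : {in `[p, q], forall x, liouville_f m s al w ddw x <= 0}.
  move=> x xx; have /andP[_ h2] := HQ' x xx.
  by rewrite /liouville_f mulr_ge0_le0// ltW// L0.
have Fi a b : p <= a -> a <= b -> b <= q ->
    (m + s * b) `^ al * liouville_du m s al w dw b <= (m + s * a) `^ al * liouville_du m s al w dw a.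
  move=> pa ab bq; have A := ACS pa ab bq AF; have E := AC_int ab A.
  rewrite -subr_le0 -E; have [I _] := A.
  apply: (@le_trans _ _ (II a b (fun=> 0))); last by rewrite IIcst// mul0r.
  apply: le_II => //; first by apply: itg_cont; exact: within_cont_cst.
  move=> x; rewrite in_itv/= => /andP[ax xb]; apply: f0.
  by rewrite in_itv/= (le_trans pa)// (le_trans xb).
apply: (@upper_of_flux _ _ hL al M p q x0 (fun x => m + s * x) (liouville_u m s al w) (liouville_du m s al w dw)
  (liouville_f m s al w ddw)) => //; try exact: ltW.
- by move=> x xx; apply: l0; exact: subset_itv_oo_cc xx.
- move=> x _ y; apply: cvgD; first exact: cvg_cst.
  by apply: cvgM; [exact: cvg_cst|exact: cvg_id].
- apply: (@eq_within_cont _ _ _ (fun x => (m + s * x) `^ (al / 2) * (m + s * x) `^ (al / 2))).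
    by move=> x xx /=; rewrite (powR_LL al l0).
  by have [_ c _] := C1_L al l0; exact: within_contM.
- move=> x xx; rewrite (powR_LL _ l0)// /liouville_u /liouville_f.
  have Lx := L0 _ xx; have /andP[h1 _] := HQ' x xx.
  rewrite (_ : - M * _ = (m + s * x) `^ (al / 2) * (- M * w x)); last by field; rewrite gt_eqF.
  by rewrite ler_pM2l.
- move=> x xx; have xx' := subset_itv_oo_cc xx; rewrite /liouville_u divr_gt0//; [exact: wp|exact: L0].
- by rewrite /liouville_u wp0 mul0r.
- by rewrite /liouville_u wq0 mul0r.
- by right; rewrite /liouville_u wp0 mul0r.
- by right; rewrite /liouville_u wq0 mul0r.
- by move=> x; rewrite in_itv/= => /andP[px _] xx0; rewrite -[leLHS]F0; apply: Fi => //; exact: ltW.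
- by move=> x; rewrite in_itv/= => /andP[_ xq] xx0; rewrite -[leRHS]F0; apply: Fi => //; exact: ltW.
- by move=> x y px xy yx0 _; apply: r1 => //; exact: lt_trans px.
- by move=> x y x0x xy yq _; apply: r2 => //; exact: lt_trans q1.
Qed.

Lemma lower_line h al M p q m s w dw ddw : 0 <= M -> p < q ->
  {in `[p, q], forall x, h x = m + s * x} -> {in `[p, q], forall x, 0 < m + s * x} ->
  C1 p q w dw -> C1 p q dw ddw -> {in `]p, q[, forall x, 0 < w x} -> w p = 0 -> w q = 0 ->
  {in `[p, q], forall x, ddw x - al / 2 * (al / 2 - 1) * (s / (m + s * x)) ^+ 2 * w x = - M * w x} ->
  0 < p -> q < 1 ->
  lower_piece (fun x => h x `^ al) M p q.
Proof.
move=> M0 pq hE l0 Cw Cdw wp wp0 wq0 HQ p0 q1 U v ACU Iv bp bq.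
have CU := C1_liouville al l0 Cw; have AF := abscont_liouville al pq l0 Cw Cdw.
have L0 := L_gt0 al l0.
have w0 : {in `[p, q], forall x, 0 <= w x}.
  move=> x; rewrite in_itv/= => /andP[]; rewrite le_eqVlt => /predU1P[<-|px]; first by rewrite wp0.
  rewrite le_eqVlt => /predU1P[->|xq]; first by rewrite wq0.
  by apply/ltW/wp; rewrite in_itv/= px.
have cL : {within `[p, q], continuous (fun x => (m + s * x) `^ al)}.
  apply: (@eq_within_cont _ _ _ (fun x => (m + s * x) `^ (al / 2) * (m + s * x) `^ (al / 2))).
    by move=> x xx /=; rewrite (powR_LL al l0).
  by have [_ c _] := C1_L al l0; exact: within_contM.
rewrite (@eq_II _ _ _ _ (fun x => U x ^+ 2 * (m + s * x) `^ al)); last by move=> x xx; rewrite hE.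
rewrite [leRHS](@eq_II _ _ _ _ (fun x => v x ^+ 2 * (m + s * x) `^ al)); last by move=> x xx; rewrite hE.
apply: (@picone _ p q M _ (liouville_u m s al w) (liouville_du m s al w dw)) => //.
- by move=> x _; exact: powR_ge0.
- by move=> x xx; rewrite /liouville_u divr_ge0// ?w0// ltW ?L0.
- move=> x xx; have xx' := subset_itv_oo_cc xx; rewrite /liouville_u divr_gt0//; [exact: wp|exact: L0].
- apply: eq_abscont AF => [|//|x xx]; first exact: ltW.
  rewrite /liouville_f HQ// (powR_LL al l0)// /liouville_u.
  by field; rewrite gt_eqF// L0.
- by left; case: bp => // p00; rewrite p00 ltxx in p0.
- by left; case: bq => // q00; rewrite q00 ltxx in q1.
Qed.

End PieceLemmas.

(** * Bessel functions and their zeros *)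

Section GammaFunction.
Variable R : realType.
Local Notation leb := (@lebesgue_measure R).
Implicit Types s t K a x c : R.

Let g s t : R := t `^ (s - 1) * expR (- t).
Let e t : R := expR (- t / 2).

(** Half of the exponential absorbs the power, by one term of the exponential series; the other half
    remains as a majorant with an explicit primitive. *)
Lemma powR_expR_bound a : 0 <= a ->
  exists2 K : R, 0 < K & forall t, 0 <= t -> t `^ a * expR (- t) <= K * e t.
Proof.
move=> a0; have [n an] : exists n : nat, a <= n.+1%:R.
  exists (Num.truncn a); exact/ltW/truncnS_gt.
exists (1 + 2 ^+ n.+1 * n.+1`!%:R); first by rewrite ltr_pwDl// mulr_ge0// exprn_ge0.
move=> t t0; have -> : expR (- t) = e t * e t.
  by rewrite /e -expRD; congr expR; field.
rewrite mulrA ler_wpM2r ?expR_ge0//.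
have ee : e t * expR (t / 2) = 1 by rewrite /e -expRD mulNr addNr expR0.
have e1 : e t <= 1 by rewrite -expR0 ler_expR mulNr oppr_le0 divr_ge0.
have H1 : t `^ a <= 1 + t ^+ n.+1.
  have [t1|/ltW t1] := leP t 1.
    rewrite (@le_trans _ _ 1)//; last by rewrite lerDl exprn_ge0.
    by have := @ge0_ler_powR R a a0 t 1; rewrite powR1 !nnegrE; apply.
  rewrite (@le_trans _ _ (t ^+ n.+1))//; last by rewrite lerDr.
  by rewrite -powR_mulrn// ler_powR.
have H2 : (t / 2) ^+ n.+1 <= n.+1`!%:R * expR (t / 2).
  have := expR_ge1Dxn n (divr_ge0 t0 (ler0n R 2)).
  set E := expR _ => HE.
  by rewrite [leRHS]mulrC -ler_pdivrMr ?ltr0n ?fact_gt0// (le_trans _ HE)// lerDr.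
have H3 : t ^+ n.+1 <= 2 ^+ n.+1 * (n.+1`!%:R * expR (t / 2)).
  have -> : t ^+ n.+1 = 2 ^+ n.+1 * (t / 2) ^+ n.+1.
    by rewrite -exprMn mulrC divfK.
  by rewrite ler_pM2l// exprn_gt0.
rewrite (@le_trans _ _ ((1 + 2 ^+ n.+1 * (n.+1`!%:R * expR (t / 2))) * e t))//.
  rewrite ler_wpM2r ?expR_ge0// (le_trans H1)// lerD2l//.
rewrite mulrDl mul1r -!mulrA [expR _ * e t]mulrC ee mulr1.
by rewrite lerD2r.
Qed.

Lemma powR_cvg a x : 0 < x -> y `^ a @[y --> x] --> x `^ a.
Proof.
move=> x0; have /derivable1_diffP/differentiable_continuous := @ex_derive _ _ _ _ _ _ _ (is_derive1_powR a x0).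
exact.
Qed.

Lemma powR_cvg_right0 a : 0 <= a -> y `^ a @[y --> 0^'+] --> (0 : R) `^ a.
Proof.
rewrite le_eqVlt => /predU1P[<-|a0]; last by rewrite powR0 ?gt_eqF//; exact: powR_cvg0.
rewrite powRr0; apply: cvg_near_cst; near=> y; exact: powRr0.
Unshelve. all: by end_near. Qed.

Lemma expRN_cvg (c x : R) : expR (- y / c) @[y --> x] --> expR (- x / c).
Proof.
have H : continuous (fun y : R => - y / c).
  by move=> y; apply: cvgM; [exact: opp_continuous|exact: cvg_cst].
by apply: (continuous_comp (H x)); exact: continuous_expR.
Qed.

Lemma is_derive_expRN (c x : R) : c != 0 ->
  is_derive x 1 (fun y => expR (- y / c)) (- expR (- x / c) / c).
Proof.
by move=> c0; apply: is_derive_eq; rewrite /GRing.scale/=; field.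
Qed.

Lemma g_cvg s x : 0 < x -> g s y @[y --> x] --> g s x.
Proof.
move=> x0; apply: cvgM; first exact: powR_cvg.
by have := @expRN_cvg 1 x; rewrite divr1; under eq_fun do rewrite divr1.
Qed.

Lemma g_cvg_right0 s : 1 <= s -> g s y @[y --> 0^'+] --> g s 0.
Proof.
move=> s1; apply: cvgM; first by apply: powR_cvg_right0; rewrite subr_ge0.
apply/cvg_at_right_filter.
by have := @expRN_cvg 1 0; rewrite divr1; under eq_fun do rewrite divr1.
Qed.

Lemma measurable_g s D : measurable D -> measurable_fun D (g s).
Proof.
move=> mD; apply: measurable_funTS; apply: measurable_funM; first exact: measurable_powR.
by apply: measurableT_comp; [exact: measurable_expR|exact: oppr_measurable].
Qed.

Lemma continuous_g s : 1 <= s -> {within `[0, +oo[, continuous (g s)}.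
Proof.
move=> s1; apply/continuous_within_itvcyP; split; last exact: g_cvg_right0.
by move=> x; rewrite in_itv/= andbT => x0; exact: g_cvg.
Qed.

Lemma continuous_e : {within `[0, +oo[, continuous e}.
Proof. by apply: continuous_subspaceT => x; exact: expRN_cvg. Qed.

Lemma e_cvgy : e x @[x --> +oo] --> (0 : R).
Proof.
rewrite (_ : e = (fun z => expR (- z)) \o (fun z => 2^-1 * z)); last first.
  by apply: eq_fun => x; rewrite /e mulNr mulrC.
have H : 2^-1 * z @[z --> (+oo : set_system R)] --> (+oo : set_system R) by exact: gt0_cvgMry.
exact: (cvg_comp _ _ H (@cvgr_expR R)).
Qed.

Lemma integral_e : (\int[leb]_(t in `[0%R, +oo[) (e t)%:E = 2%:E)%E.
Proof.
rewrite (@ge0_continuous_FTC2y _ e (fun t => - 2 * e t) 0 0).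
- by rewrite /e oppr0 mul0r expR0 mulr1 -EFinB; congr EFin; ring.
- by move=> x _; exact: expR_ge0.
- exact: continuous_e.
- by rewrite -[X in _ --> X](mulr0 (-2)); apply: cvgM; [exact: cvg_cst|exact: e_cvgy].
- by move=> x _; apply: derivableM => //; have [] := @is_derive_expRN 2 x.
- by apply/cvg_at_right_filter; apply: cvgM; [exact: cvg_cst|exact: expRN_cvg].
- move=> x _; have D := @is_derive_expRN 2 x (negbT (pnatr_eq0 _ 2)).
  rewrite derive1E; have E := is_deriveM (is_derive_cst (-2 : R) x 1) D.
  rewrite (@derive_val _ _ _ _ _ _ _ E) /GRing.scale/= /e.
  by field.
Qed.

Lemma integrable_e : leb.-integrable `[0, +oo[ (EFin \o e).
Proof.
apply/integrableP; split.
  apply/measurable_EFinP/measurable_funTS; rewrite /e; apply: measurableT_comp; first exact: measurable_expR.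
  by apply: measurable_funM; [exact: oppr_measurable|exact: measurable_cst].
under eq_integral do rewrite /= ger0_norm ?expR_ge0//.
by rewrite integral_e ltry.
Qed.

Lemma g_bound s : 1 <= s -> exists2 K : R, 0 < K & forall t, 0 <= t -> g s t <= K * e t.
Proof. by rewrite -subr_ge0 => /powR_expR_bound. Qed.

Lemma g_ge0 s t : 0 <= g s t.
Proof. by rewrite mulr_ge0// ?powR_ge0 ?expR_ge0. Qed.

Lemma integrable_g s : 1 <= s -> leb.-integrable `[0, +oo[ (EFin \o g s).
Proof.
move=> s1; have [K K0 HK] := g_bound s1.
have J : leb.-integrable `[0, +oo[ (fun x => (K%:E * (e x)%:E)%E).
  by apply: (integrableZl _ K integrable_e).
apply: le_integrable J => //.
  have M := @measurable_g s _ (measurable_itv `[0, +oo[); exact/measurable_EFinP.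
move=> x/=; rewrite in_itv/= andbT => x0; rewrite lee_fin.
by rewrite !ger0_norm ?g_ge0 ?mulr_ge0 ?expR_ge0 ?HK// ltW.
Qed.

Lemma GammaE s : 1 <= s -> Gamma s = \int[leb]_(t in `[0, +oo[) g s t.
Proof. by move=> /integrable_g Ig; apply: Rintegral_itv_obnd_cbnd; apply: integrableS Ig => //; apply: subset_itv; rewrite bnd_simp. Qed.

(* Adding [s K exp (- t / 2)] to the derivative of [- t^s exp (- t)] makes it
   nonnegative, as the half-line fundamental theorem of calculus requires. *)
Lemma Gamma_rec s : 1 <= s -> Gamma (s + 1) = s * Gamma s.
Proof.
move=> s1; have s0 : 0 < s by exact: lt_le_trans s1.
have s11 : 1 <= s + 1 by rewrite lerDr ltW.
have [K K0 HK] := g_bound s1; have [K' K'0 HK'] := g_bound s11.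
have Ig := integrable_g s1; have Ig' := integrable_g s11.
pose f t := g (s + 1) t - s * g s t + s * K * e t.
pose F t := - (t `^ s * expR (- t)) - 2 * s * K * e t.
have IF : \int[leb]_(t in `[0, +oo[) f t = 0 - F 0.
  apply: Rintegral_ge0_continuous_FTC2y.
  - move=> t t0; rewrite /f -addrA addr_ge0 ?g_ge0// addrC -mulrA -mulrBr.
    by rewrite mulr_ge0 ?(ltW s0)// subr_ge0 HK.
  - have c1 := continuous_g s11; have c2 := continuous_g s1; have c3 := continuous_e.
    move=> x; apply: cvgD; [apply: cvgB|]; [exact: c1| |].
    + by apply: cvgM; [exact: cvg_cst|exact: c2].
    + by apply: cvgM; [exact: cvg_cst|exact: c3].
  - have H0 : t `^ s * expR (- t) @[t --> +oo] --> (0 : R).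
      apply: (@squeeze_cvgr _ _ _ _ (fun=> 0) (fun t => K' * e t)).
      + near=> t; have t0 : 0 <= t by near: t; exact: nbhs_pinfty_ge.
        rewrite mulr_ge0 ?powR_ge0 ?expR_ge0//=.
        by have := HK' t t0; rewrite /g addrK.
      + exact: cvg_cst.
      + by rewrite -[X in _ --> X](mulr0 K'); apply: cvgM; [exact: cvg_cst|exact: e_cvgy].
    rewrite -[X in _ --> X](subr0 0) -{1}oppr0 -[X in _ --> _ - X](mulr0 (2 * s * K)).
    by apply: cvgB; [exact: cvgN|apply: cvgM; [exact: cvg_cst|exact: e_cvgy]].
  - move=> x x0; apply: derivableB.
      apply: derivableN; apply: derivableM.
        by have [] := is_derive1_powR s x0.
      by have := @is_derive_expRN 1 x (oner_neq0 _); under eq_fun do rewrite divr1; case.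
    by apply: derivableM => //; have [] := @is_derive_expRN 2 x (negbT (pnatr_eq0 _ 2)).
  - apply: cvgB.
      apply: cvgN; apply: cvgM; first by apply: powR_cvg_right0; exact: ltW.
      apply/cvg_at_right_filter.
      by have := @expRN_cvg 1 0; rewrite divr1; under eq_fun do rewrite divr1.
    by apply/cvg_at_right_filter; apply: cvgM; [exact: cvg_cst|exact: expRN_cvg].
  - move=> x; rewrite in_itv/= andbT => x0; rewrite derive1E.
    have D1 := is_derive1_powR s x0.
    have D2 : is_derive x 1 (fun y : R => expR (- y)) (- expR (- x)).
      by have := @is_derive_expRN 1 x (oner_neq0 _); rewrite !divr1; under eq_fun do rewrite divr1.
    have D3 := @is_derive_expRN 2 x (negbT (pnatr_eq0 _ 2)).
    have D := is_deriveB (is_deriveN (is_deriveM D1 D2)) (is_deriveM (is_derive_cst (2 * s * K) x 1) D3).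
    rewrite (@derive_val _ _ _ _ _ _ _ D) /GRing.scale/= /f /g /e addrK.
    by field.
have IE : \int[leb]_(t in `[0, +oo[) e t = 2 by rewrite /Rintegral integral_e.
move: IF; rewrite /F /f powR0 ?gt_eqF// mul0r oppr0 /e oppr0 mul0r expR0.
have Is : leb.-integrable `[0, +oo[ (fun x => (s * g s x)%:E) by apply: (integrableZl _ s Ig).
have Ie : leb.-integrable `[0, +oo[ (fun x => (s * K * e x)%:E) by apply: (integrableZl _ (s * K) integrable_e).
rewrite RintegralD//; last exact: integrableB Ig' Is.
rewrite RintegralB// !RintegralZl//; last exact: integrable_e.
rewrite IE -!GammaE// => H.
lra.
Unshelve. all: by end_near. Qed.

(** On [[1, 2]] the integrand is at least [exp (-2)]. *)
Lemma Gamma_gt0 s : 1 <= s -> 0 < Gamma s.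
Proof.
move=> s1; rewrite GammaE//.
have mg (D : set R) (mD : measurable D) : measurable_fun D (EFin \o g s).
  by apply/measurable_EFinP; exact: measurable_g.
have S12 : (`[1, 2]%classic : set R) `<=` `[0, +oo[%classic.
  by move=> x/=; rewrite !in_itv/= andbT => /andP[/(le_trans ler01)].
have /integrableP[_ If] := integrable_g s1.
have If' : (\int[leb]_(t in `[0%R, +oo[) (g s t)%:E < +oo)%E.
  apply: le_lt_trans If; apply: ge0_le_integral => //.
  - by move=> t _; rewrite lee_fin g_ge0.
  - exact: mg.
  - by apply: measurableT_comp => //; exact: mg.
  - by move=> t _; rewrite /= lee_fin ler_norm.
have H : ((expR (-2))%:E <= \int[leb]_(t in `[0%R, +oo[) (g s t)%:E)%E.
  apply: (@le_trans _ _ (\int[leb]_(t in `[1%R, 2%R]) (g s t)%:E)%E); last first.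
    by apply: ge0_subset_integral => //; [exact: mg|move=> t _; rewrite lee_fin g_ge0].
  apply: (@le_trans _ _ (\int[leb]_(t in `[1%R, 2%R]) (cst (expR (-2)) t)%:E)%E).
    have -> : (\int[leb]_(t in `[1%R, 2%R]) (cst (expR (-2)) t)%:E)%E = (expR (-2) * (2 - 1))%:E.
      by rewrite (_ : (fun t => _) = cst (expR (-2))%:E)// integral_cst//= lebesgue_measure_itv/= lte_fin ltr1n -EFinB -EFinM.
    by rewrite lee_fin; lra.
  apply: ge0_le_integral => //.
  - by move=> t _; rewrite lee_fin expR_ge0.
  - exact/measurable_EFinP/measurable_cst.
  - exact: mg.
  move=> t/=; rewrite in_itv/= => /andP[t1 t2]; rewrite lee_fin /g.
  rewrite -[leLHS]mul1r ler_pM ?expR_ge0// ?ler_expR ?lerN2//.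
  by have := @ge0_ler_powR R (s - 1) _ 1 t; rewrite powR1 !nnegrE subr_ge0; apply => //; exact: le_trans t1.
rewrite /Rintegral fine_gt0// If' andbT (lt_le_trans _ H)// lte_fin expR_gt0//.
Qed.

End GammaFunction.

(** * Power series with factorially decreasing coefficients *)

Section EntireSeries.
Variable R : realType.
Implicit Types (c : nat -> R) (x K : R).

(** A condition stable under termwise differentiation that forces convergence everywhere. *)
Definition fact_bounded c := forall m, `|c m| <= (m`!%:R)^-1.

Lemma fact_bounded_diffs c : fact_bounded c -> fact_bounded (pseries_diffs c).
Proof.
move=> Hc m; rewrite /pseries_diffs normrM ger0_norm//.
by have := Hc m.+1; rewrite factS natrM invfM ler_pdivlMl ?ltr0n.
Qed.

Lemma fact_bounded_cvg c x : fact_bounded c -> cvgn (pseries c x).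
Proof.
move=> Hc; apply: normed_cvg; apply: (series_le_cvg _ _ _ (is_cvg_series_exp_coeff `|x|)).
- by move=> n; exact: normr_ge0.
- by move=> n; rewrite /exp_coeff /= mulr_ge0 ?invr_ge0.
- move=> n /=; rewrite normrM normrX /exp_coeff/= mulrC ler_wpM2l ?exprn_ge0// Hc.
Qed.

Lemma fact_bounded_derive c x : fact_bounded c ->
  is_derive x 1 (fun x => limn (pseries c x)) (limn (pseries (pseries_diffs c) x)).
Proof.
move=> Hc; have H1 := fact_bounded_diffs Hc; have H2 := fact_bounded_diffs H1.
apply: (@pseries_snd_diffs _ c (`|x| + 1)); try exact: fact_bounded_cvg.
by rewrite [ltRHS]ger0_norm ?addr_ge0// ltrDl.
Qed.

End EntireSeries.

(** * The entire factor of the Bessel function and its differential equation *)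

Section BesselEntire.
Variable R : realType.
Variable nu : R.
Hypothesis nu0 : 0 <= nu.
Implicit Types x y : R.

Let al := 2 * nu + 1.

(** The closed form is [(-1)^m Gamma(nu+1) / (4^m m! Gamma(m+nu+1))]: these are the coefficients, in
    the variable [x^2], of [x^-nu J_nu x] normalized to be 1 at 0. *)
Fixpoint bcoef m : R :=
  if m is n.+1 then - bcoef n / (4 * n.+1%:R * (nu + n.+1%:R)) else 1.

Lemma nu_nat_gt0 n : 0 < nu + n.+1%:R.
Proof. by rewrite ltr_wpDl// ltr0n. Qed.

Lemma bcoef_bounded : fact_bounded bcoef.
Proof.
elim=> [|m IH] /=; first by rewrite normr1 invr1.
have n0 := nu_nat_gt0 m.
rewrite normrM normrN normfV factS natrM invfM mulrC ler_pM// ?invr_ge0//.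
rewrite ger0_norm ?mulr_ge0 ?(ltW n0)// lef_pV2 ?posrE ?ltr0n ?mulr_gt0 ?ltr0n//.
have m0 : 0 < m.+1%:R :> R by rewrite ltr0n.
have m1 : 1 <= m.+1%:R :> R by rewrite ler1n.
have key (N : R) : 1 <= N -> N <= 4 * N * (nu + N).
  move=> N1; have H1 : 0 <= N * (N - 1) by rewrite mulr_ge0//; lra.
  have H2 : 0 <= N * nu by rewrite mulr_ge0//; lra.
  nra.
exact: key.
Qed.

Let P y := limn (pseries bcoef y).
Let P1 y := limn (pseries (pseries_diffs bcoef) y).
Let P2 y := limn (pseries (pseries_diffs (pseries_diffs bcoef)) y).

(** The shift between the lengths [n] and [n.+1] compensates the factor [y], so the equation holds
    on partial sums without remainder. *)
Lemma bessel_ode_series y n :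
  4 * y * pseries (pseries_diffs (pseries_diffs bcoef)) y n
  + 4 * (nu + 1) * pseries (pseries_diffs bcoef) y n.+1 + pseries bcoef y n.+1 = 0.
Proof.
elim: n => [|n IH].
  rewrite /pseries /series/= !big_nat1 big_geq// /pseries_diffs/= !expr0.
  by field; rewrite gt_eqF// ltr_wpDl.
rewrite /pseries /series/= in IH *.
rewrite big_nat_recr//= [X in _ + 4 * (nu + 1) * X + _]big_nat_recr//= [X in _ + X]big_nat_recr//=.
have -> (a b c d e f g : R) : 4 * y * (a + b) + g * (c + d) + (e + f) =
   (4 * y * a + g * c + e) + (4 * y * b + g * d + f) by ring.
rewrite IH add0r /pseries_diffs /= !exprS.
have n0 := nu_nat_gt0 n; have n1 := nu_nat_gt0 n.+1.
have -> : n.+2%:R = n.+1%:R + 1 :> R by rewrite -natr1.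
rewrite -natr1 in n1; set N := n.+1%:R in n0 n1 *.
have N0 : 0 < N by rewrite ltr0n.
by field; rewrite !gt_eqF// ltr_wpDl.
Qed.

Lemma bessel_ode_P y : 4 * y * P2 y + 4 * (nu + 1) * P1 y + P y = 0.
Proof.
have H0 := bcoef_bounded; have H1 := fact_bounded_diffs H0; have H2 := fact_bounded_diffs H1.
have C c : fact_bounded c -> pseries c y n @[n --> \oo] --> limn (pseries c y).
  by move=> /fact_bounded_cvg.
have C' c : fact_bounded c -> pseries c y n.+1 @[n --> \oo] --> limn (pseries c y).
  by move=> Hc; have := C _ Hc; rewrite -(cvg_shiftS (pseries c y)).
have H : (fun n => 4 * y * pseries (pseries_diffs (pseries_diffs bcoef)) y n
    + 4 * (nu + 1) * pseries (pseries_diffs bcoef) y n.+1 + pseries bcoef y n.+1) n @[n --> \oo] -->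
    4 * y * P2 y + 4 * (nu + 1) * P1 y + P y.
  apply: cvgD; last exact: C'.
  by apply: cvgD; apply: cvgM; [exact: cvg_cst|exact: C|exact: cvg_cst|exact: C'].
rewrite -(cvg_lim (@Rhausdorff R) H) (_ : (fun n => _) = cst 0); last first.
  by apply/funext => n; exact: bessel_ode_series.
exact: lim_cst.
Qed.

(* [bG x] is [x^-nu J_nu x] normalized by [bG 0 = 1], and [bQ x] is [bG' x / x],
   which is not singular at 0. *)
Definition bG x := P (x ^+ 2).
Definition bQ x := 2 * P1 (x ^+ 2).
Definition bdG x := x * bQ x.

Lemma is_derive_sqr x : is_derive x 1 (fun x => x ^+ 2) (2 * x).
Proof. by apply: is_derive_eq; rewrite /GRing.scale/= ; ring. Qed.

Lemma is_derive_bG x : is_derive x 1 bG (bdG x).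
Proof.
have D := @is_derive1_comp _ P (fun x => x ^+ 2) x _ _ (fact_bounded_derive _ bcoef_bounded) (is_derive_sqr x).
by apply: (is_derive_eq D); rewrite /bdG /bQ /GRing.scale/= -/(P1 _); ring.
Qed.

(** This is [G'' + (al/x) G' + G = 0], with [G'/x] replaced by [bQ] so as to hold at 0 too. *)
Lemma is_derive_bdG x : is_derive x 1 bdG (- bG x - al * bQ x).
Proof.
have D := @is_derive1_comp _ P1 (fun x => x ^+ 2) x _ _
  (fact_bounded_derive _ (fact_bounded_diffs bcoef_bounded)) (is_derive_sqr x).
have D2 := is_deriveM (is_derive_id x 1) (is_deriveM (is_derive_cst (2 : R) x 1) D).
apply: (is_derive_eq D2); rewrite /bG /bQ /GRing.scale/= -/(P2 _) -/(P1 _).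
rewrite (_ : (cst 2 * _) x = 2 * P1 (x ^+ 2))//.
have E := bessel_ode_P (x ^+ 2); rewrite /al /= /cst.
apply/eqP; rewrite -subr_eq0 -[X in _ == X]E; apply/eqP; ring.
Qed.

Lemma bG0 : bG 0 = 1.
Proof.
rewrite /bG /P expr0n/=.
have -> : pseries bcoef 0 = fun n => (n != 0%N)%:R.
  apply/funext => -[|n]; first by rewrite /pseries /series/= big_geq.
  rewrite /pseries /series/= big_nat_recl//= expr0 mulr1 big1 ?addr0// => i _.
  by rewrite expr0n/= mulr0.
apply/cvg_lim => //; rewrite -(cvg_shiftS (fun n => (n != 0%N)%:R : R))/=.
exact: cvg_cst.
Qed.

Lemma besselJ_bG x : 0 < x -> besselJ nu x = (x / 2) `^ nu / Gamma (nu + 1) * bG x.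
Proof.
move=> x0.
have G0 m : 0 < Gamma (m%:R + nu + 1) by apply: Gamma_gt0; rewrite lerDr addr_ge0.
have G1 : 0 < Gamma (nu + 1) by have := G0 0%N; rewrite add0r.
rewrite /besselJ /bG /P.
have -> : (fun m : nat => (-1) ^+ m / (m`!%:R * Gamma (m%:R + nu + 1)) * (x / 2) `^ (2 * m%:R + nu))
   = (fun m => (x / 2) `^ nu / Gamma (nu + 1) * (bcoef m * (x ^+ 2) ^+ m)).
  apply/funext => m.
  have -> : (x / 2) `^ (2 * m%:R + nu) = (x / 2) `^ nu * (x ^+ 2 / 4) ^+ m.
    have x2 : 0 < x / 2 by rewrite divr_gt0.
    rewrite powRD ?(gt_eqF x2) ?implybT// mulrC; congr (_ * _).
    rewrite -natrM powR_mulrn ?ltW// exprM; congr (_ ^+ _); rewrite expr2; by field.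
  suff -> : (-1) ^+ m / (m`!%:R * Gamma (m%:R + nu + 1)) = bcoef m * 4 ^+ m / Gamma (nu + 1).
    rewrite expr_div_n; field; rewrite expf_neq0//= gt_eqF//.
  elim: m => [|m IH]; first by rewrite /= fact0 add0r !expr0 !mul1r.
  have mn : 1 <= m%:R + nu + 1 by rewrite lerDr addr_ge0.
  have -> : m.+1%:R + nu + 1 = m%:R + nu + 1 + 1 :> R by rewrite -natr1; ring.
  rewrite (Gamma_rec mn) factS natrM /= !exprS.
  have -> : - bcoef m / (4 * m.+1%:R * (nu + m.+1%:R)) * (4 * 4 ^+ m) / Gamma (nu + 1) =
     - (bcoef m * 4 ^+ m / Gamma (nu + 1)) / (m.+1%:R * (nu + m.+1%:R)).
    have h0 := nu_nat_gt0 m; have m0 : 0 < m.+1%:R :> R by rewrite ltr0n.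
    by move: h0 m0; move: m.+1%:R => N h0 m0; field; rewrite !gt_eqF.
  rewrite -IH -natr1.
  have f0 : 0 < m`!%:R :> R by rewrite ltr0n fact_gt0.
  have g0 := G0 m; have h0 := nu_nat_gt0 m; have m0 : 0 < m%:R + 1 :> R by rewrite natr1 ltr0n.
  by rewrite -natr1 in h0; field; rewrite !gt_eqF.
rewrite (_ : series (fun m => _) = (fun n => (x / 2) `^ nu / Gamma (nu + 1) * pseries bcoef (x ^+ 2) n)); last first.
  by apply/funext => n; rewrite /pseries /series/= mulr_sumr.
have H := @fact_bounded_cvg _ _ (x ^+ 2) bcoef_bounded.
by apply/cvg_lim => //; apply: cvgM; [exact: cvg_cst|exact: H].
Qed.

End BesselEntire.

(** * Signs and monotonicity of real functions *)

Section RealCalculus.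
Variable R : realType.
Implicit Types (f df : R -> R) (a b x : R).

Lemma derive_segment_cont f df a b : {in `[a, b], forall x, is_derive x 1 f (df x)} ->
  {within `[a, b], continuous f}.
Proof. by move=> D; apply: derivable_within_continuous => x /D[]. Qed.

Lemma derive_ge0_le f df a b : a <= b -> {in `[a, b], forall x, is_derive x 1 f (df x)} ->
  (forall x, a < x -> x < b -> 0 <= df x) -> f a <= f b.
Proof.
rewrite le_eqVlt => /predU1P[->//|ab] D d0.
have [c] := MVT ab (fun x xx => D x (subset_itv_oo_cc xx)) (derive_segment_cont D).
rewrite in_itv/= => /andP[ac cb] E; rewrite -subr_ge0 E mulr_ge0 ?d0//.
by rewrite subr_ge0 ltW.
Qed.

Lemma derive_gt0_lt f df a b : a < b -> {in `[a, b], forall x, is_derive x 1 f (df x)} ->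
  (forall x, a < x -> x < b -> 0 < df x) -> f a < f b.
Proof.
move=> ab D d0.
have [c] := MVT ab (fun x xx => D x (subset_itv_oo_cc xx)) (derive_segment_cont D).
rewrite in_itv/= => /andP[ac cb] E; rewrite -subr_gt0 E mulr_gt0 ?d0//.
by rewrite subr_gt0.
Qed.

Lemma no_zero_gt0 f a b : a <= b -> {within `[a, b], continuous f} ->
  (forall x, a <= x -> x <= b -> f x != 0) -> (0 < f a) = (0 < f b).
Proof.
move=> ab cf f0; have fa := f0 a (lexx _) ab; have fb := f0 b ab (lexx _).
have H : ~ (Num.min (f a) (f b) <= 0 <= Num.max (f a) (f b)).
  move=> H; have [c] := IVT ab cf H; rewrite in_itv/= => /andP[ac cb] /eqP.
  by rewrite (negbTE (f0 c ac cb)).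
apply/idP/idP => h; rewrite ltNge; apply/negP => h'; apply: H.
  by rewrite ge_min le_max h' orbT (ltW h).
by rewrite ge_min le_max h' (ltW h) orbT.
Qed.

Lemma cont_gt0_ball f x : {for x, continuous f} -> 0 < f x ->
  exists2 e : R, 0 < e & forall y, `|y - x| < e -> 0 < f y.
Proof.
move=> cf fx; have : \forall y \near x, 0 < f y by exact: cvgr_gt cf _ fx.
move=> /nbhs_ballP[e e0 He]; exists e => // y yx.
by apply: He; rewrite -ball_normE/= distrC.
Qed.

Lemma cont_neq0_ball f x : {for x, continuous f} -> f x != 0 ->
  exists2 e : R, 0 < e & forall y, `|y - x| < e -> f y != 0.
Proof.
move=> cf fx.
have [e e0 He] := @cont_gt0_ball (fun y => `|f y|) x (cvg_norm cf) (eq_ind_r is_true fx (normr_gt0 _)).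
by exists e => // y /He; rewrite normr_gt0.
Qed.

Lemma is_derive_expn x n : is_derive x 1 (fun y : R => y ^+ n.+1) (n.+1%:R * x ^+ n).
Proof.
elim: n => [|n IH]; first by apply: is_derive_eq; rewrite expr0 mulr1.
have -> : (fun y : R => y ^+ n.+2) = (fun y => y * y ^+ n.+1) by apply/funext => y; rewrite exprS.
apply: (is_derive_eq (is_deriveM (is_derive_id x 1) IH)).
by rewrite /GRing.scale/= -[n.+2%:R]natr1 exprS; ring.
Qed.

End RealCalculus.

(** * Positive zeros of the Bessel function *)

Section BesselWave.
Variables (R : realType) (nu : R).
Hypothesis nu0 : 0 <= nu.
Implicit Types x y z X : R.

Local Notation G := (bG nu).
Local Notation Q := (bQ nu).
Local Notation dG := (bdG nu).
Let al := 2 * nu + 1.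
Let mu := al / 2.

Lemma bG_cont x : {for x, continuous G}.
Proof.
have [D _] := is_derive_bG nu0 x.
by apply: differentiable_continuous; apply/derivable1_diffP.
Qed.

Lemma bdG_cont x : {for x, continuous dG}.
Proof.
have [D _] := is_derive_bdG nu0 x.
by apply: differentiable_continuous; apply/derivable1_diffP.
Qed.

(** The term [(al/x) G'] acts as friction, so the energy [G^2 + G'^2] decreases from its value 1 at
    0. *)
Lemma bG_energy x : 0 <= x -> G x ^+ 2 + dG x ^+ 2 <= 1.
Proof.
move=> x0; pose f y := - (G y * G y + dG y * dG y).
have D y : is_derive y 1 f (2 * al * y * Q y ^+ 2).
  have H := is_deriveN (is_deriveD (is_deriveM (is_derive_bG nu0 y) (is_derive_bG nu0 y))
     (is_deriveM (is_derive_bdG nu0 y) (is_derive_bdG nu0 y))).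
  by apply: (is_derive_eq H); rewrite /GRing.scale/= /bdG /al; ring.
have al0 : 0 <= al by rewrite addr_ge0// mulr_ge0.
have := derive_ge0_le x0 (fun y _ => D y).
have -> : f 0 = -1 by rewrite /f bG0 /bdG !mul0r; ring.
rewrite lerNl opprK /f !expr2; apply=> y y0 _.
by rewrite mulr_ge0 ?exprn_even_ge0// mulr_ge0 ?(ltW y0)// mulr_ge0.
Qed.

(** The energy bound gives [|G'| <= 1]. The consequence, that zeros are at least 1, is what later
    keeps the sine pieces far enough from 0 and 1. *)
Lemma bG_ge x : 0 <= x -> 1 - x <= G x.
Proof.
move=> x0; pose f y := G y + y.
have D y : is_derive y 1 f (dG y + 1) by apply: is_deriveD; exact: is_derive_bG.
have := derive_ge0_le x0 (fun y _ => D y).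
rewrite /f bG0 addr0 lerBlDr; apply=> y y0 _.
have := bG_energy (ltW y0); have := sqr_ge0 (G y); nra.
Qed.

Lemma bG_zero_ge1 z : 0 <= z -> G z = 0 -> 1 <= z.
Proof. by move=> z0 Gz; have := bG_ge z0; rewrite Gz subr_le0. Qed.

(* [x^(n+1) (G^2 + G'^2)] is nondecreasing as soon as [n + 1 >= 2 al]. *)
Lemma bG_simple x : 0 < x -> G x = 0 -> dG x != 0.
Proof.
move=> x0 Gx; apply/eqP => dGx; have x1 := bG_zero_ge1 (ltW x0) Gx.
pose n := Num.truncn (2 * al); have Hn : 2 * al <= n.+1%:R by exact/ltW/truncnS_gt.
pose f y := y ^+ n.+1 * (G y * G y + dG y * dG y).
pose df y := y ^+ n * (n.+1%:R * G y ^+ 2 + (n.+1%:R - 2 * al) * (y * Q y) ^+ 2).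
have D y : is_derive y 1 f (df y).
  have H := is_deriveM (is_derive_expn y n) (is_deriveD (is_deriveM (is_derive_bG nu0 y) (is_derive_bG nu0 y))
     (is_deriveM (is_derive_bdG nu0 y) (is_derive_bdG nu0 y))).
  by apply: (is_derive_eq H); rewrite /df /GRing.scale/= fctE /= !fctE /bdG /al exprS /=; ring.
have h : 2^-1 <= x by lra.
have := derive_ge0_le h (fun y _ => D y).
have -> : f x = 0 by rewrite /f Gx dGx; ring.
have hf : 0 < f 2^-1.
  have := @bG_ge 2^-1; rewrite invr_ge0 => /(_ (ler0n _ 2)) H.
  by rewrite mulr_gt0 ?exprn_gt0 ?invr_gt0// ltr_wpDr ?mulr_gt0 -?expr2 ?sqr_ge0//; lra.
rewrite leNgt hf => H; suff: false by []; apply: H => y y0 _.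
have y0' : 0 <= y by lra.
by rewrite mulr_ge0 ?exprn_ge0// addr_ge0// mulr_ge0 ?sqr_ge0 ?ler0n// subr_ge0.
Qed.

(** Since [mu = nu + 1/2], this is [sqrt x * J_nu x] up to a constant factor; its equation has no
    first-order term. *)
Definition wB x := x `^ mu * G x.
Definition dwB x := x `^ mu * (mu / x * G x + dG x).

Lemma is_derive_wB x : 0 < x -> is_derive x 1 wB (dwB x).
Proof.
move=> x0; have D := is_deriveM (is_derive1_powR mu x0) (is_derive_bG nu0 x).
apply: (is_derive_eq D); rewrite /dwB /GRing.scale/=.
rewrite powRB ?(gt_eqF x0) ?implybT// powRr1 ?ltW//.
by field; rewrite gt_eqF.
Qed.

Lemma is_derive_dwB x : 0 < x -> is_derive x 1 dwB ((mu * (mu - 1) / x ^+ 2 - 1) * wB x).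
Proof.
move=> x0; have xn : x != 0 by rewrite gt_eqF.
have DV : is_derive x 1 (fun y : R => mu / y) (- mu / x ^+ 2).
  have := is_deriveM (is_derive_cst mu x 1) (is_deriveV xn (is_derive_id x 1)).
  by move=> H; apply: (is_derive_eq H); rewrite /GRing.scale/= exprnP; field.
have D := is_deriveM (is_derive1_powR mu x0)
   (is_deriveD (is_deriveM DV (is_derive_bG nu0 x)) (is_derive_bdG nu0 x)).
apply: (is_derive_eq D); rewrite /wB /dwB /GRing.scale/= fctE/= fctE.
rewrite powRB ?(gt_eqF x0) ?implybT// powRr1 ?ltW//.
rewrite (_ : 2 * nu + 1 = 2 * mu); last by rewrite /mu /al; field.
by rewrite /bdG; field.
Qed.

Lemma mu_gt0 : 0 < mu.
Proof. by rewrite divr_gt0// ltr_wpDl// mulr_ge0. Qed.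

(* Sturm comparison of [wB] with [sin ((x - X1) / 2)]. *)
Lemma bG_zero_beyond X : 0 <= X -> exists2 x, X < x & G x = 0.
Proof.
move=> X0; apply: contrapT => H.
have nz x : X < x -> G x != 0 by move=> Xx; apply/eqP => Gx; apply: H; exists x.
(* Beyond [2 mu] the coefficient [1 - mu (mu - 1) / y^2] is at least [3/4], above the squared
   frequency [1/4] of the comparison sine, whose next zero after [X1] is [X2]. *)
have mu0 := mu_gt0; pose X1 := X + 2 * mu; pose X2 := X1 + 2 * pi.
have X10 : X < X1 by rewrite /X1; lra.
have p0 := @pi_gt0 R.
have X12 : X1 < X2 by rewrite /X2; lra.
pose sg : R := if 0 < G X1 then 1 else -1.
have sgG x : X1 <= x -> 0 < sg * G x.
  move=> X1x; have := @no_zero_gt0 _ G X1 x X1x (derive_segment_cont (fun x _ => is_derive_bG nu0 x)).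
  have nz' y : X1 <= y -> y <= x -> G y != 0 by move=> X1y _; apply: nz; exact: lt_le_trans X1y.
  move=> /(_ nz') E; rewrite /sg E; case: (ltP 0 (G x)) => h; rewrite ?mul1r//.
  by rewrite mulN1r oppr_gt0 lt_neqAle h andbT nz'.
pose v y : R := sin ((y - X1) / 2); pose dv y : R := cos ((y - X1) / 2) / 2.
have Dv y : is_derive y 1 v (dv y).
  by apply: is_derive_eq; rewrite /dv /GRing.scale/=; field.
have Ddv y : is_derive y 1 dv (- v y / 4).
  by apply: is_derive_eq; rewrite /v /GRing.scale/=; field.
(* The Wronskian is nondecreasing on [[X1, X2]], yet positive at [X1] and negative at [X2]. *)
pose W y := sg * (wB y * dv y - dwB y * v y).
have DW : {in `[X1, X2], forall y, is_derive y 1 W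
    (sg * (wB y * v y * (3 / 4 - mu * (mu - 1) / y ^+ 2)))}.
  move=> y; rewrite in_itv/= => /andP[X1y _]; have y0 : 0 < y by lra.
  have D := is_deriveM (is_derive_cst sg y 1) (is_deriveB (is_deriveM (is_derive_wB y0) (Ddv y))
    (is_deriveM (is_derive_dwB y0) (Dv y))).
  by apply: (is_derive_eq D); rewrite /GRing.scale/=; field; rewrite gt_eqF.
have W1 : W X1 = sg * wB X1 / 2.
  by rewrite /W /v /dv subrr mul0r sin0 cos0; ring.
have W2 : W X2 = - (sg * wB X2 / 2).
  rewrite /W /v /dv (_ : (X2 - X1) / 2 = pi) ?sinpi ?cospi; first by ring.
  by rewrite /X2; field.
have sgw y : X1 <= y -> 0 < sg * wB y.
  move=> X1y; rewrite /wB mulrCA mulr_gt0 ?sgG// powR_gt0//; lra.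
have := derive_ge0_le (ltW X12) DW; rewrite W1 W2.
have h1 := sgw X1 (lexx _); have h2 := sgw X2 (ltW X12).
rewrite leNgt (_ : - _ < _) => [H'|]; last by lra.
suff: false by []; apply: H' => y y1 y2.
rewrite !mulrA mulr_ge0//.
  rewrite mulr_ge0//; first by have := sgw y (ltW y1); rewrite /wB mulrA => /ltW.
  by rewrite /v sin_ge0_pi//; apply/andP; split; rewrite /X2 in y2 *; lra.
have y0 : 0 < y by lra.
rewrite subr_ge0 ler_pdivrMr ?exprn_gt0//.
have : 2 * mu <= y by rewrite /X1 in y1; lra.
by rewrite expr2; nra.
Qed.

Definition next_zero z := xget 0 [set y | [/\ z < y, G y = 0 & forall x, z < x -> x < y -> G x != 0]].

(** Zeros close to a zero [z] would, by the mean value theorem, produce zeros of [G'] close to [z],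
    where [bG_simple] makes [G'] nonzero. Near 0 the bound [bG_zero_ge1] suffices. *)
Lemma bG_isolated z : z = 0 \/ 0 < z -> exists2 e : R, 0 < e & forall x, z < x -> x < z + e -> G x != 0.
Proof.
move=> [->|z0].
  exists 1 => // x x0; rewrite add0r => x1; apply/eqP => /(bG_zero_ge1 (ltW x0)); lra.
have [Gz|Gz] := eqVneq (G z) 0; last first.
  have [e e0 He] := cont_neq0_ball (@bG_cont z) Gz; exists e => // x zx xz; apply: He; rewrite gtr0_norm ?subr_gt0//; lra.
have [e e0 He] := cont_neq0_ball (@bdG_cont z) (bG_simple z0 Gz).
exists e => // x zx xz; apply/eqP => Gx.
have [c] := MVT zx (fun x _ => is_derive_bG nu0 x) (derive_segment_cont (fun x _ => is_derive_bG nu0 x)).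
rewrite in_itv/= => /andP[zc cx] /eqP; rewrite Gx Gz subrr eq_sym mulf_eq0 subr_eq0 (gt_eqF zx) orbF.
by apply/negP; apply: He; rewrite ltr_norml; apply/andP; split; lra.
Qed.

(** The infimum of the zeros beyond [z] exceeds [z] by isolation and is itself a zero by
    continuity. *)
Lemma next_zeroP z : z = 0 \/ 0 < z -> [/\ z < next_zero z, G (next_zero z) = 0 &
  forall x, z < x -> x < next_zero z -> G x != 0].
Proof.
move=> z0; have z0' : 0 <= z by case: z0 => [->//|/ltW].
suff : [set y | [/\ z < y, G y = 0 & forall x, z < x -> x < y -> G x != 0]] (next_zero z) by [].
apply: (@xgetPex _ _ _); pose S := [set y | z < y /\ G y = 0].
have S0 : S !=set0 by have [y zy Gy] := bG_zero_beyond z0'; exists y.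
have lS : has_lbound S by exists z => y [/ltW].
have hS : has_inf S by split.
have [e e0 He] := bG_isolated z0.
have ze : z + e <= inf S.
  apply: lb_le_inf => // y [zy Gy]; rewrite leNgt; apply/negP => /(He y zy); by rewrite Gy eqxx.
have Hi y : z < y -> y < inf S -> G y != 0.
  move=> zy yi; apply/eqP => Gy; have : inf S <= y by apply: ge_inf.
  by rewrite leNgt yi.
exists (inf S); split; [by lra| |exact: Hi].
apply/eqP; apply: contraT => /(cont_neq0_ball (@bG_cont _))[d d0 Hd].
have [y [zy Gy] yi] := inf_adherent d0 hS.
have iy : inf S <= y by apply: ge_inf.
have := Hd y; rewrite Gy eqxx ger0_norm ?subr_ge0// => H; suff: false by []; apply: H; lra.
Qed.

(* [bz n] is the [n]-th positive zero, and [bz 0 = 0]. *)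
Fixpoint bz n := if n is m.+1 then next_zero (bz m) else 0.

Lemma bz_ge0 n : bz n = 0 \/ 0 < bz n.
Proof.
elim: n => [|n IH]; [by left|right].
by have [H _ _] := next_zeroP IH; apply: le_lt_trans H; case: IH => [->//|/ltW].
Qed.

Lemma bz_lt n : bz n < bz n.+1.
Proof. by have [] := next_zeroP (bz_ge0 n). Qed.

Lemma bz_zero n : G (bz n.+1) = 0.
Proof. by have [] := next_zeroP (bz_ge0 n). Qed.

Lemma bz_nonzero n x : bz n < x -> x < bz n.+1 -> G x != 0.
Proof. by have [_ _] := next_zeroP (bz_ge0 n); apply. Qed.

Lemma bz_le m n : (m <= n)%N -> bz m <= bz n.
Proof.
elim: n => [|n IH]; first by rewrite leqn0 => /eqP->.
by rewrite leq_eqVlt => /predU1P[->//|/IH h]; apply: le_trans h (ltW (bz_lt n)).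
Qed.

Lemma bz_gt0 n : 0 < bz n.+1.
Proof. by have [H|//] := bz_ge0 n.+1; have := bz_lt n; have := @bz_le 0 n isT; rewrite H /=; lra. Qed.

Lemma besselJ_eq0 x : 0 < x -> besselJ nu x = 0 <-> G x = 0.
Proof.
move=> x0; rewrite besselJ_bG//; have c0 : (x / 2) `^ nu / Gamma (nu + 1) != 0.
  rewrite gt_eqF// divr_gt0 ?powR_gt0 ?divr_gt0// Gamma_gt0// lerDr//.
split=> [/eqP|->]; last by rewrite mulr0.
by rewrite mulf_eq0 (negbTE c0) => /eqP.
Qed.

Let Z z := [set x | 0 < x <= z /\ besselJ nu x = 0].

Lemma card_bz n : (Z (bz n) #= `I_n)%card.
Proof.
elim: n => [|n IH].
  rewrite II0 card_eq0; apply/eqP/seteqP; split => // x [/andP[x0 x0']] _.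
  by have := lt_le_trans x0 x0'; rewrite ltxx.
apply/eq_cardSP; exists (bz n.+1).
  by split; [rewrite bz_gt0 lexx|apply/besselJ_eq0; [exact: bz_gt0|exact: bz_zero]].
suff -> : Z (bz n.+1) `\ bz n.+1 = Z (bz n) by [].
apply/seteqP; split=> x /=.
  move=> [[/andP[x0 xz] Jx] xn]; split => //; rewrite x0/= leNgt; apply/negP => zx.
  have xz' : x < bz n.+1 by rewrite lt_neqAle xz andbT; exact/eqP.
  by have /eqP := bz_nonzero zx xz'; apply; exact/besselJ_eq0.
move=> [/andP[x0 xz] Jx]; have h := le_lt_trans xz (bz_lt n).
by split; [split => //; rewrite x0 ltW|apply/eqP; rewrite lt_eqF].
Qed.

(** If [z < z'], the zero [z'] adds to the [n] zeros up to [z]. This gives the uniqueness on which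
    the choice in [bessel_zero] relies. *)
Lemma card_zero_uniq z z' n : (Z z #= `I_n)%card -> (Z z' #= `I_n)%card ->
  0 < z' -> besselJ nu z' = 0 -> ~ z < z'.
Proof.
move=> C C' z'0 Jz' zz'.
have C1 : (Z z `|` [set z'] #= `I_n.+1)%card.
  apply/eq_cardSP; exists z'; first by right.
  rewrite (_ : _ `\ _ = Z z)//; apply/seteqP; split=> x /=.
    by move=> [[|->]].
  move=> Zx; split; first by left.
  by move=> xz'; move: Zx; rewrite xz' /Z/= => -[/andP[_]]; rewrite leNgt zz'.
have S : Z z `|` [set z'] `<=` Z z'.
  move=> x [[/andP[x0 xz] Jx]|->]; split => //; last by rewrite z'0 lexx.
  by rewrite x0/= ltW// (le_lt_trans xz).
have := subset_card_le S; rewrite (card_le_eql C1) (card_le_eqr C') card_le_II.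
by rewrite ltnn.
Qed.

Lemma bessel_zeroE n : bessel_zero nu n.+1 = bz n.+1.
Proof.
have Jn : besselJ nu (bz n.+1) = 0 by apply/besselJ_eq0; [exact: bz_gt0|exact: bz_zero].
apply: get_unique; first by split => //; [exact: bz_gt0|exact: card_bz].
move=> y [y0 Jy Cy]; apply/eqP; rewrite eq_le !leNgt.
apply/andP; split; apply/negP.
  exact: card_zero_uniq (card_bz n.+1) Cy y0 Jy.
exact: card_zero_uniq Cy (card_bz n.+1) (bz_gt0 n) Jn.
Qed.

Lemma bz_sign n : exists2 sg : R, sg = 1 \/ sg = -1 & forall x, bz n < x -> x < bz n.+1 -> 0 < sg * G x.
Proof.
pose m := (bz n + bz n.+1) / 2; have nn := bz_lt n.
have sgn x : bz n < x -> x < bz n.+1 -> (0 < G m) = (0 < G x).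
  move=> nx xn; have [mx|xm] := leP m x.
    apply: (no_zero_gt0 mx (derive_segment_cont (fun x _ => is_derive_bG nu0 x))) => y my yx.
    by apply: (@bz_nonzero n); rewrite /m in my; lra.
  apply/esym/(no_zero_gt0 (ltW xm) (derive_segment_cont (fun x _ => is_derive_bG nu0 x))) => y xy ym.
  by apply: (@bz_nonzero n); rewrite /m in ym; lra.
have [Gm|Gm] := ltP 0 (G m).
  by exists 1; [left|move=> x nx xn; rewrite mul1r -(sgn x)].
exists (-1); [by right|move=> x nx xn].
by rewrite mulN1r oppr_gt0 lt_neqAle (bz_nonzero nx xn)/= leNgt -(sgn x nx xn) -leNgt.
Qed.

Lemma bG_gt0 x : 0 <= x -> x < bz 1 -> 0 < G x.
Proof.
move=> x0 x1; rewrite -(no_zero_gt0 x0 (derive_segment_cont (fun x _ => is_derive_bG nu0 x))) ?bG0// => y.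
rewrite le_eqVlt => /predU1P[<-|y0] yx; first by rewrite bG0 oner_neq0.
by apply: (@bz_nonzero 0) => //; exact: le_lt_trans x1.
Qed.

Lemma bz1_ge1 : 1 <= bz 1.
Proof. by apply: bG_zero_ge1; [exact/ltW/bz_gt0|exact: bz_zero]. Qed.

(* Otherwise x^(al/2) G would be convex and positive up to its first zero. *)
Lemma bz1_sqr : mu * (mu - 1) < bz 1 ^+ 2.
Proof.
rewrite ltNge; apply/negP => c1; have mu0 := mu_gt0; have z1 := bz1_ge1.
(* The derivative of [wB] is [y^(mu - 1) f y], and [f] is positive at 0; so [wB] starts out positive
   and increasing. *)
pose f y := mu * G y + y * dG y.
have fc : {for 0, continuous f}.
  by apply: cvgD; apply: cvgM; [exact: cvg_cst|exact: bG_cont|exact: cvg_id|exact: bdG_cont].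
have f0 : 0 < f 0 by rewrite /f bG0 mul0r addr0 mulr1.
have [e e0 He] : exists2 e : R, 0 < e & forall y, 0 < y -> y < e -> 0 < f y.
  have [e e0 He] := cont_gt0_ball fc f0; exists e => // y y0 ye.
  by apply: He; rewrite subr0 gtr0_norm.
pose a := Num.min (e / 2) (2^-1); have a0 : 0 < a by rewrite lt_min !divr_gt0//= invr_gt0.
have ae : a < e by rewrite gt_min; apply/orP; left; lra.
have a1 : a < bz 1 by rewrite gt_min; apply/orP; right; lra.
have wa : 0 < wB a by rewrite mulr_gt0 ?powR_gt0// bG_gt0// ltW.
have dwa : 0 < dwB a.
  rewrite mulr_gt0 ?powR_gt0// (_ : _ + _ = f a / a).
    by rewrite divr_gt0// He.
  by rewrite /f; field; rewrite gt_eqF.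
have w1 : wB (bz 1) = 0 by rewrite /wB bz_zero mulr0.
have dwp x : a <= x -> x <= bz 1 -> dwB a <= dwB x.
  move=> ax x1; apply: (@derive_ge0_le _ dwB (fun x => (mu * (mu - 1) / x ^+ 2 - 1) * wB x)) => //.
    by move=> y; rewrite in_itv/= => /andP[ay _]; apply: is_derive_dwB; exact: lt_le_trans ay.
  move=> y ay yx; have y0 : 0 < y by exact: lt_trans ay.
  rewrite mulr_ge0 ?mulr_ge0 ?powR_ge0//; last by rewrite ltW// bG_gt0 ?(ltW y0)//; exact: lt_le_trans x1.
  rewrite subr_ge0 ler_pdivlMr ?exprn_gt0// mul1r (le_trans _ c1)//.
  by rewrite ler_sqr ?nnegrE ?ltW ?(lt_le_trans yx)// bz_gt0.
have := @derive_ge0_le _ wB dwB a (bz 1) (ltW a1); rewrite w1 leNgt wa => H.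
suff: false by []; apply: H => [x|x ax x1].
  by rewrite in_itv/= => /andP[ax _]; apply: is_derive_wB; exact: lt_le_trans ax.
by rewrite (le_trans (ltW dwa))// dwp// ltW.
Qed.

End BesselWave.

(** * The elementary case nu = 1/2, that is alpha = 2 *)

Section BesselHalf.
Variable R : realType.
Implicit Types x y : R.

Let h : 0 <= 2^-1 :> R. Proof. by rewrite invr_ge0. Qed.

(** Both sides solve [y'' = - y] with the same initial data: the energy [f] of their difference is
    constant and vanishes at 0. *)
Lemma bG_half x : 0 <= x -> x * bG 2^-1 x = sin x.
Proof.
move=> x0; pose G := bG (2^-1 : R); pose dG := bdG (2^-1 : R).
pose f y := (y * G y - sin y) * (y * G y - sin y)
   + (G y + y * dG y - cos y) * (G y + y * dG y - cos y).
have D y : is_derive y 1 f 0.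
  have DG := is_derive_bG h y; have DdG := is_derive_bdG h y.
  have D1 := is_deriveB (is_deriveM (is_derive_id y 1) DG) (is_derive_sin y).
  have D2 := is_deriveB (is_deriveD DG (is_deriveM (is_derive_id y 1) DdG)) (is_derive_cos y).
  apply: (is_derive_eq (is_deriveD (is_deriveM D1 D1) (is_deriveM D2 D2))).
  by rewrite /GRing.scale/= fctE/= !fctE /G /dG /bdG; field.
have H := derive_ge0_le x0 (fun y _ => is_deriveN (D y)).
have : f x <= 0.
  have -> : 0 = f 0 by rewrite /f /G /dG bG0 /bdG !mul0r sin0 cos0; ring.
  by rewrite -lerN2; apply: H => y _ _; rewrite oppr0.
rewrite /f => H0; apply/eqP; rewrite -subr_eq0 -[X in X == 0]/(x * G x - sin x).
set u := x * G x - sin x in H0 *; set v := G x + _ - _ in H0.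
have := sqr_ge0 u; have := sqr_ge0 v; rewrite !expr2 => h1 h2.
rewrite -sqrf_eq0 expr2; apply/eqP; lra.
Qed.

Lemma bz1_half : bz (2^-1 : R) 1 = pi.
Proof.
have p0 := @pi_gt0 R; have z0 := bz_gt0 h 0; have Gz := bz_zero h 0.
have Gpi : bG 2^-1 (pi : R) = 0.
  have /eqP := bG_half (ltW p0); rewrite sinpi mulf_eq0 gt_eqF//= => /eqP//.
apply/eqP; rewrite eq_le !leNgt; apply/andP; split; apply/negP => H.
  by have := @bz_nonzero _ _ h 0 pi p0 H; rewrite Gpi eqxx.
have := bG_half (ltW z0); rewrite Gz mulr0 => /esym/eqP; rewrite gt_eqF// sin_gt0_pi// z0//.
Qed.

End BesselHalf.

(** * Trial functions *)

Section AffineComp.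
Variable R : realType.
Implicit Types (f : R -> R) (b e s x D : R).

Lemma is_derive_comp_affine f s b e x D : is_derive (s * (b + e * x)) 1 f D ->
  is_derive x 1 (fun y => f (s * (b + e * y))) (s * e * D).
Proof.
move=> Df; have Di : is_derive x 1 (fun y => s * (b + e * y)) (s * e).
  by apply: is_derive_eq; rewrite /GRing.scale/=; ring.
by apply: (is_derive_eq (@is_derive1_comp _ f (fun y => s * (b + e * y)) x _ _ Df Di)); rewrite mulrC.
Qed.

Lemma continuous_comp_affine f s b e : continuous f -> continuous (fun x => f (s * (b + e * x))).
Proof.
move=> cf x; apply: (@continuous_comp _ _ _ (fun x => s * (b + e * x)) f); last exact: cf.
apply: cvgM; first exact: cvg_cst.
apply: cvgD; first exact: cvg_cst.
by apply: cvgM; [exact: cvg_cst|exact: cvg_id].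
Qed.

(** The absolute value gives a function continuous on the whole line that agrees with the power
    wherever the base is nonnegative. *)
Lemma continuous_norm_powR (a : R) : 1 <= a -> continuous (fun x : R => `|x| `^ a).
Proof.
move=> a1 x; have [->|x0] := eqVneq x 0.
  rewrite /continuous_at normr0 powR0; last by rewrite gt_eqF// (lt_le_trans ltr01).
  apply: (@squeeze_cvgr _ _ _ _ (fun=> 0) (fun x => `|x|)).
  - near=> y; rewrite powR_ge0/=; have [->|y0] := eqVneq y 0.
      by rewrite normr0 powR0// gt_eqF// (lt_le_trans ltr01).
    apply: ge1r_powR => //; rewrite normr_gt0 y0/=; near: y.
    have : \forall y \near (0 : R), ball (0 : R) 1 y by exact: nbhsx_ballx.
    apply: filterS => y.
    by rewrite -ball_normE/= sub0r normrN => /ltW.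
  - exact: cvg_cst.
  - by rewrite -[X in _ --> X](@normr0 R R); apply: cvg_norm; exact: cvg_id.
apply: (@continuous_comp _ _ _ (fun x : R => `|x|) (fun x => x `^ a)); first exact: norm_continuous.
by apply: powR_cvg; rewrite normr_gt0.
Unshelve. all: by end_near. Qed.

End AffineComp.

(** * Bessel trial functions, first on the extreme pieces *)

Section BoundaryPieces.
Variables (R : realType) (nu : R).
Hypothesis nu0 : 0 <= nu.
Let al := 2 * nu + 1.
Let mu := al / 2.
Implicit Types (p q s b e m x : R) (h : R -> R).
Local Notation G := (bG nu).
Local Notation dG := (bdG nu).
Local Notation bz := (bz nu).

Lemma al_ge1 : 1 <= al.
Proof. by rewrite lerDr mulr_ge0. Qed.

Lemma C1_bG p q s b e : C1 p q (fun x => G (s * (b + e * x))) (fun x => s * e * dG (s * (b + e * x))).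
Proof.
apply: C1_intro => [x _|]; first exact/is_derive_comp_affine/is_derive_bG.
apply: continuous_subspaceT => x; apply: cvgM; first exact: cvg_cst.
by apply: continuous_comp_affine => y; exact: bdG_cont.
Qed.

(* [e] is 1 or -1: with [b + e x] equal to [x] or [1 - x], both ends of [[0, 1]]
   are treated at once. *)
Lemma AC_bessel_flux p q s b e m : p <= q -> e * e = 1 -> 0 < m ->
  {in `[p, q], forall x, 0 <= b + e * x} -> {in `]p, q[, forall x, 0 < b + e * x} ->
  abscont p q (fun x => (m * (b + e * x)) `^ al * (s * e * dG (s * (b + e * x))))
    (fun x => - (s ^+ 2) * ((m * (b + e * x)) `^ al * G (s * (b + e * x)))).
Proof.
move=> pq ee m0 t0 tp; apply: C1_AC => //.
have cP : {within `[p, q], continuous (fun x => (m * (b + e * x)) `^ al)}.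
  apply: (@eq_within_cont _ _ _ (fun x => `|m * (b + e * x)| `^ al)).
    by move=> x xx /=; rewrite ger0_norm// mulr_ge0 ?(ltW m0)// t0.
  apply: continuous_subspaceT => x.
  exact: (@continuous_comp_affine _ (fun x => `|x| `^ al) m b e (continuous_norm_powR al_ge1)).
have cG : {within `[p, q], continuous (fun x => G (s * (b + e * x)))} by have [] := C1_bG p q s b e.
have cdG : {within `[p, q], continuous (fun x => s * e * dG (s * (b + e * x)))} by have [] := C1_bG p q s b e.
split; [|exact: within_contM|by apply: within_contM; [exact: within_cont_cst|exact: within_contM]].
move=> x xx; have tx := tp x xx; have mt : 0 < m * (b + e * x) by rewrite mulr_gt0.
have D1 := is_derive_comp_affine (is_derive1_powR al mt).
have D2 := is_derive_comp_affine (is_derive_bdG nu0 (s * (b + e * x))).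
have D := is_deriveM D1 (is_deriveM (is_derive_cst (s * e) x 1) D2).
apply: (is_derive_eq D); rewrite /GRing.scale/= !fctE/= /bdG -/al.
rewrite powRB ?(gt_eqF mt) ?implybT// powRr1 ?ltW//.
rewrite -[RHS]mul1r -[X in _ = X * _]ee; field.
by rewrite !gt_eqF.
Qed.

(** The flux [y^al G' y] is minus the integral of [x^al G x], and [G] is nonnegative up to its first
    zero. *)
Lemma bdG_le0 y : 0 <= y -> y <= bz 1 -> dG y <= 0.
Proof.
rewrite le_eqVlt => /predU1P[<- _|y0 y1]; first by rewrite /bdG mul0r.
have H := @AC_bessel_flux 0 y 1 0 1 1 (ltW y0) (mulr1 1) ltr01.
have H0 : {in `[0, y], forall x : R, 0 <= 0 + 1 * x}.
  by move=> x; rewrite in_itv/= add0r mul1r => /andP[].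
have H1 : {in `]0, y[, forall x : R, 0 < 0 + 1 * x}.
  by move=> x; rewrite in_itv/= add0r mul1r => /andP[].
have A := H H0 H1; have E := AC_int (ltW y0) A; have [Ii _] := A.
have al0 : al != 0 by rewrite gt_eqF// (lt_le_trans ltr01)// al_ge1.
have : II 0 y (fun x => - 1 ^+ 2 * ((1 * (0 + 1 * x)) `^ al * G (1 * (0 + 1 * x)))) <= 0.
  apply: (@le_trans _ _ (II 0 y (fun=> 0))); last by rewrite IIcst ?(ltW y0)// mul0r.
  apply: le_II => //; first by apply: itg_cont; exact: within_cont_cst.
  move=> x; rewrite in_itv/= => /andP[x0 xy]; rewrite !mul1r !add0r expr1n mulN1r oppr_le0.
  rewrite mulr_ge0 ?powR_ge0//; have := le_trans xy y1; rewrite le_eqVlt => /predU1P[->|xz].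
    by rewrite bz_zero.
  by rewrite ltW// bG_gt0.
rewrite E !mul1r !add0r powR0// mul0r subr0 pmulr_rle0// powR_gt0//.
Qed.

Lemma upper_bessel_left h s : concave_unit h -> 0 < s -> bz 1 / s <= 1 ->
  upper_piece (fun x => h x `^ al) (s ^+ 2) 0 (bz 1 / s).
Proof.
move=> hL s0 q1; set q := bz 1 / s; have q0 : 0 < q by rewrite divr_gt0// bz_gt0.
have sq : s * q = bz 1 by rewrite /q mulrC divfK// gt_eqF.
have sx x : x <= q -> s * x <= bz 1 by rewrite -sq ler_pM2l.
have sx' x : x < q -> s * x < bz 1 by rewrite -sq ltr_pM2l.
have H0 : {in `[0, q], forall x : R, 0 <= 0 + 1 * x}.
  by move=> x; rewrite in_itv/= add0r mul1r => /andP[].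
have H1 : {in `]0, q[, forall x : R, 0 < 0 + 1 * x}.
  by move=> x; rewrite in_itv/= add0r mul1r => /andP[].
have A := @AC_bessel_flux 0 q s 0 1 1 (ltW q0) (mulr1 1) ltr01 H0 H1.
have e01 : (fun x : R => 1 * (0 + 1 * x)) = id by apply/funext => x; ring.
(* The peak is at the end 0: [h x / x] is nonincreasing on the whole piece, so the comparison line
   [x] works for every [h]. *)
apply: (@upper_of_flux _ _ hL al (s ^+ 2) 0 q 0 (fun x => 1 * (0 + 1 * x)) (fun x => G (s * (0 + 1 * x)))
  (fun x => s * 1 * dG (s * (0 + 1 * x))) _) => //; try exact: al_ge1.
- by rewrite lexx ltW.
- by move=> x xx; rewrite mul1r H1.
- by rewrite e01 => x _; exact: cvg_id.
- rewrite (_ : (fun x => _) = (fun x => x `^ al)); last by apply/funext => x; rewrite add0r !mul1r.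
  apply: (@eq_within_cont _ _ _ (fun x => `|x| `^ al)).
    by move=> x; rewrite in_itv/= => /andP[x0 _]; rewrite ger0_norm.
  by apply: continuous_subspaceT; exact: continuous_norm_powR al_ge1.
- exact: C1_bG.
- exact: A.
- by move=> x xx; rewrite !mulNr.
- by move=> x; rewrite in_itv/= => /andP[x0 xq]; rewrite add0r mul1r bG_gt0// ?sx'// mulr_ge0 ?(ltW s0) ?ltW.
- by rewrite mulr0 addr0 mulr0 bG0.
- by rewrite add0r mul1r sq bz_zero.
- by left.
- by right; rewrite add0r mul1r sq bz_zero.
- move=> x; rewrite in_itv/= => /andP[x0 xq] x0'; have -> : x = 0 by apply/eqP; rewrite eq_le x0'.
  by rewrite mulr0 addr0 mulr0 mulr0 /bdG mul0r mulr0 mulr0.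
- move=> x; rewrite in_itv/= => /andP[x0 xq] _; rewrite !add0r !mul1r mulr1.
  by rewrite mulr_ge0_le0 ?powR_ge0// mulr_ge0_le0 ?(ltW s0)// bdG_le0 ?sx// mulr_ge0 ?(ltW s0).
- by move=> x y x0 xy y0; have := lt_le_trans x0 (le_trans xy y0); rewrite ltxx.
- move=> x y _ xy yq x0; rewrite !add0r !mul1r; apply: concave_x => //.
  exact: le_trans (ltW yq) q1.
Qed.

Lemma upper_bessel_right h s : concave_unit h -> 0 < s -> bz 1 / s <= 1 ->
  upper_piece (fun x => h x `^ al) (s ^+ 2) (1 - bz 1 / s) 1.
Proof.
move=> hL s0 q1; set p := 1 - bz 1 / s; have p1 : p < 1 by rewrite /p ltrBlDr ltrDl divr_gt0// bz_gt0.
have p0 : 0 <= p by rewrite /p subr_ge0.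
have sp : s * (1 - p) = bz 1 by rewrite /p opprB addrC subrK mulrC divfK// gt_eqF.
have sx x : p <= x -> s * (1 - x) <= bz 1 by move=> px; rewrite -sp ler_pM2l// lerD2l lerN2.
have sx' x : p < x -> s * (1 - x) < bz 1 by move=> px; rewrite -sp ltr_pM2l// ltrD2l ltrN2.
have tE (x : R) : 1 + -1 * x = 1 - x by rewrite mulN1r.
have H0 : {in `[p, 1], forall x : R, 0 <= 1 + -1 * x}.
  by move=> x; rewrite in_itv/= tE subr_ge0 => /andP[].
have H1 : {in `]p, 1[, forall x : R, 0 < 1 + -1 * x}.
  by move=> x; rewrite in_itv/= tE subr_gt0 => /andP[].
have ee : -1 * -1 = 1 :> R by ring.
have A := @AC_bessel_flux p 1 s 1 (-1) 1 (ltW p1) ee ltr01 H0 H1.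
apply: (@upper_of_flux _ _ hL al (s ^+ 2) p 1 1 (fun x => 1 * (1 + -1 * x)) (fun x => G (s * (1 + -1 * x)))
  (fun x => s * -1 * dG (s * (1 + -1 * x))) _) => //; try exact: al_ge1.
- by rewrite lexx ltW.
- by move=> x xx; rewrite mul1r H1.
- by move=> x _; apply: (@continuous_comp_affine _ id 1 1 (-1)) => y; exact: cvg_id.
- apply: (@eq_within_cont _ _ _ (fun x => `|1 * (1 + -1 * x)| `^ al)).
    by move=> x xx; rewrite ger0_norm// mul1r H0.
  apply: continuous_subspaceT => x.
  exact: (@continuous_comp_affine _ (fun x => `|x| `^ al) 1 1 (-1) (continuous_norm_powR al_ge1)).
- exact: C1_bG.
- exact: A.
- by move=> x xx; rewrite !mulNr.
- move=> x; rewrite in_itv/= => /andP[px x1]; rewrite tE bG_gt0// ?sx'//.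
  by rewrite mulr_ge0 ?(ltW s0)// subr_ge0 ltW.
- by rewrite tE sp bz_zero.
- by rewrite tE subrr mulr0 bG0.
- by right; rewrite tE sp bz_zero.
- by left.
- move=> x; rewrite in_itv/= => /andP[px x1] _; rewrite !tE mulrN1 mulNr mulrN oppr_ge0.
  rewrite mulr_ge0_le0 ?powR_ge0// mulr_ge0_le0 ?(ltW s0)// bdG_le0 ?sx//.
  by rewrite mulr_ge0 ?(ltW s0)// subr_ge0.
- move=> x; rewrite in_itv/= => /andP[px x1] x1'; have -> : x = 1 by apply/eqP; rewrite eq_le x1.
  by rewrite !tE subrr !mulr0 /bdG mul0r !mulr0.
- move=> x y px xy _ y1; rewrite !tE !mul1r; apply: concave_1x => //.
  exact: le_trans p0 (ltW px).
- move=> x y x1 xy y1; have := le_lt_trans x1 (le_lt_trans xy y1); rewrite ltxx//.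
Qed.

(** At the end 0 or 1 the weight vanishes, hence so does the flux, and [picone] asks nothing of [U]
    there; at the inner end [U] vanishes. *)
Lemma lower_bessel h s p q m b e : 0 < s -> p < q -> e * e = 1 -> 0 < m ->
  {in `[p, q], forall x, 0 <= b + e * x} -> {in `]p, q[, forall x, 0 < b + e * x} ->
  {in `[p, q], forall x, s * (b + e * x) <= bz 1} -> {in `]p, q[, forall x, s * (b + e * x) < bz 1} ->
  {in `[p, q], forall x, h x = m * (b + e * x)} ->
  (b + e * p = 0 /\ q < 1) \/ (b + e * q = 0 /\ 0 < p) ->
  lower_piece (fun x => h x `^ al) (s ^+ 2) p q.
Proof.
move=> s0 pq ee m0 t0 tp ts ts' hE bc U v ACU Iv bp bq.
have al0 : al != 0 by rewrite gt_eqF// (lt_le_trans ltr01)// al_ge1.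
rewrite (@eq_II _ _ _ _ (fun x => U x ^+ 2 * (m * (b + e * x)) `^ al)); last by move=> x xx; rewrite hE.
rewrite [leRHS](@eq_II _ _ _ _ (fun x => v x ^+ 2 * (m * (b + e * x)) `^ al)); last by move=> x xx; rewrite hE.
apply: (@picone _ p q (s ^+ 2) _ (fun x => G (s * (b + e * x))) (fun x => s * e * dG (s * (b + e * x)))) => //.
- by rewrite exprn_ge0// ltW.
- apply: (@eq_within_cont _ _ _ (fun x => `|m * (b + e * x)| `^ al)).
    by move=> x xx /=; rewrite ger0_norm// mulr_ge0 ?(ltW m0)// t0.
  apply: continuous_subspaceT => x.
  exact: (@continuous_comp_affine _ (fun x => `|x| `^ al) m b e (continuous_norm_powR al_ge1)).
- by move=> x _; exact: powR_ge0.
- exact: C1_bG.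
- move=> x xx; have := ts x xx; rewrite le_eqVlt => /predU1P[->|H]; first by rewrite bz_zero.
  by rewrite ltW// bG_gt0// mulr_ge0 ?(ltW s0) ?t0.
- move=> x xx; rewrite bG_gt0 ?ts'// mulr_ge0 ?(ltW s0)// ltW// tp//.
- exact: AC_bessel_flux (ltW pq) ee m0 t0 tp.
- case: bc => -[bc1 bc2]; first by right; rewrite bc1 !mulr0 powR0// mul0r.
  by left; case: bp => // p00; rewrite p00 ltxx in bc2.
- case: bc => -[bc1 bc2]; last by right; rewrite bc1 !mulr0 powR0// mul0r.
  by left; case: bq => // q00; rewrite q00 ltxx in bc2.
Qed.

(** The sign [sg] makes the chosen arch positive; the zeros, scaled by [1/s], are counted from 0 or
    from 1 according to [b + e x]. *)
Definition wave sg s b e x := sg * wB nu (s * (b + e * x)).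
Definition dwave sg s b e x := sg * (s * e * dwB nu (s * (b + e * x))).
Definition ddwave sg s b e x := (mu * (mu - 1) / (b + e * x) ^+ 2 - s ^+ 2) * wave sg s b e x.

Lemma is_derive_wave sg s b e x : 0 < s -> 0 < b + e * x ->
  is_derive x 1 (wave sg s b e) (dwave sg s b e x).
Proof.
move=> s0 tx; have stx : 0 < s * (b + e * x) by rewrite mulr_gt0.
have D := is_deriveM (is_derive_cst sg x 1) (is_derive_comp_affine (is_derive_wB nu0 stx)).
by apply: (is_derive_eq D); rewrite /GRing.scale/= mulr0 addr0.
Qed.

Lemma is_derive_dwave sg s b e x : e * e = 1 -> 0 < s -> 0 < b + e * x ->
  is_derive x 1 (dwave sg s b e) (ddwave sg s b e x).
Proof.
move=> ee s0 tx; have stx : 0 < s * (b + e * x) by rewrite mulr_gt0.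
have D := is_deriveM (is_derive_cst sg x 1) (is_deriveM (is_derive_cst (s * e) x 1) (is_derive_comp_affine (is_derive_dwB nu0 stx))).
apply: (is_derive_eq D); rewrite /GRing.scale/= !mulr0 !addr0 /ddwave /wave -/al -/mu.
rewrite -[RHS]mul1r -[X in _ = X * _]ee; field.
by rewrite !gt_eqF.
Qed.

Lemma C1_wave p q sg s b e : 0 < s -> e * e = 1 -> {in `[p, q], forall x, 0 < b + e * x} ->
  C1 p q (wave sg s b e) (dwave sg s b e).
Proof.
move=> s0 ee tp; apply: C1_intro => [x xx|]; first by apply: is_derive_wave; rewrite ?tp.
by apply: (@derive_segment_cont _ _ (ddwave sg s b e)) => x xx; apply: is_derive_dwave; rewrite ?tp.
Qed.

Lemma C1_dwave p q sg s b e : 0 < s -> e * e = 1 -> {in `[p, q], forall x, 0 < b + e * x} ->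
  C1 p q (dwave sg s b e) (ddwave sg s b e).
Proof.
move=> s0 ee tp; apply: C1_intro => [x xx|]; first by apply: is_derive_dwave; rewrite ?tp.
apply: within_contM; last by have [] := C1_wave sg s0 ee tp.
apply: within_contB; last exact: within_cont_cst.
apply: within_contM; first exact: within_cont_cst.
apply: within_contV => [x xx|]; first by rewrite expf_neq0// gt_eqF// tp.
apply: continuous_subspaceT => x.
have c := @continuous_comp_affine _ id 1 b e (fun y => @cvg_id _ (nbhs y)).
have -> : (fun x => (b + e * x) ^+ 2) = (fun x => (1 * (b + e * x)) * (1 * (b + e * x))).
  by apply/funext => y; rewrite mul1r expr2.
by apply: cvgM; exact: c.
Qed.

End BoundaryPieces.

Arguments bz : simpl never.

(** * Contact points and supporting lines *)

Section Touching.
Variable R : realType.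
Implicit Types (al p q r t x y s : R) (h w dw ddw : R -> R).

Let above h x0 s := forall x, 0 <= x <= 1 -> h x <= h x0 + s * (x - x0).

Lemma is_derive_cont (f : R -> R) x d : is_derive x 1 f d -> {for x, continuous f}.
Proof. by case=> D _; apply: differentiable_continuous; apply/derivable1_diffP. Qed.

(** The maximum of [w / h^(al/2)]. Since [w] need not vanish at [r], the point [r] is not excluded
    here; [touch_left] uses this to cut a piece at the maximum of [h]. *)
Lemma argmax_exists h al p r w : concave_unit h -> 0 < p -> p < r -> r < 1 ->
  {within `[p, r], continuous w} -> w p = 0 -> {in `]p, r[, forall x, 0 < w x} ->
  exists x0, [/\ p < x0, x0 <= r, 0 < w x0 &
    {in `[p, r], forall x, w x * h x0 `^ (al / 2) <= w x0 * h x `^ (al / 2)}].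
Proof.
move=> hL p0 pr r1 cw wp0 wp.
have hp x : x \in `[p, r] -> 0 < h x.
  by rewrite in_itv/= => /andP[px xr]; apply: (concave_gt0 hL); apply/andP; split; lra.
have Hp x : x \in `[p, r] -> 0 < h x `^ (al / 2) by move=> /hp; exact: powR_gt0.
have cH : {within `[p, r], continuous (fun x => h x `^ (al / 2))}.
  apply: continuous_in_subspaceT => x; rewrite inE/= => xx.
  apply: (@continuous_comp _ _ _ h (fun y => y `^ (al / 2))); last exact/powR_cvg/hp.
  apply: (concave_cont hL); move: xx; rewrite in_itv/= => /andP[px xr].
  by apply/andP; split; lra.
have cphi : {within `[p, r], continuous (fun x => w x * (h x `^ (al / 2))^-1)}.
  by apply: within_contM => //; apply: within_contV => // x xx; rewrite gt_eqF ?Hp.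
have [x0 x0pr Hx0] := EVT_max (ltW pr) cphi.
pose m := (p + r) / 2; have mpr : m \in `]p, r[ by rewrite in_itv/= /m; apply/andP; split; lra.
have mpr' := subset_itv_oo_cc mpr.
have wx0 : 0 < w x0.
  have := Hx0 m mpr'; rewrite leNgt; apply: contraR; rewrite -leNgt => w0.
  apply: (@le_lt_trans _ _ 0); first by rewrite pmulr_lle0 ?invr_gt0 ?Hp.
  by rewrite divr_gt0 ?wp ?Hp.
have x0pr' := x0pr; move: x0pr'; rewrite in_itv/= => /andP[px0 x0r].
exists x0; split => //.
  rewrite lt_neqAle px0 andbT; apply/eqP => px0'; move: wx0; rewrite -px0' wp0 ltxx//.
move=> x xpr; have := Hx0 x xpr.
by rewrite ler_pdivlMr ?Hp// mulrAC ler_pdivrMr ?Hp.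
Qed.

(** Raised to the power [2/al], local maximality of [w / h^(al/2)] says that [Phi] touches the
    concave [h] from below at [x0]. The supporting line then has the slope of [Phi]. *)
Lemma argmax_line h al x0 w d : concave_unit h -> 0 < al -> 0 < x0 < 1 ->
  is_derive x0 1 w d -> 0 < w x0 ->
  (\forall x \near x0, w x * h x0 `^ (al / 2) <= w x0 * h x `^ (al / 2)) ->
  exists2 s, above h x0 s & d * h x0 = al / 2 * s * w x0.
Proof.
move=> hL al0 x001 Dw wx0 Hn; have h0 := concave_gt0 hL x001.
have al2 : al / 2 * (2 / al) = 1 by field; rewrite gt_eqF.
have hK y : 0 <= y -> (y `^ (al / 2)) `^ (2 / al) = y by move=> y0; rewrite -powRrM al2 powRr1.
pose K := h x0 `^ (al / 2) / w x0; have K0 : 0 < K by rewrite divr_gt0 ?powR_gt0.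
have wK : w x0 * K = h x0 `^ (al / 2) by rewrite /K mulrC divfK// gt_eqF.
have wK0 : 0 < w x0 * K by rewrite mulr_gt0.
pose Phi x := (w x * K) `^ (2 / al).
exists (2 / al * (d / w x0) * h x0); last by field; rewrite !gt_eqF.
apply: (@concave_touch _ _ hL x0 Phi) => //.
- have D := is_deriveM Dw (is_derive_cst K x0 1).
  have := @is_derive1_comp _ (fun y => y `^ (2 / al)) (fun x => w x * K) x0 _ _ (is_derive1_powR _ wK0) D.
  move=> H; apply: (is_derive_eq H); rewrite /GRing.scale/= mulr0 add0r.
  rewrite powRB ?(gt_eqF wK0) ?implybT// powRr1 ?ltW// wK hK ?ltW// /K.
  by field; rewrite !gt_eqF ?powR_gt0.
- have [e e0 He] := cont_gt0_ball (is_derive_cont Dw) wx0.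
  have N1 : \forall x \near x0, ball x0 e x by exact: nbhsx_ballx.
  have x0i : x0 \in `]0, 1[ by rewrite in_itv.
  have N2 : \forall x \near x0, x \in `]0, 1[ by exact: near_in_itvoo.
  near=> x.
  have wx : 0 < w x by apply: He; rewrite distrC; near: x; apply: filterS N1 => x; rewrite -ball_normE.
  have x01 : 0 < x < 1 by suff: x \in `]0, 1[ by []; near: x.
  have hx := concave_gt0 hL x01.
  have wxK : 0 <= w x * K by rewrite ltW// mulr_gt0.
  have wxK' : w x * K <= h x `^ (al / 2).
    by rewrite /K mulrA ler_pdivrMr// [leRHS]mulrC; near: x.
  rewrite -[leRHS](hK (h x) (ltW hx)).
  apply: ge0_ler_powR; rewrite ?nnegrE ?powR_ge0//.
  by rewrite divr_ge0// ltW.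
- by rewrite /Phi wK hK// ltW.
Unshelve. all: by end_near. Qed.

Lemma touch_two_sided h al p q w dw ddw : concave_unit h -> 0 < al -> 0 < p -> p < q -> q < 1 ->
  C1 p q w dw -> C1 p q dw ddw -> w p = 0 -> w q = 0 -> {in `]p, q[, forall x, 0 < w x} ->
  exists x0 s, [/\ p < x0 < q, above h x0 s & dw x0 * h x0 = al / 2 * s * w x0].
Proof.
move=> hL al0 p0 pq q1 [Dw cw _] _ wp0 wq0 wp.
have [x0 [px0]] := argmax_exists al hL p0 pq q1 cw wp0 wp.
rewrite le_eqVlt => /predU1P[->|x0q wx0 H]; first by rewrite wq0 ltxx.
have x0pq : x0 \in `]p, q[ by rewrite in_itv/= px0.
have x001 : 0 < x0 < 1 by apply/andP; split; lra.
have [|s s1 s2] := argmax_line hL al0 x001 (Dw _ x0pq) wx0.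
  have N : \forall x \near x0, x \in `]p, q[ by exact: near_in_itvoo.
  by apply: filterS N => x /subset_itv_oo_cc; exact: H.
by exists x0, s; rewrite px0 x0q.
Qed.

(** The maximization is restricted to points up to [t]. It cannot be attained at [t], where [w]
    decreases and [h] is largest. From a contact point to the left of [t], a line lying above
    [h t = 1] has nonnegative slope. *)
Lemma touch_left h al p q w dw ddw t : concave_unit h -> 0 < al -> 0 < p -> p < q -> q < 1 ->
  C1 p q w dw -> C1 p q dw ddw -> w p = 0 -> w q = 0 -> {in `]p, q[, forall x, 0 < w x} ->
  0 <= t <= 1 -> h t = 1 -> p < t -> (t < q -> dw t < 0) ->
  exists x0 s, [/\ p < x0 < q, above h x0 s, dw x0 * h x0 = al / 2 * s * w x0 & 0 <= s].
Proof.
move=> hL al0 p0 pq q1 [Dw cw _] [Ddw _ _] wp0 wq0 wp t01 ht pt dwt.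
pose r := Num.min t q; have pr : p < r by rewrite lt_min pt.
have rq : r <= q by rewrite ge_min lexx orbT.
have rt : r <= t by rewrite ge_min lexx.
have r1 : r < 1 by exact: le_lt_trans q1.
have cw' := within_contS (lexx p) rq cw.
have wp' : {in `]p, r[, forall x, 0 < w x}.
  by move=> x; rewrite in_itv/= => /andP[px xr]; apply: wp; rewrite in_itv/= px (lt_le_trans xr).
have [x0 [px0 x0r wx0 H]] := argmax_exists al hL p0 pr r1 cw' wp0 wp'.
have x0r' : x0 < r.
  rewrite lt_neqAle x0r andbT; apply/eqP => E; have := wx0; rewrite E.
  have [tq|qt] := ltP t q; last by rewrite /r (min_idPr qt) wq0 ltxx.
  have rE : r = t by apply/min_idPl/ltW.
  move=> wr; have tpq : t \in `]p, q[ by rewrite in_itv/= pt.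
  have dwt' : 0 < (- dw) t by rewrite fctE/= oppr_gt0 dwt.
  have [e e0 He] := cont_gt0_ball (is_derive_cont (is_deriveN (Ddw t tpq))) dwt'.
  (* A point just before [t] where [w'] is still negative: [w y > w t] while [h y <= h t], against
     maximality at [t]. *)
  pose y := Num.max ((p + t) / 2) (t - e / 2).
  have yt : y < t by rewrite gt_max; apply/andP; split; lra.
  have py : p < y by rewrite lt_max; apply/orP; left; lra.
  have ye : t - e < y by rewrite lt_max; apply/orP; right; lra.
  have : - w y < - w t.
    apply: (@derive_gt0_lt _ (fun x => - w x) (fun x => - dw x)) => // x.
      rewrite in_itv/= => /andP[yx xt]; apply: is_deriveN; apply: Dw.
      by rewrite in_itv/= (lt_le_trans py)//= (le_lt_trans xt).
    by move=> yx xt; apply: He; rewrite ltr_norml; apply/andP; split; lra.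
  rewrite ltrN2 ltNge; apply/negP; rewrite negbK.
  have ypr : y \in `[p, r] by rewrite in_itv/= (ltW py) rE ltW.
  have := H y ypr; rewrite E rE ht powR1 mulr1 => /le_trans; apply.
  have y01 : 0 <= y <= 1 by apply/andP; split; lra.
  rewrite -[leRHS]mulr1 ler_pM2l; last by rewrite -rE.
  have := @ge0_ler_powR R (al / 2) _ (h y) 1; rewrite powR1 !nnegrE; apply => //.
  - by rewrite divr_ge0// ltW.
  - exact: concave_ge0.
  - exact: concave_le1.
have x0pr : x0 \in `]p, r[ by rewrite in_itv/= px0.
have x0pq : x0 \in `]p, q[ by rewrite in_itv/= px0 (lt_le_trans x0r').
have x001 : 0 < x0 < 1 by apply/andP; split; lra.
have [|s s1 s2] := argmax_line hL al0 x001 (Dw _ x0pq) wx0.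
  have N : \forall x \near x0, x \in `]p, r[ by exact: near_in_itvoo.
  by apply: filterS N => x /subset_itv_oo_cc; exact: H.
have x0q : p < x0 < q by rewrite px0 (lt_le_trans x0r').
exists x0, s; split => //.
have := s1 t t01; rewrite ht => h1; have h2 : h x0 <= 1 by apply: (concave_le1 hL); apply/andP; split; lra.
have h3 : x0 < t by exact: lt_le_trans rt.
have : 0 <= s * (t - x0) by lra.
by rewrite pmulr_lge0// subr_gt0.
Qed.

Lemma concave_unit_mirror h : concave_unit h -> concave_unit (fun x => h (1 - x)).
Proof.
move=> [h01 hc [t t01 ht]]; split.
- by move=> x x01; apply: h01; apply/andP; split; lra.
- move=> x y z x0 xy yz z1; have := hc (1 - z) (1 - y) (1 - x); lra.
- by exists (1 - t); [apply/andP; split; lra|rewrite opprB addrC subrK].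
Qed.

(** A line above [h] is nonnegative at 0 and at 1; these two facts are the bounds on its slope. *)
Lemma above_slope h x0 s x : concave_unit h -> above h x0 s -> 0 < x < 1 ->
  let l := h x0 + s * (x - x0) in [/\ 0 < l, s * x <= l & - s * (1 - x) <= l].
Proof.
move=> hL hl x01 l; have hx := concave_gt0 hL x01; case/andP: x01 => x0p x1.
have h0 : 0 <= h 0 by apply: (concave_ge0 hL); rewrite lexx ler01.
have h1 : 0 <= h 1 by apply: (concave_ge0 hL); rewrite lexx ler01.
have := hl 0; have := hl 1; rewrite !lexx ler01 => /(_ isT) l1 /(_ isT) l0.
have lx : h x <= l by apply: hl; rewrite !ltW.
by split; rewrite /l in lx *; lra.
Qed.

Lemma slope_sq_le s l t : 0 < l -> 0 < t -> - l <= s * t -> s * t <= l -> (s / l) ^+ 2 <= 1 / t ^+ 2.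
Proof.
move=> l0 t0 h1 h2; rewrite div1r -exprVn -[leRHS]real_normK ?num_real// -[leLHS]real_normK ?num_real//.
rewrite ler_sqr ?nnegrE// normrM normfV [X in _ / X]gtr0_norm// [leRHS]gtr0_norm ?invr_gt0//.
rewrite ler_pdivrMr// -ler_pdivrMl ?invr_gt0// invrK mulrC.
rewrite -[X in _ * X](gtr0_norm t0) -normrM ler_norml h1 h2//.
Qed.

End Touching.

(** * Inner pieces for alpha at least 2: Bessel waves *)

Section WavePieces.
Variables (R : realType) (nu : R).
Hypothesis nu_half : 2^-1 <= nu.
Let al := 2 * nu + 1.
Let mu := al / 2.
Implicit Types (p q s b e m x sg : R) (h : R -> R) (n : nat).
Local Notation bz := (bz nu).
Local Notation wave := (wave nu).
Local Notation dwave := (dwave nu).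
Local Notation ddwave := (ddwave nu).

Let nu0 : 0 <= nu. Proof. by apply: le_trans nu_half; rewrite invr_ge0. Qed.
Let mu1 : 1 <= mu. Proof. by rewrite /mu /al; move: nu_half; lra. Qed.
Let al1 : 1 <= al. Proof. exact: al_ge1. Qed.
Let al0 : 0 < al. Proof. exact: lt_le_trans al1. Qed.

(** With [t = b + e x] and [c = mu (mu - 1) >= 0], the middle term is [c/t^2 - s^2 - c (d/l)^2]
    times the wave. The lower bound uses [(d/l)^2 <= 1/t^2], the upper one
    [c < (bz 1)^2 <= (s t)^2]. *)
Lemma wave_flux_bounds sg s b e d l x : 0 < s -> 0 < b + e * x -> bz 1 <= s * (b + e * x) ->
  0 < l -> - l <= d * (b + e * x) -> d * (b + e * x) <= l -> 0 <= wave sg s b e x ->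
  - s ^+ 2 * wave sg s b e x <=
    ddwave sg s b e x - al / 2 * (al / 2 - 1) * (d / l) ^+ 2 * wave sg s b e x <= 0.
Proof.
rewrite /ddwave -/al -/mu; set t := b + e * x; set W := wave _ _ _ _ _ => s0 t0 st l0 d1 d2 W0.
have r := slope_sq_le l0 t0 d1 d2; set D := (d / l) ^+ 2 in r *.
have D0 : 0 <= D by exact: sqr_ge0.
have c0 : 0 <= mu * (mu - 1) by rewrite mulr_ge0// ?subr_ge0// (le_trans ler01).
have H1 : mu * (mu - 1) * D <= mu * (mu - 1) * (1 / t ^+ 2) by rewrite ler_wpM2l.
have H2 : mu * (mu - 1) * (1 / t ^+ 2) <= s ^+ 2.
  rewrite mulrA mulr1 ler_pdivrMr ?exprn_gt0// -exprMn.
  apply: le_trans (ltW (bz1_sqr nu0)) _.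
  by rewrite ler_sqr// nnegrE ltW// ?mulr_gt0// bz_gt0.
have H3 : 0 <= mu * (mu - 1) * D by rewrite mulr_ge0.
rewrite -mulrBl -[mu * (mu - 1) / _]mulr1 -mulrA [_^-1 * 1]mulrC.
apply/andP; split; first by rewrite ler_wpM2r//; lra.
by rewrite mulr_le0_ge0//; lra.
Qed.

Lemma wave_sign n : exists sg, forall s b e x, 0 < s ->
  bz n < s * (b + e * x) -> s * (b + e * x) < bz n.+1 -> 0 < wave sg s b e x.
Proof.
have [sg _ H] := bz_sign nu0 n; exists sg => s b e x s0 h1 h2.
rewrite /wave /wB mulrCA mulr_gt0 ?H// powR_gt0// (le_lt_trans _ h1)//.
by case: (bz_ge0 nu0 n) => [->//|/ltW].
Qed.

Lemma wave_eq0 n sg s b e x : s * (b + e * x) = bz n.+1 -> wave sg s b e x = 0.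
Proof. by move=> H; rewrite /wave /wB H bz_zero// !mulr0. Qed.

Section OneWave.
Variables (n : nat) (s b e p q : R).
Hypotheses (s0 : 0 < s) (ee : e * e = 1) (p0 : 0 < p) (pq : p < q) (q1 : q < 1).
Hypothesis tin : {in `[p, q], forall x, bz n.+1 <= s * (b + e * x)}.
Hypothesis tin' : {in `]p, q[, forall x, bz n.+1 < s * (b + e * x) < bz n.+2}.
Hypothesis tends : (s * (b + e * p) = bz n.+1 /\ s * (b + e * q) = bz n.+2) \/
  (s * (b + e * p) = bz n.+2 /\ s * (b + e * q) = bz n.+1).

Lemma wave_dom_gt0 : {in `[p, q], forall x, 0 < b + e * x}.
Proof. by move=> x /tin; have := bz_gt0 nu0 n => z0 /(lt_le_trans z0); rewrite pmulr_rgt0. Qed.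

Lemma wave_dom_ge1 : {in `[p, q], forall x, bz 1 <= s * (b + e * x)}.
Proof. by move=> x /tin; apply: le_trans; exact: bz_le. Qed.

Lemma wave_piece : exists sg, [/\ C1 p q (wave sg s b e) (dwave sg s b e),
  C1 p q (dwave sg s b e) (ddwave sg s b e), {in `]p, q[, forall x, 0 < wave sg s b e x},
  {in `[p, q], forall x, 0 <= wave sg s b e x} & wave sg s b e p = 0 /\ wave sg s b e q = 0].
Proof.
have [sg Hsg] := wave_sign n.+1; exists sg.
have wp : {in `]p, q[, forall x, 0 < wave sg s b e x} by move=> x /tin'/andP[]; exact: Hsg.
have w0 : wave sg s b e p = 0 /\ wave sg s b e q = 0.
  by case: tends => -[h1 h2]; split; [apply: wave_eq0 h1|apply: wave_eq0 h2|apply: wave_eq0 h1|apply: wave_eq0 h2].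
have t0 := wave_dom_gt0.
split; [exact: C1_wave|exact: C1_dwave|exact: wp| |exact: w0].
move=> x; rewrite in_itv/= => /andP[]; rewrite le_eqVlt => /predU1P[<-|px']; first by rewrite w0.1.
rewrite le_eqVlt => /predU1P[->|xq']; first by rewrite w0.2.
by rewrite ltW// wp// in_itv/= px'.
Qed.

(** The hypothesis on [d] and [l] isolates the only place where the position of the piece matters:
    [|l'/l| <= 1/(b + e x)] has to follow from nonnegativity of [l] at 0 and 1. *)
Lemma upper_wave h : concave_unit h ->
  (forall d l x, x \in `[p, q] -> 0 < l -> d * x <= l -> - d * (1 - x) <= l ->
    - l <= d * (b + e * x) /\ d * (b + e * x) <= l) ->
  upper_piece (fun x => h x `^ al) (s ^+ 2) p q.
Proof.
move=> hL slope; have [sg [Cw Cdw wp w0 [wp0 wq0]]] := wave_piece.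
have [x0 [d [/andP[px0 x0q] hl crit]]] := touch_two_sided hL al0 p0 pq q1 Cw Cdw wp0 wq0 wp.
apply: (@upper_line _ h al (s ^+ 2) p q x0 d _ _ _ hL al1 _ p0 px0 x0q q1 hl Cw Cdw wp wp0 wq0 crit).
  by rewrite exprn_ge0// ltW.
move=> /= x xpq; have t0 := wave_dom_gt0 xpq; have t1 := wave_dom_ge1 xpq.
move: (xpq); rewrite in_itv/= => /andP[px xq].
have x01 : 0 < x < 1 by rewrite (lt_le_trans p0)//= (le_lt_trans xq).
have [l0 l1 l2] := above_slope hL hl x01; have [d1 d2] := slope _ _ _ xpq l0 l1 l2.
by apply: wave_flux_bounds => //; exact: w0.
Qed.

Lemma lower_wave h m : 0 < m -> {in `[p, q], forall x, h x = m * (b + e * x)} ->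
  lower_piece (fun x => h x `^ al) (s ^+ 2) p q.
Proof.
move=> m0 hE; have [sg [Cw Cdw wp w0 [wp0 wq0]]] := wave_piece.
have tE x : m * b + m * e * x = m * (b + e * x) by ring.
apply: (@lower_line _ h al (s ^+ 2) p q (m * b) (m * e) _ _ _ _ pq _ _ Cw Cdw wp wp0 wq0) => //.
- by rewrite exprn_ge0// ltW.
- by move=> x xx; rewrite tE hE.
- by move=> x xx; rewrite tE mulr_gt0// wave_dom_gt0.
- move=> x xx; have t0 := wave_dom_gt0 xx; rewrite tE /ddwave -/al -/mu.
  rewrite (_ : (m * e / (m * (b + e * x))) ^+ 2 = (b + e * x) ^- 2); first by field; rewrite gt_eqF.
  rewrite -[RHS]mul1r -[X in _ = X * _]ee; field; rewrite !gt_eqF//.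
Qed.

End OneWave.

Let scaleK s z : 0 < s -> s * (z / s) = z. Proof. by move=> s0; rewrite mulrC divfK// gt_eqF. Qed.

Lemma left_wave_dom n s (p := bz n.+1 / s) (q := bz n.+2 / s) : 0 < s ->
  [/\ p < q, {in `[p, q], forall x, bz n.+1 <= s * (0 + 1 * x)},
    {in `]p, q[, forall x, bz n.+1 < s * (0 + 1 * x) < bz n.+2} &
    s * (0 + 1 * p) = bz n.+1 /\ s * (0 + 1 * q) = bz n.+2].
Proof.
move=> s0; split.
- by rewrite ltr_pM2r ?invr_gt0// bz_lt.
- move=> x; rewrite in_itv/= add0r mul1r => /andP[px _].
  by rewrite -(scaleK (bz n.+1) s0) ler_pM2l.
- move=> x; rewrite in_itv/= add0r mul1r => /andP[px xq].
  by rewrite -{1}(scaleK (bz n.+1) s0) -(scaleK (bz n.+2) s0) !ltr_pM2l// px.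
- by rewrite !add0r !mul1r !scaleK.
Qed.

Lemma right_wave_dom n s (p := 1 - bz n.+2 / s) (q := 1 - bz n.+1 / s) : 0 < s ->
  [/\ p < q, {in `[p, q], forall x, bz n.+1 <= s * (1 + -1 * x)},
    {in `]p, q[, forall x, bz n.+1 < s * (1 + -1 * x) < bz n.+2} &
    s * (1 + -1 * p) = bz n.+2 /\ s * (1 + -1 * q) = bz n.+1].
Proof.
move=> s0; split.
- by rewrite ltrD2l ltrN2 ltr_pM2r ?invr_gt0// bz_lt.
- move=> x; rewrite in_itv/= mulN1r => /andP[_ xq].
  by rewrite -(scaleK (bz n.+1) s0) ler_pM2l// lerBrDr -lerBrDl.
- move=> x; rewrite in_itv/= mulN1r => /andP[px xq].
  rewrite -{1}(scaleK (bz n.+1) s0) -(scaleK (bz n.+2) s0) !ltr_pM2l//.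
  by rewrite ltrBrDr -ltrBrDl xq/= ltrBlDr -ltrBlDl.
- by rewrite !mulN1r !opprB !(addrC 1) !subrK !scaleK.
Qed.

(** For [x <= 1/2] one has [x <= 1 - x], so nonnegativity of the line at 1 also bounds its descent
    by [1/x]. *)
Lemma upper_wave_left h s n : concave_unit h -> 0 < s -> bz n.+2 / s <= 1 / 2 ->
  upper_piece (fun x => h x `^ al) (s ^+ 2) (bz n.+1 / s) (bz n.+2 / s).
Proof.
move=> hL s0 q2; have [pq t1 t2 t3] := left_wave_dom n s0.
have p0 : 0 < bz n.+1 / s by rewrite divr_gt0// bz_gt0.
apply: (upper_wave s0 (mulr1 1) p0 pq _ t1 t2) => //; [by lra|by left|].
move=> d l x; rewrite in_itv/= add0r mul1r => /andP[px xq] l0 l1 l2; split => //.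
have x2 : x <= 1 / 2 by exact: le_trans q2.
have x0 : 0 <= x by exact/ltW/(lt_le_trans p0).
have [d0|d0] := leP 0 d; first by have := mulr_ge0 d0 x0; lra.
have nd : 0 <= - d by lra.
have x3 : 0 <= 1 - 2 * x by lra.
by have := mulr_ge0 nd x3; lra.
Qed.

Lemma upper_wave_right h s n : concave_unit h -> 0 < s -> bz n.+2 / s <= 1 / 2 ->
  upper_piece (fun x => h x `^ al) (s ^+ 2) (1 - bz n.+2 / s) (1 - bz n.+1 / s).
Proof.
move=> hL s0 q2; have [pq t1 t2 t3] := right_wave_dom n s0.
have p0 : 0 < bz n.+1 / s by rewrite divr_gt0// bz_gt0.
have ee : -1 * -1 = 1 :> R by ring.
apply: (upper_wave s0 ee _ pq _ t1 t2) => //; [by lra|by lra|by right|].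
move=> d l x; rewrite in_itv/= mulN1r => /andP[px xq] l0 l1 l2; split; first by lra.
have x2 : 1 / 2 <= x by lra.
have x1 : 0 <= 1 - x by lra.
have x3 : 0 <= 2 * x - 1 by lra.
have [d0|d0] := leP 0 d; first by have := mulr_ge0 d0 x3; lra.
have nd : 0 <= - d by lra.
by have := mulr_ge0 nd x1; lra.
Qed.

(* Here the slope of the supporting line is not controlled by [1 / x]: if the
   wave [A] decreases, or its mirror image [B] increases, at the maximum [t] of
   [h], then the touching point for [A] lies left of [t], resp. that for [B] right
   of [t]; otherwise a convex combination of [A] and [B] is critical at [t], where
   the supporting line is horizontal. *)
Lemma upper_wave_middle h n (s := bz n.+1 + bz n.+2) : concave_unit h ->
  upper_piece (fun x => h x `^ al) (s ^+ 2) (bz n.+1 / s) (bz n.+2 / s).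
Proof.
move=> hL; have z0 := bz_gt0 nu0 n; have z1 := bz_gt0 nu0 n.+1.
have s0 : 0 < s by rewrite addr_gt0.
have [pq tA tA' eA] := left_wave_dom n s0; have [_ tB tB' eB] := right_wave_dom n s0.
set p := bz n.+1 / s in pq tA tA' eA tB tB' eB *; set q := bz n.+2 / s in pq tA tA' eA tB tB' eB *.
(* The choice of [s] centres the piece at [1/2], so that the waves counted from 0 and from 1 are
   mirror images on it. *)
have q1E : 1 - q = p.
  by apply: (mulfI (lt0r_neq0 s0)); rewrite mulrBr mulr1 !scaleK// /s addrK.
have p1E : 1 - p = q by rewrite -q1E opprB addrC subrK.
rewrite q1E p1E in tB tB' eB.
have p0 : 0 < p by rewrite divr_gt0.
have q1 : q < 1 by lra.
have ee : -1 * -1 = 1 :> R by ring.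
have M0 : 0 <= s ^+ 2 by rewrite exprn_ge0// ltW.
have [sg [CA CdA pA nA [A1 A2]]] := wave_piece s0 (mulr1 1) tA tA' (or_introl eA).
have dA0 := wave_dom_gt0 s0 tA; have dA1 := wave_dom_ge1 tA.
have dB0 := wave_dom_gt0 s0 tB; have dB1 := wave_dom_ge1 tB.
have BE x : wave sg s 1 (-1) x = wave sg s 0 1 (1 - x) by rewrite /wave add0r mul1r mulN1r.
have dBE x : dwave sg s 1 (-1) x = - dwave sg s 0 1 (1 - x).
  by rewrite /dwave add0r mul1r mulN1r; ring.
have mirror x : x \in `[p, q] -> 1 - x \in `[p, q].
  by rewrite !in_itv/= => /andP[px xq]; apply/andP; split; lra.
have mirror' x : x \in `]p, q[ -> 1 - x \in `]p, q[.
  by rewrite !in_itv/= => /andP[px xq]; apply/andP; split; lra.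
have CB := C1_wave nu0 sg s0 ee dB0; have CdB := C1_dwave nu0 sg s0 ee dB0.
have pB : {in `]p, q[, forall x, 0 < wave sg s 1 (-1) x} by move=> x /mirror' xx; rewrite BE pA.
have nB : {in `[p, q], forall x, 0 <= wave sg s 1 (-1) x} by move=> x /mirror xx; rewrite BE nA.
have B1 : wave sg s 1 (-1) p = 0 by rewrite BE p1E.
have B2 : wave sg s 1 (-1) q = 0 by rewrite BE q1E.
have x01 x : x \in `[p, q] -> 0 < x < 1.
  by rewrite in_itv/= => /andP[px xq]; apply/andP; split; lra.
(* With a nonnegative slope, [|l'/l| <= 1/x] holds on the whole piece, even beyond [1/2]. *)
have useA x0 d : p < x0 -> x0 < q -> (forall x, 0 <= x <= 1 -> h x <= h x0 + d * (x - x0)) ->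
    dwave sg s 0 1 x0 * h x0 = al / 2 * d * wave sg s 0 1 x0 -> 0 <= d ->
    upper_piece (fun x => h x `^ al) (s ^+ 2) p q.
  move=> px0 x0q hl crit d0.
  apply: (@upper_line _ h al (s ^+ 2) p q x0 d _ _ _ hL al1 M0 p0 px0 x0q q1 hl CA CdA pA A1 A2 crit).
  move=> /= x xpq; have [l0 l1 l2] := above_slope hL hl (x01 x xpq); have t0 := dA0 x xpq.
  apply: wave_flux_bounds => //; [exact: dA1| | |exact: nA].
    by rewrite (@le_trans _ _ 0) ?oppr_le0 ?(ltW l0)// mulr_ge0// ltW.
  by rewrite add0r mul1r.
have useB x0 d : p < x0 -> x0 < q -> (forall x, 0 <= x <= 1 -> h x <= h x0 + d * (x - x0)) ->
    dwave sg s 1 (-1) x0 * h x0 = al / 2 * d * wave sg s 1 (-1) x0 -> d <= 0 ->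
    upper_piece (fun x => h x `^ al) (s ^+ 2) p q.
  move=> px0 x0q hl crit d0.
  apply: (@upper_line _ h al (s ^+ 2) p q x0 d _ _ _ hL al1 M0 p0 px0 x0q q1 hl CB CdB pB B1 B2 crit).
  move=> /= x xpq; have [l0 l1 l2] := above_slope hL hl (x01 x xpq); have t0 := dB0 x xpq.
  apply: wave_flux_bounds => //; [exact: dB1| | |exact: nB].
    by rewrite mulN1r; lra.
  by rewrite (@le_trans _ _ 0) ?(ltW l0)// mulr_le0_ge0// ltW.
have [_ _ [t t01 ht]] := hL.
have caseA : p < t -> (t < q -> dwave sg s 0 1 t < 0) -> upper_piece (fun x => h x `^ al) (s ^+ 2) p q.
  move=> pt dt; have [x0 [d [/andP[px0 x0q] hl crit d0]]] := touch_left hL al0 p0 pq q1 CA CdA A1 A2 pA t01 ht pt dt.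
  exact: useA px0 x0q hl crit d0.
(* This is [touch_left] for the mirrored profile, read back through [x] to [1 - x]. *)
have caseB : t < q -> (p < t -> 0 < dwave sg s 1 (-1) t) -> upper_piece (fun x => h x `^ al) (s ^+ 2) p q.
  move=> tq dt; have hL' := concave_unit_mirror hL.
  have t01' : 0 <= 1 - t <= 1 by rewrite subr_ge0 lerBlDr lerDl andbC.
  have ht' : h (1 - (1 - t)) = 1 by rewrite opprB addrC subrK.
  have pt' : p < 1 - t by lra.
  have dt' : 1 - t < q -> dwave sg s 0 1 (1 - t) < 0.
    by move=> tq'; rewrite -oppr_gt0 -dBE dt//; lra.
  have [x0 [d [/andP[px0 x0q] hl crit d0]]] := touch_left hL' al0 p0 pq q1 CA CdA A1 A2 pA t01' ht' pt' dt'.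
  have x0E : 1 - (1 - x0) = x0 by rewrite opprB addrC subrK.
  apply: (useB (1 - x0) (- d)).
  - by rewrite -q1E ltrD2l ltrN2.
  - by rewrite -p1E ltrD2l ltrN2.
  - move=> x /andP[x0' x1']; have xE : 1 - (1 - x) = x by rewrite opprB addrC subrK.
    have := hl (1 - x); rewrite xE subr_ge0 x1' lerBlDr lerDl x0' => /(_ isT).
    by rewrite (_ : 1 - x - x0 = - (x - (1 - x0))) ?mulrN ?mulNr//; ring.
  - by rewrite dBE BE x0E mulNr crit; ring.
  - by rewrite oppr_le0.
have [qt|tq] := leP q t; first by apply: caseA => [|tq]; [exact: lt_le_trans pq qt|have := lt_le_trans tq qt; rewrite ltxx].
have [tp|pt] := leP t p; first by apply: caseB => // pt; have := lt_le_trans pt tp; rewrite ltxx.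
have [dt|dAt] := ltP (dwave sg s 0 1 t) 0; first exact: caseA.
have [dt|dBt] := ltP 0 (dwave sg s 1 (-1) t); first exact: caseB.
have [la [la0 la1 laE]] : exists la : R, [/\ 0 <= la, la <= 1 &
    la * dwave sg s 0 1 t + (1 - la) * dwave sg s 1 (-1) t = 0].
  move: dAt dBt; set dA := dwave _ _ _ _ _; set dB := dwave _ _ _ _ _ => dAt dBt.
  (* Here [dA >= 0 >= dB]. If the difference is not positive, both derivatives vanish and any weight
     is suitable. *)
  have [ab|ab] := ltP 0 (dA - dB); last by exists 1; split => //; lra.
  exists (- dB / (dA - dB)); split.
  - by rewrite divr_ge0 ?(ltW ab)// oppr_ge0.
  - by rewrite ler_pdivrMr// mul1r; lra.
  - by field; rewrite gt_eqF.
pose W x := la * wave sg s 0 1 x + (1 - la) * wave sg s 1 (-1) x.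
pose dW x := la * dwave sg s 0 1 x + (1 - la) * dwave sg s 1 (-1) x.
pose ddW x := la * ddwave sg s 0 1 x + (1 - la) * ddwave sg s 1 (-1) x.
have comb f df g dg : C1 p q f df -> C1 p q g dg ->
    C1 p q (fun x => la * f x + (1 - la) * g x) (fun x => la * df x + (1 - la) * dg x).
  move=> Cf Cg; apply: eq_C1 (C1D (C1M (C1_cst p q la) Cf) (C1M (C1_cst p q (1 - la)) Cg)) => x _ /=.
  by rewrite !mul0r !add0r.
have la1' : 0 <= 1 - la by rewrite subr_ge0.
have W0 x : x \in `]p, q[ -> 0 < W x.
  move=> xx; have a := pA x xx; have b := pB x xx; rewrite /W.
  have [l0|l0] := ltP 0 la.
    by apply: ltr_pwDl; [exact: mulr_gt0|rewrite mulr_ge0// ltW].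
  have -> : la = 0 by apply/eqP; rewrite eq_le l0.
  by rewrite mul0r add0r subr0 mul1r.
have hl x : 0 <= x <= 1 -> h x <= h t + 0 * (x - t).
  by move=> x01'; rewrite mul0r addr0 ht; exact: (concave_le1 hL).
apply: (@upper_line _ h al (s ^+ 2) p q t 0 W dW ddW hL al1 M0 p0 pt tq q1 hl).
- exact: comb.
- exact: comb.
- exact: W0.
- by rewrite /W A1 B1 !mulr0 addr0.
- by rewrite /W A2 B2 !mulr0 addr0.
- by rewrite /dW laE !mul0r mulr0 mul0r.
move=> /= x xpq; have [l0 _ _] := above_slope hL hl (x01 x xpq).
have z0' (t' : R) : - (h t + 0 * (x - t)) <= 0 * t' /\ 0 * t' <= h t + 0 * (x - t).
  by rewrite [0 * t']mul0r oppr_le0 ltW.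
have HA := wave_flux_bounds s0 (dA0 x xpq) (dA1 x xpq) l0 (z0' _).1 (z0' _).2 (nA x xpq).
have HB := wave_flux_bounds s0 (dB0 x xpq) (dB1 x xpq) l0 (z0' _).1 (z0' _).2 (nB x xpq).
case/andP: HA; case/andP: HB; rewrite /W /ddW.
set D := _ * (0 / _) ^+ 2; set a := wave _ _ 0 1 x; set b := wave _ _ 1 (-1) x.
set a' := ddwave _ _ 0 1 x; set b' := ddwave _ _ 1 (-1) x => b1 b2 a1 a2.
have -> : la * a' + (1 - la) * b' - D * (la * a + (1 - la) * b) =
   la * (a' - D * a) + (1 - la) * (b' - D * b) by ring.
have -> : - s ^+ 2 * (la * a + (1 - la) * b) = la * (- s ^+ 2 * a) + (1 - la) * (- s ^+ 2 * b) by ring.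
apply/andP; split; first by rewrite lerD// ler_wpM2l.
by rewrite -[leRHS]addr0 lerD// mulr_ge0_le0.
Qed.

End WavePieces.

(** * Inner pieces for alpha at most 2: sines *)

Section SinePieces.
Variables (R : realType) (al s p : R).
Hypothesis s0 : 0 < s.
Let q := p + pi / s.
Implicit Types (h : R -> R) (x m d : R).

Let w x := sin (s * (- p + 1 * x)).
Let dw x := s * 1 * cos (s * (- p + 1 * x)).
Let ddw x := - s ^+ 2 * w x.

Let C1_w : C1 p q w dw.
Proof.
apply: C1_intro => [x _|]; first by apply: is_derive_comp_affine; exact: is_derive_sin.
apply: continuous_subspaceT => x; apply: cvgM; first exact: cvg_cst.
by apply: continuous_comp_affine => y; exact: continuous_cos.
Qed.

Let C1_dw : C1 p q dw ddw.
Proof.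
apply: C1_intro => [x _|].
  have D := is_deriveM (is_derive_cst (s * 1) x 1)
     (is_derive_comp_affine (s := s) (b := - p) (e := 1) (is_derive_cos (s * (- p + 1 * x)))).
  by apply: (is_derive_eq D); rewrite /ddw /w /GRing.scale/=; ring.
apply: continuous_subspaceT => x; apply: cvgM; first exact: cvg_cst.
by apply: continuous_comp_affine => y; exact: continuous_sin.
Qed.

Let pq : p < q. Proof. by rewrite ltrDl divr_gt0// pi_gt0. Qed.

Let w_gt0 : {in `]p, q[, forall x, 0 < w x}.
Proof.
move=> x; rewrite in_itv/= => /andP[px xq]; rewrite /w mul1r addrC sin_gt0_pi//.
rewrite mulr_gt0 ?subr_gt0//= mulrC -ltr_pdivlMr// ltrBlDr addrC//.
Qed.

Let w_p : w p = 0. Proof. by rewrite /w mul1r addNr mulr0 sin0. Qed.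

Let w_q : w q = 0.
Proof. by rewrite /w mul1r /q addKr mulrC divfK ?sinpi// gt_eqF. Qed.

Let w_ge0 : {in `[p, q], forall x, 0 <= w x}.
Proof.
move=> x; rewrite in_itv/= => /andP[]; rewrite le_eqVlt => /predU1P[<-|px']; first by rewrite w_p.
rewrite le_eqVlt => /predU1P[->|xq']; first by rewrite w_q.
by rewrite ltW// w_gt0// in_itv/= px'.
Qed.

(** The distance [1/s] to both ends gives [(l'/l)^2 <= s^2], whichever the sign of the slope. As
    [-1 <= c <= 0], the potential term only adds to [- s^2 w] and cannot make it positive. *)
Lemma upper_sine h : concave_unit h -> 1 <= al -> al <= 2 -> s^-1 <= p -> q <= 1 - s^-1 ->
  upper_piece (fun x => h x `^ al) (s ^+ 2) p q.
Proof.
move=> hL al1 al2 sp qs; have si : 0 < s^-1 by rewrite invr_gt0.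
have p0 : 0 < p by exact: lt_le_trans sp.
have q1 : q < 1 by apply: le_lt_trans qs _; rewrite ltrBlDr ltrDl.
have al0 : 0 < al by exact: lt_le_trans al1.
have [x0 [d [/andP[px0 x0q] hl crit]]] := touch_two_sided hL al0 p0 pq q1 C1_w C1_dw w_p w_q w_gt0.
apply: (@upper_line _ h al (s ^+ 2) p q x0 d _ _ _ hL al1 _ p0 px0 x0q q1 hl C1_w C1_dw w_gt0 w_p w_q crit).
  by rewrite exprn_ge0// ltW.
move=> /= x xpq; have W0 := w_ge0 xpq; move: xpq; rewrite in_itv/= => /andP[px xq].
have x01 : 0 < x < 1 by rewrite (lt_le_trans p0)//= (le_lt_trans xq).
have [l0 l1 l2] := above_slope hL hl x01; set l := h x0 + d * (x - x0) in l0 l1 l2 *.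
have xs : s^-1 <= x by exact: le_trans px.
have xs' : s^-1 <= 1 - x by rewrite lerBrDr addrC -lerBrDr; exact: le_trans qs.
have r : (d / l) ^+ 2 <= s ^+ 2.
  have := @slope_sq_le _ d l s^-1 l0 si; rewrite exprVn div1r invrK; apply.
    have [d0|d0] := leP 0 d; first by rewrite (@le_trans _ _ 0) ?oppr_le0 ?(ltW l0)// mulr_ge0// ltW.
    rewrite lerNl -mulNr (le_trans _ l2)// ler_wpM2l// oppr_ge0 ltW//.
  have [d0|d0] := leP 0 d; first by rewrite (le_trans _ l1)// ler_wpM2l.
  by rewrite (@le_trans _ _ 0) ?(ltW l0)// mulr_le0_ge0// ltW.
rewrite /ddw; set D := (d / l) ^+ 2 in r *; have D0 : 0 <= D by exact: sqr_ge0.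
set c := al / 2 * (al / 2 - 1).
have c0 : c <= 0 by rewrite /c mulr_ge0_le0//; lra.
have c1 : - 1 <= c by rewrite /c; nra.
rewrite -mulrBl; apply/andP; split.
  by rewrite ler_wpM2r// lerBrDr gerDl mulr_le0_ge0.
rewrite mulr_le0_ge0// subr_le0.
have : -1 * D <= c * D by rewrite ler_wpM2r.
lra.
Qed.

(** The condition on [d] covers the plateau [d = 0] for every [al], and every slope when [al = 2].
    The latter is the origin of the many maximizers in that case. *)
Lemma lower_sine h m d : al / 2 * (al / 2 - 1) * d = 0 -> 0 < p -> q < 1 ->
  {in `[p, q], forall x, h x = m + d * x} -> {in `[p, q], forall x, 0 < m + d * x} ->
  lower_piece (fun x => h x `^ al) (s ^+ 2) p q.
Proof.
move=> cd p0 q1 hE l0.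
apply: (@lower_line _ h al (s ^+ 2) p q m d _ _ _ _ pq hE l0 C1_w C1_dw w_gt0 w_p w_q _ p0 q1).
  by rewrite exprn_ge0// ltW.
move=> x xx; rewrite /ddw expr2 !mulrA cd !mul0r subr0 mulNr//.
Qed.

End SinePieces.

(** * Extremal profiles *)

Section ConcaveExamples.
Variable R : realType.
Implicit Types (f g h : R -> R) (m d a x : R).

Lemma concave01_affine h m d : (forall x, h x = m + d * x) -> concave01 h.
Proof.
by move=> hE x y z _ _ _ _; rewrite !hE le_eqVlt; apply/orP; left; apply/eqP; ring.
Qed.

Lemma concave01_min f g : concave01 f -> concave01 g -> concave01 (fun x => Num.min (f x) (g x)).
Proof.
move=> cf cg x y z x0 xy yz z1.
have zy : 0 <= z - y by rewrite subr_ge0 ltW.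
have yx : 0 <= y - x by rewrite subr_ge0 ltW.
have le1 (u v : R) : Num.min u v <= u by rewrite ge_min lexx.
have le2 (u v : R) : Num.min u v <= v by rewrite ge_min lexx orbT.
case: (leP (f y) (g y)) => _.
  apply: le_trans (cf x y z x0 xy yz z1).
  by rewrite lerD// ler_wpM2l.
apply: le_trans (cg x y z x0 xy yz z1).
by rewrite lerD// ler_wpM2l.
Qed.

(** Written as a minimum of affine functions, concavity follows without distinguishing positions. *)
Definition trapezoid a x := Num.min 1 (Num.min (x / a) ((1 - x) / a)).

Lemma trapezoid_left a x : 0 < a -> a <= 1 / 2 -> 0 <= x -> x <= a -> trapezoid a x = x / a.
Proof.
move=> a0 a1 x0 xa; rewrite /trapezoid [Num.min (x / a) _]min_l.
  by rewrite min_r// ler_pdivrMr// mul1r.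
by rewrite ler_pM2r ?invr_gt0//; lra.
Qed.

Lemma trapezoid_mid a x : 0 < a -> a <= x -> x <= 1 - a -> trapezoid a x = 1.
Proof.
move=> a0 ax xa; rewrite /trapezoid min_l// le_min !ler_pdivlMr// !mul1r ax/=; lra.
Qed.

Lemma trapezoid_right a x : 0 < a -> a <= 1 / 2 -> 1 - a <= x -> x <= 1 -> trapezoid a x = (1 - x) / a.
Proof.
move=> a0 a1 xa x1; rewrite /trapezoid [Num.min (x / a) _]min_r.
  by rewrite min_r// ler_pdivrMr// mul1r; lra.
by rewrite ler_pM2r ?invr_gt0//; lra.
Qed.

Lemma trapezoid_concave a : 0 < a -> a <= 1 / 2 -> concave_unit (trapezoid a).
Proof.
move=> a0 a1; split.
- move=> x /andP[x0 x1]; rewrite /trapezoid !le_min !ge_min lexx ler01 !divr_ge0 ?(ltW a0)//.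
  by rewrite subr_ge0.
- apply: concave01_min; first by move=> x y z _ _ _ _; lra.
  apply: concave01_min; [apply: (@concave01_affine _ 0 (1 / a))|apply: (@concave01_affine _ (1 / a) (- (1 / a)))];
    by move=> x; ring.
- by exists (1 / 2); [apply/andP; split; lra|rewrite trapezoid_mid//; lra].
Qed.

Definition tent a x := Num.min (x / a) ((1 - x) / (1 - a)).

Lemma tent_left a x : 0 < a -> a < 1 -> x <= a -> tent a x = x / a.
Proof.
move=> a0 a1 xa; have a1' : 0 < 1 - a by rewrite subr_gt0.
by rewrite /tent min_l// ler_pdivrMr// mulrAC ler_pdivlMr//; nra.
Qed.

Lemma tent_right a x : 0 < a -> a < 1 -> a <= x -> tent a x = (1 - x) / (1 - a).
Proof.
move=> a0 a1 xa; have a1' : 0 < 1 - a by rewrite subr_gt0.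
by rewrite /tent min_r// ler_pdivrMr// mulrAC ler_pdivlMr//; nra.
Qed.

Lemma tent_concave a : 0 < a -> a < 1 -> concave_unit (tent a).
Proof.
move=> a0 a1; have a1' : 0 < 1 - a by rewrite subr_gt0.
split.
- move=> x /andP[x0 x1]; rewrite /tent le_min ge_min !divr_ge0 ?(ltW a0) ?(ltW a1') ?subr_ge0//=.
  have [xa|/ltW xa] := leP x a; apply/orP; [left|right]; rewrite ler_pdivrMr// mul1r//.
  by rewrite lerD2l lerN2.
- apply: concave01_min; [apply: (@concave01_affine _ 0 (1 / a))|
    apply: (@concave01_affine _ (1 / (1 - a)) (- (1 / (1 - a))))]; by move=> x; ring.
- by exists a; rewrite ?(ltW a0) ?(ltW a1)// tent_left// divff// gt_eqF.
Qed.

End ConcaveExamples.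

(** * Exponents at most 2 *)

Section ShortExponent.
Variables (R : realType) (nu : R) (k : nat).
Hypotheses (nu0 : 0 <= nu) (nu_half : nu <= 2^-1) (k0 : (0 < k)%N).
Let al := 2 * nu + 1.
Let j := bz nu 1.
(** Two extreme pieces of length [j/s] and [k - 1] inner pieces of length [pi/s] fill the unit
    interval. *)
Let s := 2 * j + (k%:R - 1) * pi.
Let a := j / s.
Implicit Types h : R -> R.

Let j1 : 1 <= j. Proof. exact: bz1_ge1. Qed.
Let j0 : 0 < j. Proof. exact: lt_le_trans j1. Qed.

Let kpi : 0 <= (k%:R - 1) * pi :> R.
Proof. by rewrite mulr_ge0 ?pi_ge0// subr_ge0 ler1n. Qed.

Let s0 : 0 < s. Proof. by rewrite ltr_pwDl// mulr_gt0. Qed.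
Let al1 : 1 <= al. Proof. exact: al_ge1. Qed.
Let al2 : al <= 2. Proof. by rewrite /al; move: nu_half; lra. Qed.
Let al0 : 0 < al. Proof. exact: lt_le_trans al1. Qed.
Let a0 : 0 < a. Proof. exact: divr_gt0. Qed.
Let a_half : a <= 1 / 2.
Proof. by rewrite /a ler_pdivrMr// /s; move: kpi; lra. Qed.

Definition short_node i : R :=
  if i is i'.+1 then (if i' == k then 1 else a + i'%:R * (pi / s)) else 0.
Local Notation node := short_node.

Let node1 : node 1 = a.
Proof. by rewrite /= eq_sym (gtn_eqF k0) mul0r addr0. Qed.

Let nodek1 : node k.+1 = 1. Proof. by rewrite /= eqxx. Qed.

Let nodek : node k = 1 - a.
Proof.
have kE : k = k.-1.+1 by rewrite prednK.
have kn : (k.-1 < k)%N by rewrite prednK.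
rewrite [in LHS]kE /= (ltn_eqF kn) -subn1 natrB//.
rewrite /a -[X in _ = X - _](divff (lt0r_neq0 s0)) mulrA -mulrDl -mulrBl; congr (_ / _).
by rewrite /s; ring.
Qed.

Let nodeS i : (0 < i)%N -> (i < k)%N -> node i.+1 = node i + pi / s.
Proof.
case: i => // i _ ik; rewrite /= (ltn_eqF ik) (ltn_eqF (ltn_trans (ltnSn i) ik)).
by rewrite -natr1; ring.
Qed.

Let node_lt i : (i <= k)%N -> node i < node i.+1.
Proof.
case: i => [_|i]; first by rewrite node1.
rewrite leq_eqVlt => /predU1P[ik|ik]; first by move: nodek nodek1; rewrite -ik => -> ->; rewrite ltrBlDr ltrDl.
by rewrite (nodeS (ltn0Sn i) ik) ltrDl divr_gt0// pi_gt0.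
Qed.

Let node_le i i' : (i <= i')%N -> (i' <= k.+1)%N -> node i <= node i'.
Proof.
elim: i' => [|i' IH]; first by rewrite leqn0 => /eqP->.
rewrite leq_eqVlt => /predU1P[->//|ii'] ik; apply: le_trans (IH ii' (ltnW ik)) _.
exact/ltW/node_lt.
Qed.

Let node_in i : (0 < i)%N -> (i < k)%N -> a <= node i /\ node i + pi / s <= 1 - a.
Proof.
move=> i0 ik; rewrite -nodeS// -nodek -[X in X <= _]node1; split; apply: node_le => //.
exact: ltnW (ltnW _).
Qed.

Let sva : s^-1 <= a.
Proof. by rewrite /a -[leLHS]mul1r ler_pM2r ?invr_gt0. Qed.

Lemma short_le h : concave_unit h -> (SLpow k al h <= (s ^+ 2)%:E)%E.
Proof.
move=> hL; apply: (@SLeigen_le _ k node) => //; first exact: concave_weight.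
have a1 : a <= 1 by move: a_half; lra.
case=> [_|i]; first by rewrite node1; exact: upper_bessel_left.
rewrite leq_eqVlt => /predU1P[ik|ik].
  by move: nodek nodek1; rewrite -ik => -> ->; exact: upper_bessel_right.
rewrite (nodeS (ltn0Sn i) ik); have [n1 n2] := node_in (ltn0Sn i) ik; apply: upper_sine => //.
  exact: le_trans sva n1.
by apply: (le_trans n2); rewrite lerD2l lerN2.
Qed.

(** Stated for a general profile to serve both the trapezoid and, when [alpha = 2], the profiles
    made of segments. *)
Lemma short_ge h : concave_unit h ->
  (exists2 m, 0 < m & {in `[0, a], forall x, h x = m * x}) ->
  (exists2 m, 0 < m & {in `[1 - a, 1], forall x, h x = m * (1 - x)}) ->
  (forall i, (0 < i)%N -> (i < k)%N -> exists m d, al / 2 * (al / 2 - 1) * d = 0 /\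
    {in `[node i, node i.+1], forall x, h x = m + d * x}) ->
  ((s ^+ 2)%:E <= SLpow k al h)%E.
Proof.
move=> hL [m1 m10 hm1] [m2 m20 hm2] hm; apply: (@SLeigen_ge _ k node) => //.
- exact: concave_weight.
- by rewrite exprn_ge0// ltW.
have sa : s * a = j by rewrite /a mulrC divfK// gt_eqF.
have a1 : a < 1 by move: a_half; lra.
case=> [_|i].
  rewrite node1; apply: (@lower_bessel _ _ nu0 _ s 0 a m1 0 1) => //.
  - by rewrite mulr1.
  - by move=> x; rewrite in_itv/= add0r mul1r => /andP[].
  - by move=> x; rewrite in_itv/= add0r mul1r => /andP[].
  - by move=> x; rewrite in_itv/= add0r mul1r => /andP[_ xa]; rewrite -[leRHS]sa ler_pM2l.
  - by move=> x; rewrite in_itv/= add0r mul1r => /andP[_ xa]; rewrite -[ltRHS]sa ltr_pM2l.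
  - by move=> x xx; rewrite add0r mul1r hm1.
  - by left; rewrite mulr0 addr0.
rewrite leq_eqVlt => /predU1P[ik|ik].
  move: nodek nodek1; rewrite -ik => -> ->.
  apply: (@lower_bessel _ _ nu0 _ s (1 - a) 1 m2 1 (-1)) => //.
  - by rewrite ltrBlDr ltrDl.
  - by rewrite mulrNN mulr1.
  - by move=> x; rewrite in_itv/= mulN1r subr_ge0 => /andP[].
  - by move=> x; rewrite in_itv/= mulN1r subr_gt0 => /andP[].
  - by move=> x; rewrite in_itv/= mulN1r => /andP[xa _]; rewrite -[leRHS]sa ler_pM2l// lerBlDr -lerBlDl.
  - by move=> x; rewrite in_itv/= mulN1r => /andP[xa _]; rewrite -[ltRHS]sa ltr_pM2l// ltrBlDr -ltrBlDl.
  - by move=> x xx; rewrite mulN1r hm2.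
  - by right; rewrite mulN1r subrr subr_gt0.
have [n1 n2] := node_in (ltn0Sn i) ik; have [m [d [cd hmd]]] := hm i.+1 isT ik.
rewrite (nodeS (ltn0Sn i) ik) in hmd *.
apply: (@lower_sine _ al s (node i.+1) s0 h m d cd) => //.
- exact: lt_le_trans a0 n1.
- by apply: le_lt_trans n2 _; rewrite ltrBlDr ltrDl.
- move=> x xx; rewrite -hmd//; apply: (concave_gt0 hL); move: xx; rewrite in_itv/= => /andP[h1 h2].
  by rewrite (lt_le_trans a0 (le_trans n1 h1))/= (le_lt_trans (le_trans h2 n2))// ltrBlDr ltrDl.
Qed.

Lemma short_trapezoid_ge : ((s ^+ 2)%:E <= SLpow k al (trapezoid a))%E.
Proof.
apply: short_ge; first exact: trapezoid_concave.
- exists a^-1; rewrite ?invr_gt0// => x; rewrite in_itv/= => /andP[x0 xa].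
  by rewrite trapezoid_left// mulrC.
- exists a^-1; rewrite ?invr_gt0// => x; rewrite in_itv/= => /andP[x0 xa].
  by rewrite trapezoid_right// mulrC.
- move=> i i0 ik; exists 1, 0; split; first by rewrite mulr0.
  have [n1 n2] := node_in i0 ik; rewrite nodeS// => x; rewrite in_itv/= => /andP[h1 h2].
  by rewrite mul0r addr0 trapezoid_mid// ?(le_trans n1)// (le_trans h2).
Qed.

Let sa_pi : j = pi -> s = k.+1%:R * pi.
Proof. by rewrite /s => ->; rewrite -natr1; ring. Qed.

Let a_pi : j = pi -> a = 1 / k.+1%:R.
Proof.
by move=> jpi; rewrite /a (sa_pi jpi) jpi invfM mulrCA divff ?mulr1 ?div1r// gt_eqF// pi_gt0.
Qed.

Let node_pi i : j = pi -> (i <= k.+1)%N -> node i = i%:R / k.+1%:R.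
Proof.
move=> jpi; case: i => [_|i]; first by rewrite mul0r.
rewrite leq_eqVlt eqSS => /predU1P[->|ik]; first by rewrite nodek1 divff// pnatr_eq0.
rewrite /= (ltn_eqF (ik : (i < k)%N)) (a_pi jpi).
rewrite (_ : pi / s = 1 / k.+1%:R); last by rewrite -jpi -/a a_pi.
by rewrite -[i.+1%:R]natr1 mulrA mulr1 -mulrDl addrC.
Qed.

(** When [j = pi] the nodes are the multiples of [1/(k+1)], and for [al = 2] the potential vanishes,
    so inner slopes are free. The zero values at the ends make the extreme segments proportional to
    [x] and [1 - x]. *)
Lemma short_segments_ge h : al = 2 -> j = pi -> concave_unit h -> h 0 = 0 -> h 1 = 0 ->
  graph_segments k.+1 h -> ((s ^+ 2)%:E <= SLpow k al h)%E.
Proof.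
move=> al2' jpi hL h0 h1 hs.
have seg i : (i <= k)%N -> exists m d, {in `[node i, node i.+1], forall x, h x = m + d * x}.
  move=> ik; have [d [m hE]] := hs i ik; exists m, d => x xx.
  have : node i <= x <= node i.+1 by exact: xx.
  by rewrite !node_pi//; [move=> xx'; rewrite (hE x xx') addrC|exact: ltnW].
have a1 : a < 1 by move: a_half; lra.
have a2 : 0 < a / 2 < 1 by apply/andP; split; move: a0 a1; lra.
apply: short_ge => //.
- have [m [d]] := seg 0%N isT; rewrite node1 [node 0]/= => hE.
  have m0 : m = 0 by have := hE 0; rewrite in_itv/= lexx ltW// h0 mulr0 addr0 => /(_ isT).
  have hE' : {in `[0, a], forall x, h x = d * x} by move=> x /hE; rewrite m0 add0r.
  have a2i : a / 2 \in `[0, a] by rewrite in_itv/=; apply/andP; split; move: a0; lra.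
  exists d => //; have := concave_gt0 hL a2; rewrite (hE' _ a2i) pmulr_lgt0//.
  by case/andP: a2.
- have [m [d]] := seg k (leqnn k); rewrite nodek nodek1 => hE.
  have m0 : m = - d.
    have := hE 1; rewrite in_itv/= lexx h1 mulr1 lerBlDr lerDl (ltW a0) => /(_ isT) H.
    by apply/eqP; rewrite -subr_eq0 opprK -H.
  have hE' : {in `[1 - a, 1], forall x, h x = - d * (1 - x)} by move=> x /hE ->; rewrite m0; ring.
  have a3 : 0 < 1 - a / 2 < 1 by apply/andP; split; move: a0 a1; lra.
  have a3i : 1 - a / 2 \in `[1 - a, 1] by rewrite in_itv/=; apply/andP; split; move: a0; lra.
  exists (- d) => //; have := concave_gt0 hL a3; rewrite (hE' _ a3i) pmulr_lgt0//.
  by rewrite subKr; case/andP: a2.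
- move=> i _ ik; have [m [d hE]] := seg i (ltnW ik); exists m, d; split => //.
  by rewrite al2' divff ?pnatr_eq0// subrr mulr0 mul0r.
Qed.

Lemma trapezoid_segments : j = pi -> graph_segments k.+1 (trapezoid a).
Proof.
move=> jpi i ik; have [i0|i0] := posnP i.
  exists (a^-1), 0 => x; rewrite i0 mul0r -(a_pi jpi) => /andP[x0 xa].
  by rewrite trapezoid_left// addr0 mulrC.
have [->|ik'] := eqVneq i k.
  exists (- a^-1), (a^-1) => x; rewrite -!node_pi// nodek nodek1 => /andP[x0 xa].
  by rewrite trapezoid_right//; ring.
have ik2 : (i < k)%N by rewrite ltn_neqAle ik'.
have [n1 n2] := node_in i0 ik2.
exists 0, 1 => x; rewrite -!node_pi//; last exact: ltnW.
rewrite nodeS// => /andP[h1 h2]; rewrite trapezoid_mid// ?mul0r ?add0r//.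
  exact: le_trans n1 h1.
exact: le_trans h2 n2.
Qed.

End ShortExponent.

Lemma bz0 (R : realType) (nu : R) : bz nu 0 = 0. Proof. by []. Qed.

(** * Exponents at least 2 *)

Section LongExponent.
Variables (R : realType) (nu : R) (k : nat).
Hypotheses (nu_half : 2^-1 <= nu) (k0 : (0 < k)%N).
Let al := 2 * nu + 1.
Let nl := k.+1./2.
Let nr := k.+2./2.
Let s := bz nu nl + bz nu nr.
Let a := bz nu nl / s.
Local Notation bz := (bz nu).
Implicit Types h : R -> R.

Let nu0 : 0 <= nu. Proof. by apply: le_trans nu_half; rewrite invr_ge0. Qed.
Let al0 : 0 < al. Proof. exact: lt_le_trans (al_ge1 nu0). Qed.

Let nlr : (nl + nr = k.+1)%N.
Proof. by have := uphalf_half k.+1; have := odd_double_half k.+1; rewrite /nl /nr; case: odd => /=; lia. Qed.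

Let nl0 : (0 < nl)%N. Proof. by rewrite /nl; lia. Qed.
Let nlr_le : (nl <= nr)%N. Proof. by rewrite /nl /nr; lia. Qed.
Let nrl_le : (nr <= nl.+1)%N. Proof. by rewrite /nl /nr; lia. Qed.

Let bz_pos n : (0 < n)%N -> 0 < bz n. Proof. by case: n => // n _; exact: bz_gt0. Qed.
Let s0 : 0 < s. Proof. by rewrite addr_gt0// bz_pos//; exact: leq_trans nlr_le. Qed.
Let a0 : 0 < a. Proof. by rewrite divr_gt0// bz_pos. Qed.

Let ar : 1 - bz nr / s = a.
Proof. by rewrite -[X in X - _](divff (lt0r_neq0 s0)) -mulrBl /s addrK. Qed.

Let a1 : a < 1.
Proof. by rewrite -ar ltrBlDr ltrDl divr_gt0// bz_pos//; exact: leq_trans nlr_le. Qed.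

Let bz_half n : (n <= nl)%N -> bz n / s <= 1 / 2.
Proof.
move=> nn; rewrite ler_pdivrMr//; have h1 := bz_le nu0 nn; have h2 := bz_le nu0 nlr_le.
rewrite /s; lra.
Qed.

(** The two formulas agree at [i = nl], where both give the apex [a]. *)
Definition long_node i : R := if (i < nl)%N then bz i / s else 1 - bz (k.+1 - i)%N / s.
Local Notation node := long_node.

Let node_left i : (i <= nl)%N -> node i = bz i / s.
Proof.
rewrite leq_eqVlt => /predU1P[->|il]; last by rewrite /node il.
by rewrite /node ltnn (_ : (k.+1 - nl)%N = nr) ?ar//; lia.
Qed.

Let node_right i : (nl <= i)%N -> node i = 1 - bz (k.+1 - i)%N / s.
Proof. by rewrite /node leqNgt => /negbTE->. Qed.

Let node0 : node 0 = 0. Proof. by rewrite node_left// bz0 mul0r. Qed.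

Let nodek1 : node k.+1 = 1.
Proof. by rewrite node_right ?subnn ?bz0 ?mul0r ?subr0//; lia. Qed.

Let node_lt i : (i <= k)%N -> node i < node i.+1.
Proof.
move=> ik; have [il|li] := ltnP i nl.
  by rewrite !node_left//; [rewrite ltr_pM2r ?invr_gt0// bz_lt|exact: ltnW].
rewrite !node_right//; last exact: ltnW.
by rewrite subSS subSn// ltrD2l ltrN2 ltr_pM2r ?invr_gt0// bz_lt.
Qed.

Let bz1s : bz 1 / s <= 1 / 2. Proof. exact: bz_half. Qed.

Lemma long_le h : concave_unit h -> (SLpow k al h <= (s ^+ 2)%:E)%E.
Proof.
move=> hL; apply: (@SLeigen_le _ k node) => //; first exact: concave_weight.
have b1 : bz 1 / s <= 1 by apply: le_trans bz1s _; lra.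
move=> i ik; have [il|li] := ltnP i nl.
  rewrite !node_left//; last exact: ltnW.
  case: i il {ik} => [_|i il]; last by apply: upper_wave_left => //; exact: bz_half.
  by rewrite bz0 mul0r; exact: upper_bessel_left.
rewrite !node_right//; last exact: ltnW.
rewrite subSS subSn//; case E : (k - i)%N => [|n].
  by rewrite bz0 mul0r subr0; exact: upper_bessel_right.
(* The remaining case occurs only for even [k]: the piece just after the apex, which is symmetric
   about [1/2]. *)
have [nn|nn] := leqP n.+2 nl; first by apply: upper_wave_right => //; exact: bz_half.
have nlE : nl = n.+1 by lia.
have nrE : nr = n.+2 by lia.
have E1 : 1 - bz n.+2 / s = bz n.+1 / s by rewrite -nrE ar /a nlE.
have E2 : 1 - bz n.+1 / s = bz n.+2 / s by rewrite -E1 opprB addrC subrK.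
rewrite E1 E2 /s nlE nrE; exact: upper_wave_middle.
Qed.

(** The apex is a node, so on every piece the tent is proportional to [x] or to [1 - x] and the
    corresponding wave is an exact solution. *)
Lemma long_ge : ((s ^+ 2)%:E <= SLpow k al (tent a))%E.
Proof.
apply: (@SLeigen_ge _ k node) => //.
- by apply: concave_weight => //; exact: tent_concave.
- by rewrite exprn_ge0// ltW.
have s00 := lt0r_neq0 s0.
have hleft x : x <= a -> tent a x = a^-1 * (0 + 1 * x).
  by move=> xa; rewrite tent_left// add0r mul1r mulrC.
have hright x : a <= x -> tent a x = (1 - a)^-1 * (1 + -1 * x).
  by move=> ax; rewrite tent_right// mulN1r mulrC.
have ai0 : 0 < a^-1 by rewrite invr_gt0.
have ai1 : 0 < (1 - a)^-1 by rewrite invr_gt0 subr_gt0.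
have ee : -1 * -1 = 1 :> R by ring.
have sK z : s * (z / s) = z by rewrite mulrC divfK.
have bzpos n : 0 < bz n.+1 / s by rewrite divr_gt0// bz_pos.
have bzle n m : (n <= m)%N -> bz n / s <= bz m / s by move=> nm; rewrite ler_pM2r ?invr_gt0// bz_le.
have b1 : bz 1 / s < 1 by apply: le_lt_trans bz1s _; lra.
move=> i ik; have [il|li] := ltnP i nl.
  rewrite !node_left//; last exact: ltnW.
  case: i il {ik} => [_|i il].
    rewrite bz0 mul0r.
    apply: (@lower_bessel _ _ nu0 _ s 0 (bz 1 / s) a^-1 0 1) => //.
    - by rewrite mulr1.
    - by move=> x; rewrite in_itv/= add0r mul1r => /andP[].
    - by move=> x; rewrite in_itv/= add0r mul1r => /andP[].
    - by move=> x; rewrite in_itv/= add0r mul1r => /andP[_ xa]; rewrite -[leRHS]sK ler_pM2l.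
    - by move=> x; rewrite in_itv/= add0r mul1r => /andP[_ xa]; rewrite -[ltRHS]sK ltr_pM2l.
    - move=> x; rewrite in_itv/= => /andP[_ xq]; apply: hleft; apply: le_trans xq _.
      exact: bzle.
    - by left; rewrite mulr0 addr0.
  have [pq t1 t2 t3] := left_wave_dom nu_half i s0.
  apply: (lower_wave nu_half s0 (mulr1 1) (bzpos i) pq _ t1 t2 (or_introl t3) ai0).
    by apply: (@le_lt_trans _ _ (1 / 2)); [exact: bz_half|lra].
  move=> x; rewrite in_itv/= => /andP[_ xq]; apply: hleft; apply: le_trans xq _.
  exact: bzle.
rewrite !node_right//; last exact: ltnW.
have knr : (k.+1 - i <= nr)%N by rewrite leq_subLR -nlr leq_add2r.
rewrite subSS subSn// in knr *; case E : (k - i)%N knr => [|n] knr.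
  rewrite bz0 mul0r subr0.
  have sp : s * (1 - (1 - bz 1 / s)) = bz 1 by rewrite opprB addrC subrK sK.
  apply: (@lower_bessel _ _ nu0 _ s (1 - bz 1 / s) 1 (1 - a)^-1 1 (-1)) => //.
  - by rewrite ltrBlDr ltrDl.
  - by move=> x; rewrite in_itv/= mulN1r subr_ge0 => /andP[].
  - by move=> x; rewrite in_itv/= mulN1r subr_gt0 => /andP[].
  - by move=> x; rewrite in_itv/= mulN1r => /andP[xa _]; rewrite -sp ler_pM2l// lerD2l lerN2.
  - by move=> x; rewrite in_itv/= mulN1r => /andP[xa _]; rewrite -sp ltr_pM2l// ltrD2l ltrN2.
  - move=> x; rewrite in_itv/= => /andP[px _]; apply: hright; apply: le_trans px.
    by rewrite -ar lerD2l lerN2; exact: bzle.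
  - by right; rewrite mulN1r subrr subr_gt0.
have [pq t1 t2 t3] := right_wave_dom nu_half n s0.
have p1 : a <= 1 - bz n.+2 / s by rewrite -ar lerD2l lerN2; exact: bzle.
apply: (lower_wave nu_half s0 ee (lt_le_trans a0 p1) pq _ t1 t2 (or_intror t3) ai1).
  by rewrite ltrBlDr ltrDl.
move=> x; rewrite in_itv/= => /andP[px _]; apply: hright; exact: le_trans px.
Qed.

End LongExponent.

Lemma solution_of (R : realType) (k : nat) (al M : R) (h : R -> R) :
  (forall g, concave_unit g -> (SLpow k al g <= M%:E)%E) -> concave_unit h ->
  (M%:E <= SLpow k al h)%E -> is_solution k al h /\ SLpow k al h = M%:E.
Proof.
move=> le_M hL ge_M; have E : SLpow k al h = M%:E by apply/eqP; rewrite eq_le le_M.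
split=> //; split; first exact/classLP.
rewrite E; apply/eqP; rewrite eq_le; apply/andP; split.
  by apply: ereal_sup_ubound; exists h => //; exact/classLP.
by apply: ge_ereal_sup => _ [g /classLP gL <-]; exact: le_M.
Qed.

Theorem theorem4p1 (R : realType) (alpha : R) (k : nat)
    (halpha : 1 <= alpha) (hk : (1 <= k)%N) :
  let nu := (alpha - 1) / 2 in
  exists hbar : R -> R,
    is_solution k alpha hbar /\
    [/\ (* (i) *)
        alpha < 2 ->
        let j := bessel_zero nu 1 in
        (k = 1%N ->
           SLpow k alpha hbar = ((2 * j) ^+ 2)%:E /\
           (forall x, 0 <= x <= 1 / 2 -> hbar x = 2 * x) /\
           (forall x, 1 / 2 <= x <= 1 -> hbar x = 2 * (1 - x))) /\
        ((2 <= k)%N ->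
           let a := j / (2 * j + (k%:R - 1) * pi) in
           SLpow k alpha hbar = ((2 * j + (k%:R - 1) * pi) ^+ 2)%:E /\
           (forall x, 0 <= x <= a -> hbar x = x / a) /\
           (forall x, a <= x <= 1 - a -> hbar x = 1) /\
           (forall x, 1 - a <= x <= 1 -> hbar x = (1 - x) / a)),
        (* (ii) *)
        alpha = 2 ->
        SLpow k alpha hbar = (((k%:R + 1) * pi) ^+ 2)%:E /\
        (hbar 0 = 0 /\ hbar 1 = 0 /\ graph_segments k.+1 hbar) /\
        (forall h : R -> R, classL h -> h 0 = 0 -> h 1 = 0 ->
           graph_segments k.+1 h -> is_solution k alpha h),
        (* (iii) *)
        2 < alpha -> odd k ->
        SLpow k alpha hbar = (4 * bessel_zero nu k.+1./2 ^+ 2)%:E /\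
        (forall x, 0 <= x <= 1 / 2 -> hbar x = 2 * x) /\
        (forall x, 1 / 2 <= x <= 1 -> hbar x = 2 * (1 - x))
      & (* (iv) *)
        2 < alpha -> ~~ odd k ->
        let j := bessel_zero nu k./2 in
        let j' := bessel_zero nu k.+2./2 in
        let a := j / (j + j') in
        SLpow k alpha hbar = ((j + j') ^+ 2)%:E /\
        (forall x, 0 <= x <= a -> hbar x = x / a) /\
        (forall x, a <= x <= 1 -> hbar x = (1 - x) / (1 - a))].
Proof.
move=> nu; have nu0 : 0 <= nu by rewrite divr_ge0// subr_ge0.
have alE : alpha = 2 * nu + 1 by rewrite /nu; field.
have bE n : (0 < n)%N -> bessel_zero nu n = bz nu n by case: n => // n _; exact: bessel_zeroE.
have [a2|a2] := leP alpha 2.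
  have nu_half : nu <= 2^-1 by rewrite /nu; lra.
  pose j := bz nu 1; pose s := 2 * j + (k%:R - 1) * pi; pose a := j / s.
  have j0 : 0 < j by exact: bz_gt0.
  have p0 := @pi_gt0 R.
  have kpi : 0 <= (k%:R - 1) * pi :> R by rewrite mulr_ge0 ?subr_ge0 ?ler1n// ltW.
  have s0 : 0 < s by rewrite ltr_pwDl// mulr_gt0.
  have a0 : 0 < a by rewrite divr_gt0.
  have ah : a <= 1 / 2 by rewrite ler_pdivrMr// /s; lra.
  have le_M := short_le nu0 nu_half hk; rewrite -alE in le_M.
  have ge_M := short_trapezoid_ge nu0 hk; rewrite -alE in ge_M.
  have [sol val] := solution_of le_M (trapezoid_concave a0 ah) ge_M.
  (* One witness serves [alpha < 2] and [alpha = 2]; for [k = 1] one has [a = 1/2], and the plateau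
     shrinks to a point. *)
  exists (trapezoid a); split; first exact: sol.
  split.
  - move=> _; rewrite bE//; split=> [k1|_].
      have sE : s = 2 * j by rewrite /s k1 subrr mul0r addr0.
      have aE : a = 1 / 2 by rewrite /a sE; field; rewrite gt_eqF.
      rewrite val -/j -/s sE; split=> //; split=> x /andP[x1 x2].
        by rewrite trapezoid_left// aE//; field.
      by rewrite trapezoid_right// aE//; [field|lra].
    split=> //; split; [|split] => x /andP[x1 x2].
    + exact: trapezoid_left.
    + exact: trapezoid_mid.
    + exact: trapezoid_right.
  - move=> al2; have nuE : nu = 2^-1 by rewrite /nu al2; field.
    have jpi : j = pi by rewrite /j nuE bz1_half.
    have sE : s = (k%:R + 1) * pi by rewrite /s jpi; ring.
    split; first by rewrite val -/j -/s sE.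
    split.
      split; first by rewrite trapezoid_left ?mul0r// ltW.
      split; first by rewrite trapezoid_right ?subrr ?mul0r// lerBlDr lerDl ltW.
      exact: trapezoid_segments.
    move=> h /classLP hL h0 h1 hs; have := short_segments_ge nu0 hk _ jpi hL h0 h1 hs.
    by rewrite -alE => /(_ al2) /(solution_of le_M hL) [].
  - by [].
  - by [].
have nu_half : 2^-1 <= nu by rewrite /nu; lra.
pose nl := k.+1./2; pose nr := k.+2./2.
have nl0 : (0 < nl)%N by rewrite /nl; lia.
have nr0 : (0 < nr)%N by rewrite /nr; lia.
pose s := bz nu nl + bz nu nr; pose a := bz nu nl / s.
have z0 n : (0 < n)%N -> 0 < bz nu n by case: n => // n _; exact: bz_gt0.
have s0 : 0 < s by rewrite addr_gt0 ?z0.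
have a0 : 0 < a by rewrite divr_gt0 ?z0.
have a1 : a < 1 by rewrite ltr_pdivrMr// mul1r /s ltrDl z0.
have le_M := long_le nu_half hk; rewrite -alE in le_M.
have ge_M := long_ge nu_half hk; rewrite -alE in ge_M.
have [sol val] := solution_of le_M (tent_concave a0 a1) ge_M.
exists (tent a); split; first exact: sol.
split.
- by rewrite ltNge (ltW a2).
- by move=> al2; rewrite al2 ltxx in a2.
(* For odd [k] the two halves have equally many pieces, which puts the apex at [1/2]. *)
- move=> _ ok; have nlr : nr = nl by rewrite /nr /nl; lia.
  have zn : bz nu nl != 0 by rewrite gt_eqF// z0.
  have sE : s = 2 * bz nu nl by rewrite /s nlr; ring.
  have aE : a = 1 / 2 by rewrite /a sE invfM mulrCA divff ?mulr1 ?div1r.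
  rewrite val bE// -/nl -/nr nlr; split; first by congr EFin; ring.
  split=> x /andP[x1 x2].
    by rewrite tent_left// aE//; field.
  by rewrite tent_right// aE//; field.
- move=> _ ok; have nlE : k./2 = nl by rewrite /nl; lia.
  rewrite !bE// nlE//; split=> //.
  split=> x /andP[x1 x2]; [exact: tent_left|exact: tent_right].
Qed.
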